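(* Let $n\ge 1$ and $d\ge 1$ be integers and let $A=(A_0,\ldots,A_d)\in(\mathbb{C}^{n\times n})^{d+1}\equiv\mathbb{C}^{(d+1)n^2}$ be chosen at random with independent entries with distribution $\mathcal{N}_{\mathbb{C}}(0,1)$. Then $$\mathrm{E}_{A}\left(\mu_{\mathrm{max}}(A)^2\right)\leq\bigl((d+1)n^2-1\bigr)n,$$ and in particular $$\mathrm{E}_{A}\left(\log\left(\mu_{\mathrm{max}}(A)\right)\right)\leq \frac32\log n+\frac12\log(d+1).$$
   Context: $\mathcal{N}_{\mathbb{C}}(0,1)$ has density $\frac1\pi e^{-|z|^2}$ on $\mathbb{C}$, so the density of $A$ on $\mathbb{C}^{(d+1)n^2}$ is $\pi^{-(d+1)n^2}e^{-\|A\|_F^2}$, where $\|A\|_F^2=\sum_{k=0}^d\|A_k\|_F^2$ (Frobenius norm). $\mathbb{P}(\mathbb{C}^2)$ is the complex projective line; points are written by homogeneous representatives $(\alpha,\beta)$. Polynomial eigenvalue problem (PEVP): for $A=(A_0,\ldots,A_d)\in(\mathbb{C}^{n\times n})^{d+1}$ put $$P(A,\alpha,\beta)=\sum_{k=0}^d\alpha^k\beta^{d-k}A_k ,\qquad \mathrm{Eig}(A)=\{(\alpha,\beta)\in\mathbb{P}(\mathbb{C}^2):\det P(A,\alpha,\beta)=0\}.$$ Elements of $\mathrm{Eig}(A)$ are the eigenvalues of $A$; for generic $A$ there are $dn$ of them. Right and left eigenvectors associated with $(\alpha,\beta)\in\mathrm{Eig}(A)$ are nonzero $x,y\in\mathbb{C}^n$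 with $P(A,\alpha,\beta)x=0$ and $y^*P(A,\alpha,\beta)=0$. Condition number: for $(\alpha,\beta)\in\mathrm{Eig}(A)$ with right and left eigenvectors $x,y$, $$\mu(A,(\alpha,\beta))=\left(\sum_{k=0}^d|\alpha|^{2k}|\beta|^{2d-2k}\right)^{1/2}\frac{\|x\|\,\|y\|}{|y^*v|}\,\|A\|_F,\qquad v=\bar\beta\,\frac{\partial P}{\partial\alpha}(A,\alpha,\beta)\,x-\bar\alpha\,\frac{\partial P}{\partial\beta}(A,\alpha,\beta)\,x,$$ where $\|\cdot\|$ is the Euclidean norm on $\mathbb{C}^n$. This is independent of the representatives of $(\alpha,\beta)$, $x$, $y$. It equals $\|A\|_F$ times the operator norm of the derivative of the local solution map sending an input to its eigenvalue (with the Fubini–Study metric on $\mathbb{P}(\mathbb{C}^2)$), and $\mu(A,(\alpha,\beta))=\infty$ when the derivative of $\det P(A,\cdot)$ at $(\alpha,\beta)$ in the direction tangent to $\mathbb{P}(\mathbb{C}^2)$ vanishes. Finally, $\displaystyle\mu_{\mathrm{max}}(A)=\max_{(\alpha,\beta)\in \mathrm{Eig}(A)}\mu(A,(\alpha,\beta))$. *)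

(* Defs.v *)
From HB Require Import structures.
From mathcomp Require Import all_boot all_order all_algebra.
From mathcomp Require Import all_classical all_reals all_analysis.
From mathcomp.real_closed Require Import complex.

Set Implicit Arguments.
Unset Strict Implicit.
Unset Printing Implicit Defensive.

Import Order.TTheory GRing.Theory Num.Theory.
Import numFieldNormedType.Exports.

Local Open Scope classical_set_scope.
Local Open Scope complex_scope.
Local Open Scope ring_scope.

(* The ring S is arbitrary so that the same expression can be evaluated at
   scalars and at polynomials; the latter yields the derivatives below. *)
Definition pevp (S : comNzRingType) (n d : nat) (A : 'I_d.+1 -> 'M[S]_n)
    (a b : S) : 'M[S]_n :=
  \sum_(k < d.+1) (a ^+ k * b ^+ (d - k)) *: A k.

Definition polyc_mx (S : comNzRingType) (n d : nat) (A : 'I_d.+1 -> 'M[S]_n) :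
    'I_d.+1 -> 'M[{poly S}]_n :=
  fun k => map_mx polyC (A k).

Definition pevp_dalpha (S : comNzRingType) (n d : nat)
    (A : 'I_d.+1 -> 'M[S]_n) (a b : S) : 'M[S]_n :=
  \matrix_(i, j) ((pevp (polyc_mx A) 'X b%:P) i j)^`().[a].

Definition pevp_dbeta (S : comNzRingType) (n d : nat)
    (A : 'I_d.+1 -> 'M[S]_n) (a b : S) : 'M[S]_n :=
  \matrix_(i, j) ((pevp (polyc_mx A) a%:P 'X) i j)^`().[b].

Section ConditionNumber.
Variables (R : realType) (n d : nat).
Implicit Types (A : 'I_d.+1 -> 'M[R[i]]_n) (a b : R[i]) (x y : 'cV[R[i]]_n).

(* On column vectors this is the Euclidean norm; Normc.normc is the R-valued modulus
   (the norm `|z| of the library takes its values in R[i]). *)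
Definition fnorm (p q : nat) (M : 'M[R[i]]_(p, q)) : R :=
  Num.sqrt (\sum_i \sum_j Normc.normc (M i j) ^+ 2).

Definition tuple_fnorm A : R := Num.sqrt (\sum_k fnorm (A k) ^+ 2).

(* Points of the projective line are represented by all their nonzero
   homogeneous representatives. *)
Definition Eig A : set (R[i] * R[i]) :=
  [set ab | ab != 0 /\ \det (pevp A ab.1 ab.2) = 0].

Definition adjoint y : 'rV[R[i]]_n := (map_mx Num.conj y)^T.

Definition right_eigenvector A a b : set 'cV[R[i]]_n :=
  [set x | x != 0 /\ pevp A a b *m x = 0].

Definition left_eigenvector A a b : set 'cV[R[i]]_n :=
  [set y | y != 0 /\ adjoint y *m pevp A a b = 0].

(* The value at t = 0 of the derivative of
   t |-> det P(A, a + t b^*, b - t a^* ): the vector (b^*, - a^* ) spans the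
   orthogonal complement of (a, b), i.e. the tangent line to P(C^2). *)
Definition tangent_det_derivative A a b : R[i] :=
  (\det (pevp (polyc_mx A) (a%:P + (Num.conj b)%:P * 'X)
                           (b%:P - (Num.conj a)%:P * 'X)))^`().[0].

Definition mu_formula A a b x y : R :=
  let v := Num.conj b *: (pevp_dalpha A a b *m x)
           - Num.conj a *: (pevp_dbeta A a b *m x) in
  Num.sqrt (\sum_(k < d.+1) Normc.normc a ^+ (2 * k) * Normc.normc b ^+ (2 * d - 2 * k))
  * (fnorm x * fnorm y / Normc.normc ((adjoint y *m v) 0 0)) * tuple_fnorm A.

(* If the tangent derivative does not vanish, both kernels are lines, y^* v is
   nonzero and mu_formula takes the same value at all pairs (x, y) of
   eigenvectors: the supremum is over a singleton. *)
Definition mu A a b : \bar R :=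
  if tangent_det_derivative A a b == 0 then +oo%E
  else ereal_sup [set (mu_formula A a b xy.1 xy.2)%:E |
         xy in right_eigenvector A a b `*` left_eigenvector A a b].

(* The supremum is attained as soon as n, d >= 1: Eig A then consists of
   finitely many projective points, or it is all of P(C^2) and mu is +oo. *)
Definition mu_max A : \bar R := ereal_sup [set mu A ab.1 ab.2 | ab in Eig A].

End ConditionNumber.

Section GaussianEntries.
Context (R : realType) (disp : measure_display) (T : measurableType disp).
Variable P : probability T R.

(* R[i] carries no measurable structure in the library: C is identified with
   R * R, with its product Borel sets and product Lebesgue measure. *)
Definition re_im (z : R[i]) : R * R := (complex.Re z, complex.Im z).

Definition complex_normal (B : set (R * R)) : \bar R :=
  \int[(lebesgue_measure \x lebesgue_measure)%E]_(z in B)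
    (pi^-1 * expR (- Normc.normc (z.1 +i* z.2) ^+ 2))%:E.

Definition mutually_independent (disp' : measure_display)
    (E : measurableType disp') (I : finType) (X : I -> T -> E) : Prop :=
  forall (J : {set I}) (B : I -> set E), (forall i, measurable (B i)) ->
    P (\bigcap_(i in [set` J]) X i @^-1` B i)
    = (\prod_(i in J) P (X i @^-1` B i))%E.

Definition iid_complex_normal_entries (n d : nat)
    (A : T -> 'I_d.+1 -> 'M[R[i]]_n) : Prop :=
  let X (e : 'I_d.+1 * 'I_n * 'I_n) (w : T) :=
    re_im (A w e.1.1 e.1.2 e.2) in
  [/\ forall e, measurable_fun setT (X e),
      forall e (B : set (R * R)), measurable B ->
        P (X e @^-1` B) = complex_normal B
    & mutually_independent X].

End GaussianEntries.

(* Main.v *)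
(* For a simple finite eigenvalue [(z, 1)], [mu(A, (z, 1))^2] is at most
   [w(A, z) / |f'(z)|^2], where [f(z) = det P(A, z, 1)] and
   [w(A, z) = (1 + |z|^2)^-2 * sum_k |z|^(2k) * |adj P(A, z, 1)|^2 * |A|^2].
   The maximum over the zeros of [f] is therefore at most the liminf, as
   [t -> oo], of [int_z (t / pi) exp (- t |f(z)|^2) w(A, z) dz], since every
   simple zero alone contributes [w / |f'|^2] in the limit.

   For fixed [z], [f(z)] is a linear form in the Gaussian entries of the [j]-th
   column of the [A_k], with coefficients independent of that column and sum of
   squared moduli [S_j]; and [w] is [(1 + |z|^2)^-2 * sum_j S_j * |A|^2].
   Integrating out column [j] gives
   [E (t S_j |A|^2 exp (- t |f(z)|^2)) <= (d + 1) n^2 - 1 + o(1)]: every entry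
   contributes 1, except that the form itself is forced to be small.
   As [int_z (1 + |z|^2)^-2 = pi], Tonelli and Fatou give the first bound; the
   second one follows from [ln x <= (x^2 / c - 1 + ln c) / 2].

   Infinite and multiple eigenvalues are avoided by adding to the integral
   [6^k (int_z (1 + |z|^2)^-2 exp (- 16^k |f(z)|^2) + exp (- 16^k |det A_d|^2))]:
   its expectation is [O((3/4)^k)], but it tends to infinity at every [A] with
   [det A_d = 0] or with a double zero of [f].  The resulting
   measurable majorant is valid at every [A], so that the measurability of
   [mu_max] plays no role. *)

From HB Require Import structures.
Require Import Defs.
From mathcomp Require Import all_boot all_order all_fingroup all_algebra.
From mathcomp Require Import all_classical all_reals all_analysis.
From mathcomp.real_closed Require Import complex.
From mathcomp Require Import measurable_realfun ring lra.

Set Implicit Arguments.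
Unset Strict Implicit.
Unset Printing Implicit Defensive.

Import Order.TTheory GRing.Theory Num.Theory.
Import numFieldNormedType.Exports.

Local Open Scope classical_set_scope.
Local Open Scope ring_scope.

(** * Squared moduli, measurability and Gaussian integrals *)

(** Only inequalities are proved; no change of variables, area formula or polar coordinates enters.
    A simple zero of [f] is detected from below by comparison with a Gaussian centred at it, and the
    mass of [(1 + |z|^2)^-2] is obtained by writing this function as a Gaussian second moment.
    Columns are integrated out one entry at a time, by replacing a single entry with a fresh
    Gaussian one: functions of the shape [phi * exp (- t |c + u g|^2)] keep their shape under this
    operation.

    The rates 16, 8, 6 and 4 fit together as follows. Near a double zero, [16^k |f|^2] stays bounded
    on a disc of area of order [4^-k], whereas [exp (- 16^k |det|^2)] has mean [O(8^-k)]. The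
    induction on minors behind this mean loses a power of [k] against [16^-k], and the base 8
    absorbs it. A factor strictly between [4^k] and [8^k] then separates the two effects; it is
    [6^k]. *)

Section ComplexModulus.
Variable R : realType.
Implicit Types (z w : R[i]).

Definition nsq z : R := complex.Re z ^+ 2 + complex.Im z ^+ 2.

Definition toC (p : R * R) : R[i] := Complex p.1 p.2.

Lemma nsqE z : nsq z = complex.Re z ^+ 2 + complex.Im z ^+ 2.
Proof. by []. Qed.

Lemma nsq_ge0 z : 0 <= nsq z.
Proof. by rewrite addr_ge0 ?sqr_ge0. Qed.

Lemma normc_sqr z : Normc.normc z ^+ 2 = nsq z.
Proof. by case: z => a b; rewrite /nsq /= sqr_sqrtr // addr_ge0 ?sqr_ge0. Qed.

Lemma normc_ge0 z : 0 <= Normc.normc z.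
Proof. by case: z => a b; rewrite sqrtr_ge0. Qed.

Lemma nsqM z w : nsq (z * w) = nsq z * nsq w.
Proof. by case: z w => a b [c d]; rewrite /nsq /=; ring. Qed.

Lemma nsq0 : nsq 0 = 0.
Proof. by rewrite /nsq /= expr0n /= addr0. Qed.

Lemma nsq1 : nsq 1 = 1.
Proof. by rewrite /nsq /= expr0n /= addr0 expr1n. Qed.

Lemma nsq_eq0 z : (nsq z == 0) = (z == 0).
Proof.
by case: z => a b; rewrite /nsq /= paddr_eq0 ?sqr_ge0 // !sqrf_eq0 eq_complex.
Qed.

Lemma nsqX z k : nsq (z ^+ k) = nsq z ^+ k.
Proof.
by elim: k => [|k IH]; rewrite ?expr0 ?nsq1 // !exprS nsqM IH.
Qed.

Lemma nsq_conj z : nsq (Num.conj z) = nsq z.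
Proof. by case: z => a b; rewrite /nsq /= sqrrN. Qed.

Lemma nsqD_le z w : nsq (z + w) <= 2 * nsq z + 2 * nsq w.
Proof.
case: z w => a b [c d]; rewrite /nsq /=.
have := sqr_ge0 (a - c); have := sqr_ge0 (b - d); nra.
Qed.

Lemma re_imK z : toC (re_im z) = z.
Proof. by case: z. Qed.

End ComplexModulus.

Section ComplexMeasurability.
Variables (R : realType) (d : measure_display) (X : measurableType d).
Implicit Types f g : X -> R[i].

Definition cmeasurable f :=
  measurable_fun setT (fun x => complex.Re (f x)) /\
  measurable_fun setT (fun x => complex.Im (f x)).

Lemma cmeasurable_cst z : cmeasurable (fun=> z).
Proof. by split; exact: measurable_cst. Qed.

Lemma cmeasurableD f g : cmeasurable f -> cmeasurable g ->
  cmeasurable (fun x => f x + g x).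
Proof.
move=> [f1 f2] [g1 g2]; split.
- rewrite (_ : (fun _ => _) = (fun x => complex.Re (f x) + complex.Re (g x))).
    exact: measurable_funD.
  by apply/funext => x; case: (f x) (g x) => ? ? [].
- rewrite (_ : (fun _ => _) = (fun x => complex.Im (f x) + complex.Im (g x))).
    exact: measurable_funD.
  by apply/funext => x; case: (f x) (g x) => ? ? [].
Qed.

Lemma cmeasurableM f g : cmeasurable f -> cmeasurable g ->
  cmeasurable (fun x => f x * g x).
Proof.
move=> [f1 f2] [g1 g2]; split.
- rewrite (_ : (fun _ => _) = (fun x => complex.Re (f x) * complex.Re (g x)
     - complex.Im (f x) * complex.Im (g x))).
    by apply: measurable_funB; exact: measurable_funM.
  by apply/funext => x; case: (f x) (g x) => ? ? [].
- rewrite (_ : (fun _ => _) = (fun x => complex.Re (f x) * complex.Im (g x)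
     + complex.Im (f x) * complex.Re (g x))).
    by apply: measurable_funD; exact: measurable_funM.
  by apply/funext => x; case: (f x) (g x) => ? ? [].
Qed.

Lemma cmeasurableX f k : cmeasurable f -> cmeasurable (fun x => f x ^+ k).
Proof.
move=> mf; elim: k => [|k IH].
  by rewrite (_ : (fun _ => _) = fun=> 1) //; exact: cmeasurable_cst.
rewrite (_ : (fun _ => _) = fun x => f x * f x ^+ k); first exact: cmeasurableM.
by apply/funext => x; rewrite exprS.
Qed.

Lemma cmeasurable_sum (J : Type) (s : seq J) (P : pred J) (F : J -> X -> R[i]) :
  (forall j, cmeasurable (F j)) ->
  cmeasurable (fun x => \sum_(j <- s | P j) F j x).
Proof.
move=> mF; elim: s => [|j s IH].
  by under eq_fun do rewrite big_nil; exact: cmeasurable_cst.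
under eq_fun do rewrite big_cons.
by case: (P j) => //; exact: cmeasurableD.
Qed.

Lemma cmeasurable_prod (J : Type) (s : seq J) (P : pred J) (F : J -> X -> R[i]) :
  (forall j, cmeasurable (F j)) ->
  cmeasurable (fun x => \prod_(j <- s | P j) F j x).
Proof.
move=> mF; elim: s => [|j s IH].
  by under eq_fun do rewrite big_nil; exact: cmeasurable_cst.
under eq_fun do rewrite big_cons.
by case: (P j) => //; exact: cmeasurableM.
Qed.

Lemma cmeasurable_det n (M : X -> 'M[R[i]]_n) :
  (forall i j, cmeasurable (fun x => M x i j)) ->
  cmeasurable (fun x => \det (M x)).
Proof.
move=> mM; rewrite /determinant; apply: cmeasurable_sum => s.
by apply: cmeasurableM; [exact: cmeasurable_cst|exact: cmeasurable_prod].
Qed.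

Lemma measurable_nsq f : cmeasurable f -> measurable_fun setT (fun x => nsq (f x)).
Proof.
by move=> [f1 f2]; apply: measurable_funD; exact: measurable_funX.
Qed.

Lemma measurable_inv_pos (f : X -> R) : measurable_fun setT f ->
  (forall x, 0 < f x) -> measurable_fun setT (fun x => (f x)^-1).
Proof.
move=> mf f0.
rewrite (_ : (fun _ => _) = fun x => expR (- ln (f x))).
  apply: measurableT_comp => //; apply: measurable_funN.
  exact: measurableT_comp.
by apply/funext => x; rewrite expRN lnK // posrE.
Qed.

End ComplexMeasurability.

Lemma cmeasurable_toC (R : realType) : cmeasurable (@toC R).
Proof. by split; [exact: measurable_fst|exact: measurable_snd]. Qed.

Section GaussianIntegral.
Variable R : realType.
Local Notation leb := (@lebesgue_measure R).
Local Notation leb2 := (leb \x leb)%E.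

Lemma integral_gauss_shift (a b : R) : 0 < a ->
  (\int[leb]_x (expR (- (a * (x + b) ^+ 2)))%:E = (Num.sqrt (pi / a))%:E)%E.
Proof.
(* With variance [1 / (2 a)] and mean [- b], the integrand is the normal density divided by its
   peak. *)
move=> a0; pose s := Num.sqrt ((2 * a)^-1).
have s2 : s ^+ 2 = (2 * a)^-1 by rewrite sqr_sqrtr // invr_ge0 mulr_ge0 // ltW.
have s0 : s != 0 by rewrite sqrtr_eq0 -ltNge invr_gt0 mulr_gt0.
have pk : normal_peak s = (Num.sqrt (pi / a))^-1.
  rewrite /normal_peak s2; congr (Num.sqrt _)^-1; field.
  by rewrite gt_eqF.
have pa : 0 < Num.sqrt (pi / a) by rewrite sqrtr_gt0 divr_gt0 ?pi_gt0.
have E x : expR (- (a * (x + b) ^+ 2)) =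
    Num.sqrt (pi / a) * normal_pdf (- b) s x.
  rewrite normal_pdfE //= pk mulVKf ?gt_eqF //.
  rewrite /normal_fun opprK s2; congr expR; field.
  by rewrite gt_eqF.
under eq_integral do rewrite E EFinM.
rewrite ge0_integralZl_EFin //=.
- by rewrite integral_normal_pdf mule1.
- by move=> x _; rewrite lee_fin normal_pdf_ge0.
- by apply/measurable_EFinP; exact: measurable_normal_pdf.
Qed.

Lemma measurable_gauss2 (a b c : R) :
  measurable_fun setT
    (fun p : R * R => expR (- (a * ((p.1 + b) ^+ 2 + (p.2 + c) ^+ 2)))).
Proof.
apply: measurableT_comp => //; apply: measurable_funN.
by apply: measurable_funM => //; apply: measurable_funD; apply: measurable_funX;
  apply: measurable_funD.
Qed.

Lemma integral_gauss2 (a b c : R) : 0 < a ->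
  (\int[leb2]_p (expR (- (a * ((p.1 + b) ^+ 2 + (p.2 + c) ^+ 2))))%:E
   = (pi / a)%:E)%E.
Proof.
move=> a0.
rewrite fubini_tonelli1; last 2 first.
- by apply/measurable_EFinP; exact: measurable_gauss2.
- by move=> p; rewrite lee_fin expR_ge0.
rewrite /fubini_F /=.
have E x y : expR (- (a * ((x + b) ^+ 2 + (y + c) ^+ 2))) =
   expR (- (a * (x + b) ^+ 2)) * expR (- (a * (y + c) ^+ 2)).
  by rewrite -expRD; congr expR; ring.
under eq_integral => x _.
  under eq_integral => y _ do rewrite E EFinM.
  rewrite ge0_integralZl_EFin ?expR_ge0 //=; last first.
    apply/measurable_EFinP; apply: measurableT_comp => //.
    apply: measurable_funN; apply: measurable_funM => //.
    by apply: measurable_funX; apply: measurable_funD.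
  rewrite integral_gauss_shift // muleC.
  over.
rewrite ge0_integralZl_EFin ?sqrtr_ge0 //=; last first.
  apply/measurable_EFinP; apply: measurableT_comp => //.
  apply: measurable_funN; apply: measurable_funM => //.
  by apply: measurable_funX; apply: measurable_funD.
by rewrite integral_gauss_shift // -EFinM -expr2 sqr_sqrtr // divr_ge0 ?pi_ge0 // ltW.
Qed.

Lemma measurable_gauss_affine (l t : R) (u c : R[i]) :
  measurable_fun setT
   (fun p : R * R => expR (- (l * nsq (toC p) + t * nsq (u * toC p + c)))).
Proof.
have mC := @cmeasurable_toC R.
apply: measurableT_comp => //; apply: measurable_funN.
apply: measurable_funD; apply: measurable_funM => //; apply: measurable_nsq => //.
apply: cmeasurableD; last exact: cmeasurable_cst.
by apply: cmeasurableM => //; exact: cmeasurable_cst.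
Qed.

(* Completing the square in the complex variable p. *)
Lemma integral_gauss_affine (l t : R) (u c : R[i]) :
  0 < l -> 0 <= t ->
  (\int[leb2]_p (expR (- (l * nsq (toC p) + t * nsq (u * toC p + c))))%:E
   = (pi / (l + t * nsq u) * expR (- (t * l * nsq c / (l + t * nsq u))))%:E)%E.
Proof.
move=> l0 t0.
have D0 : 0 < l + t * nsq u by rewrite ltr_wpDr // mulr_ge0 // nsq_ge0.
pose D := l + t * nsq u.
(* [b + i q = t * conj u * c / D] is minus the centre of the Gaussian in [p]. *)
pose b := t * (complex.Re u * complex.Re c + complex.Im u * complex.Im c) / D.
pose q := t * (complex.Re u * complex.Im c - complex.Im u * complex.Re c) / D.
have E (p : R * R) : expR (- (l * nsq (toC p) + t * nsq (u * toC p + c))) =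
   expR (- (t * l * nsq c / D)) *
   expR (- (D * ((p.1 + b) ^+ 2 + (p.2 + q) ^+ 2))).
  rewrite -expRD; congr expR; rewrite /b /q /D.
  case: p u c D0 {D b q} => x y [u1 u2] [c1 c2]; rewrite /nsq /= => D0.
  by field; rewrite gt_eqF.
under eq_integral do rewrite E EFinM.
rewrite ge0_integralZl_EFin ?expR_ge0 //=.
- by rewrite integral_gauss2 // -EFinM mulrC.
- by apply/measurable_EFinP; exact: measurable_gauss2.
Qed.

End GaussianIntegral.

Global Opaque nsq.

(** * Resampling one Gaussian entry *)

Section DensityIntegral.
Context d (T : measurableType d) (R : realType).
Variables (nu mu : {measure set T -> \bar R}) (f : T -> R).
Hypotheses (mf : measurable_fun setT f) (f0 : forall x, 0 <= f x).
Hypothesis nuE : forall B, measurable B ->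
  nu B = (\int[mu]_(x in B) (f x)%:E)%E.

Import HBNNSimple.

Let mfE : measurable_fun setT (EFin \o f).
Proof. exact/measurable_EFinP. Qed.

Let integral_density_nnsfun (h : {nnsfun T >-> R}) :
  (\int[nu]_x (h x)%:E = \int[mu]_x ((h x)%:E * (f x)%:E))%E.
Proof.
rewrite integralT_nnsfun sintegralE.
rewrite [RHS](_ : _ = (\int[mu]_x
  (\sum_(y \in range h) ((y * \1_(h @^-1` [set y]) x)%:E * (f x)%:E)))%E); last first.
  apply: eq_integral => x _; rewrite [in LHS]fimfunE -fsumEFin //.
  rewrite ge0_mule_fsuml // => y.
  exact: (nnfun_muleindic_ge0 h).
have mi y : measurable_fun setT (fun x => (y * \1_(h @^-1` [set y]) x)%:E).
  by apply/measurable_EFinP; exact: measurable_funM.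
rewrite ge0_integral_fsum //=; last 2 first.
- by move=> y; apply: emeasurable_funM.
- by move=> y x _; rewrite mule_ge0 ?lee_fin //; exact: (nnfun_muleindic_ge0 h).
apply: eq_fsbigr => y; rewrite inE => -[x0 _ hx0].
have y0 : 0 <= y by rewrite -hx0.
have mA : measurable (h @^-1` [set y]) by exact: measurable_sfunP.
under eq_integral do rewrite EFinM -muleA.
rewrite ge0_integralZl_EFin //=; last 2 first.
- by move=> x _; rewrite mule_ge0 ?lee_fin.
- by apply: emeasurable_funM => //; apply/measurable_EFinP; exact: measurable_indic.
rewrite nuE // integral_mkcond; congr (_ * _)%E.
by apply: eq_integral => x _; rewrite epatch_indic /= muleC.
Qed.

(** Carries the law of an entry, known on sets through [complex_normal], over to integrands: simple
    functions, then monotone convergence. *)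
Lemma ge0_integral_density (h : T -> \bar R) : measurable_fun setT h ->
  (forall x, 0 <= h x)%E ->
  (\int[nu]_x h x = \int[mu]_x (h x * (f x)%:E))%E.
Proof.
move=> mh h0; pose g := nnsfun_approx measurableT mh.
have gh x : (g n x)%:E @[n --> \oo] --> h x by exact: cvg_nnsfun_approx.
have gnd x m n : (m <= n)%N -> ((g m x)%:E <= (g n x)%:E)%E.
  by move=> mn; rewrite lee_fin; exact/lefP/nd_nnsfun_approx.
transitivity (limn (fun n => \int[nu]_x (g n x)%:E)%E).
  rewrite -monotone_convergence //=.
  - by apply: eq_integral => x _; apply/esym/cvg_lim => //; exact: gh.
  - by move=> n; apply/measurable_EFinP.
  - by move=> n x _; rewrite lee_fin.
  - by move=> x _ m n; exact: gnd.
under eq_fun do rewrite integral_density_nnsfun.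
rewrite -monotone_convergence //=.
- apply: eq_integral => x _; apply/cvg_lim => //.
  by apply: cvgeZr => //; exact: gh.
- by move=> n; apply: emeasurable_funM => //; apply/measurable_EFinP.
- by move=> n x _; rewrite mule_ge0 ?lee_fin.
- by move=> x _ m n mn; rewrite lee_wpmul2r ?lee_fin //; exact: gnd.
Qed.

End DensityIntegral.

(** * The product sigma-algebra on finite families of complex numbers *)

Section Cylinders.
Variables (R : realType) (I : finType).
Implicit Types (x : I -> R * R) (e : I) (g : R * R).

(** Full boxes are stable under intersection, and [mutually_independent] gives their probabilities;
    they are the pi-system on which laws are compared. *)
Definition boxes : set (set (I -> R * R)) :=
  [set A | exists2 B : I -> set (R * R),
     (forall i, measurable (B i)) & A = [set x | forall i, B i (x i)]].

Definition sample_space := g_sigma_algebraType boxes.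

Definition upd x e g : I -> R * R := fun i => if i == e then g else x i.

Lemma updE x e g : upd x e g e = g.
Proof. by rewrite /upd eqxx. Qed.

Lemma upd_neq x e g i : i != e -> upd x e g i = x i.
Proof. by rewrite /upd => /negbTE ->. Qed.

Lemma measurable_coord e : measurable_fun setT (fun x : sample_space => x e).
Proof.
move=> _ B mB; rewrite setTI; apply: sub_sigma_algebra.
exists (fun i => if i == e then B else setT).
  by move=> i; case: ifP.
apply/seteqP; split=> x /=.
  by move=> Bx i; case: eqP => // ->.
by move=> /(_ e); rewrite eqxx.
Qed.

Lemma measurable_to_sample_space d (X : measurableType d) (f : X -> sample_space) :
  (forall i, measurable_fun setT (fun w => f w i)) -> measurable_fun setT f.
Proof.
move=> mf; apply: (@measurability _ _ _ sample_space setT f boxes) => [//|_ [_ [B mB ->] <-]].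
rewrite setTI (_ : _ @^-1` _ = \bigcap_(i in [set: I]) ((fun w => f w i) @^-1` B i)).
  apply: fin_bigcap_measurable => // i _.
  by rewrite -[X in measurable X]setTI; exact: mf.
by apply/seteqP; split=> w /= Bw i; [move=> _; exact: Bw|exact: Bw].
Qed.

Lemma measurable_upd e :
  measurable_fun setT (fun p : sample_space * (R * R) => upd p.1 e p.2 : sample_space).
Proof.
apply: measurable_to_sample_space => i; rewrite /upd; case: eqP => _.
  exact: measurable_snd.
by apply: measurableT_comp (measurable_coord i) _; exact: measurable_fst.
Qed.

Lemma boxes_setI : setI_closed boxes.
Proof.
move=> _ _ [B mB ->] [C mC ->]; exists (fun i => B i `&` C i).
  by move=> i; exact: measurableI.
apply/seteqP; split=> x /=; first by move=> [Bx Cx] i.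
by move=> BC; split=> i; have [] := BC i.
Qed.

Lemma boxes_setT : boxes setT.
Proof. by exists (fun=> setT) => //; apply/seteqP; split. Qed.

End Cylinders.

Section Resampling.
Context (R : realType) (disp : measure_display) (T : measurableType disp).
Variables (P : probability T R) (I : finType) (X : I -> T -> R * R).
Hypotheses (mX : forall e, measurable_fun setT (X e))
  (lawX : forall e (B : set (R * R)), measurable B ->
     P (X e @^-1` B) = complex_normal B)
  (indX : mutually_independent P X).

Local Notation leb := (@lebesgue_measure R).
Local Notation leb2 := (leb \x leb)%E.

Definition at_sample (w : T) : sample_space R I := fun i => X i w.

Definition gauss_density (g : R * R) : R := pi^-1 * expR (- nsq (toC g)).

Lemma measurable_gauss_density : measurable_fun setT gauss_density.
Proof.
apply: measurable_funM => //; apply: measurableT_comp => //.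
by apply: measurable_funN; apply: measurable_nsq; exact: cmeasurable_toC.
Qed.

Lemma gauss_density_ge0 g : 0 <= gauss_density g.
Proof. by rewrite mulr_ge0 ?expR_ge0 // invr_ge0 pi_ge0. Qed.

Lemma measurable_at_sample : measurable_fun setT at_sample.
Proof. by apply: measurable_to_sample_space => i; exact: mX. Qed.

(** Overwriting entry [e] by 0 leaves a function of the other entries only, without changing the
    sample space. *)
Let Y e w : sample_space R I := upd (at_sample w) e 0.

Let mY e : measurable_fun setT (Y e).
Proof.
apply: measurable_to_sample_space => i; rewrite /Y /upd; case: eqP => _.
  exact: measurable_cst.
exact: mX.
Qed.

Let indep_boxes e A B : boxes A -> measurable B ->
  P (Y e @^-1` A `&` X e @^-1` B) = (P (Y e @^-1` A) * P (X e @^-1` B))%E.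
Proof.
move=> [D mD ->] mB.
(* Coordinate [e] of [Y e w] is always 0: either the preimage of the box is empty, or side [e] of
   the box imposes nothing. *)
have [De|De] := pselect (D e 0); last first.
  have -> : Y e @^-1` [set x | forall i, D i (x i)] = set0.
    by apply/seteqP; split=> w //= /(_ e); rewrite /Y updE.
  by rewrite set0I measure0 mul0e.
pose D' C i := if i == e then C else D i.
have mD' C : measurable C -> forall i, measurable (D' C i).
  by move=> mC i; rewrite /D'; case: eqP.
have PE C : measurable C ->
  P (Y e @^-1` [set x | forall i, D i (x i)] `&` X e @^-1` C) =
  (P (X e @^-1` C) * \prod_(i | i != e) P (X i @^-1` D i))%E.
  move=> mC; have := indX (finset.setTfor I) (mD' _ mC).
  rewrite (_ : \bigcap_(i in _) _ =
    Y e @^-1` [set x | forall i, D i (x i)] `&` X e @^-1` C).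
    move=> ->; under eq_bigl do rewrite finset.in_setT.
    rewrite (bigD1 e) //= /D' eqxx; congr (_ * _)%E.
    by apply: eq_bigr => i /negbTE ->.
  apply/seteqP; split=> w /=.
    move=> H; split.
      move=> i; rewrite /Y /upd; case: eqP => [->//|/eqP/negbTE ie].
      by have := H i; rewrite /D' ie /= finset.in_setT; exact.
    by have := H e; rewrite /D' eqxx /= finset.in_setT; exact.
  move=> [H He] i _; rewrite /D'; case: eqP => [->//|/eqP/negbTE ie].
  by have := H i; rewrite /Y /upd ie.
rewrite PE //.
have := PE setT measurableT; rewrite preimage_setT setIT probability_setT mul1e.
by move=> ->; rewrite muleC.
Qed.

(** With [B] fixed, both sides are finite measures in [A] that agree on [boxes]. *)
Let indep e A B : (measurable A : Prop) -> measurable B ->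
  P (Y e @^-1` A `&` X e @^-1` B) = (P (Y e @^-1` A) * P (X e @^-1` B))%E.
Proof.
move=> mA mB.
have mXB : measurable (X e @^-1` B).
  by rewrite -[X in measurable X]setTI; exact: mX.
have fB : P (X e @^-1` B) \is a fin_num by exact: fin_num_measure.
pose r : {nonneg R} := NngNum (fine_ge0 (measure_ge0 P (X e @^-1` B))).
pose Yf : {mfun T >-> sample_space R I} :=
  HB.pack (Y e) (isMeasurableFun.Build _ _ _ _ _ (mY e)).
pose n1 : {measure set (sample_space R I) -> \bar R} :=
  pushforward (mrestr P mXB) Yf.
pose n2 : {measure set (sample_space R I) -> \bar R} := mscale r (distribution P Yf).
have := @measure_unique _ R (sample_space R I) (@boxes R I) (fun=> setT) erefl
  (@boxes_setI _ _) (fun=> @boxes_setT _ _) _ (n1 (mY e)) n2 _ _ _ mA.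
rewrite /n1 /n2 /= /pushforward /mrestr /mscale /= fineK // => ->.
- by rewrite muleC.
- by rewrite bigcup_const.
- by move=> D bD; rewrite indep_boxes // muleC.
- move=> _; rewrite preimage_setT setTI.
  by rewrite ltey_eq fB.
Qed.

(** The pair [(Y e, X e)] has a product law, so Tonelli applies: the integral in the hypothesis is
    the conditional expectation of [H] given the other entries. Being an inequality, the hypothesis
    only asks for a pointwise bound in [x]. *)
Lemma resampling_le e (H H' : sample_space R I -> R) :
  measurable_fun setT H -> measurable_fun setT H' ->
  (forall x, 0 <= H x) ->
  (forall x : sample_space R I,
     (\int[leb2]_g (H (upd x e g) * gauss_density g)%:E <= (H' x)%:E)%E) ->
  (\int[P]_w (H (at_sample w))%:E <= \int[P]_w (H' (at_sample w))%:E)%E.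
Proof.
move=> mH mH' H0 HH'.
pose Yf : {mfun T >-> sample_space R I} :=
  HB.pack (Y e) (isMeasurableFun.Build _ _ _ _ _ (mY e)).
pose C2 := (measurableTypeR R * measurableTypeR R)%type.
have mX' : measurable_fun setT (X e : T -> C2) by exact: (mX e).
pose Xf : {mfun T >-> C2} :=
  HB.pack (X e) (isMeasurableFun.Build _ _ _ _ _ mX').
pose m1 := distribution P Yf; pose m2 := distribution P Xf.
have mYX : measurable_fun setT (fun w => (Y e w, X e w) : (sample_space R I * C2)%type).
  exact: measurable_fun_pair.
pose YX : {mfun T >-> (sample_space R I * C2)%type} :=
  HB.pack (fun w => (Y e w, X e w)) (isMeasurableFun.Build _ _ _ _ _ mYX).
pose K (p : sample_space R I * C2) := (H (upd p.1 e p.2))%:E.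
have mK : measurable_fun setT K.
  by apply/measurable_EFinP; apply: measurableT_comp mH _; exact: measurable_upd.
have K0 p : (0 <= K p)%E by rewrite lee_fin.
have HK w : (H (at_sample w))%:E = K (YX w).
  rewrite /K /YX /=; congr (H _)%:E; apply/funext => i.
  by rewrite /Y /upd; case: eqP => [->|].
under eq_integral do rewrite HK.
rewrite -[leLHS]/(\int[P]_(w in YX @^-1` setT) (K \o YX) w)%E.
rewrite -ge0_integral_pushforward //=.
rewrite -(@eq_measure_integral _ _ _ _ _ (m1 \x m2)%E); last first.
  move=> A mA _; apply: product_measure_unique => // B C mB mC.
  exact: indep.
rewrite fubini_tonelli1 // /m1 /fubini_F.
have mF := @measurable_fun_fubini_tonelli_F _ _ _ _ R m2 K mK K0.
rewrite ge0_integral_pushforward //=; last first.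
  by move=> y _; apply: integral_ge0.
(* [K] overwrites coordinate [e] anyway, so [Y e w] can be replaced by the sample itself, where the
   hypothesis is stated. *)
have KE w y : K (Y e w, y) = K (at_sample w, y).
  rewrite /K /=; congr (H _)%:E; apply/funext => i.
  by rewrite /Y /upd; case: eqP.
rewrite (_ : Y e @^-1` _ = setT) //.
under eq_integral => w _ do under eq_integral => y _ do rewrite KE.
apply: ge0_le_integral => //=.
- by move=> w _; apply: integral_ge0.
- by apply: measurableT_comp mF _; exact: measurable_at_sample.
- apply/measurable_EFinP; apply: measurableT_comp mH' _.
  exact: measurable_at_sample.
move=> w _; apply: le_trans (HH' (at_sample w)).
rewrite (@ge0_integral_density _ _ _ (distribution P Xf) leb2 gauss_density) //=.
- exact: measurable_gauss_density.
- exact: gauss_density_ge0.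
- move=> B mB; rewrite /m2 /distribution /pushforward /= lawX //.
  by apply: eq_integral => -[a b] _; rewrite /gauss_density /= -normc_sqr.
- by apply: measurableT_comp mK _; exact: measurable_fun_pair.
Qed.

End Resampling.

Section OneGaussian.
Variable R : realType.
Local Notation leb := (@lebesgue_measure R).
Local Notation leb2 := (leb \x leb)%E.
Local Notation gauss_density := (@gauss_density R).

(** Integrating out [g] divides the prefactor [phi] and the rate [t] by the same [1 + t |u|^2],
    which is what lets this step be iterated. *)
Lemma gauss_step (phi t : R) (u c : R[i]) : 0 <= phi -> 0 <= t ->
  (\int[leb2]_g (phi * expR (- (t * nsq (u * toC g + c))) * gauss_density g)%:E
   = (phi / (1 + t * nsq u) * expR (- (t / (1 + t * nsq u) * nsq c)))%:E)%E.
Proof.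
move=> phi0 t0.
have pi0 : pi != 0 :> R by rewrite gt_eqF ?pi_gt0.
have E g : phi * expR (- (t * nsq (u * toC g + c))) * gauss_density g =
    (phi / pi) * expR (- (1 * nsq (toC g) + t * nsq (u * toC g + c))).
  by rewrite /gauss_density mul1r [in RHS]opprD [in RHS]expRD; ring.
under eq_integral do rewrite E EFinM.
rewrite ge0_integralZl_EFin ?divr_ge0 ?pi_ge0 //=; last first.
  by apply/measurable_EFinP; exact: measurable_gauss_affine.
rewrite integral_gauss_affine // -EFinM mulrA; congr (_ * expR _)%:E.
  have D0 : 0 < 1 + t * nsq u by rewrite ltr_wpDr // mulr_ge0 // nsq_ge0.
  by rewrite mulrA divfK.
by rewrite mulr1 mulrAC.
Qed.

Lemma measurable_nsq_toC : measurable_fun setT (fun g : R * R => nsq (toC g)).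
Proof. by apply: measurable_nsq; exact: cmeasurable_toC. Qed.

(* Integrate [h |g|^2 + 1 <= exp (h |g|^2)] and let [h] tend to 0. *)
Lemma gauss_second_moment (tau : R) : 0 <= tau ->
  (\int[leb2]_g (nsq (toC g) * expR (- (tau * nsq (toC g))) * gauss_density g)%:E
   <= ((1 + tau) ^- 2)%:E)%E.
Proof.
move=> tau0; set M := (X in (X <= _)%E).
have pi0 : pi != 0 :> R by rewrite gt_eqF ?pi_gt0.
have mN := measurable_nsq_toC.
have mE (s : R) : measurable_fun setT
    (fun g : R * R => expR (- (s * nsq (toC g)))).
  by apply: measurableT_comp => //; apply: measurable_funN; exact: measurable_funM.
have mP (s : R) : measurable_fun setT
    (fun g : R * R => (pi^-1 * expR (- (s * nsq (toC g))))%:E).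
  by apply/measurable_EFinP; apply: measurable_funM => //; exact: mE.
have mG : measurable_fun setT
    (fun g => (nsq (toC g) * expR (- (tau * nsq (toC g))) * gauss_density g)%:E).
  apply/measurable_EFinP; apply: measurable_funM.
    by apply: measurable_funM; [exact: mN|exact: mE].
  exact: measurable_gauss_density.
have IE (s : R) : 0 < s ->
    (\int[leb2]_g (pi^-1 * expR (- (s * nsq (toC g))))%:E = (s^-1)%:E)%E.
  move=> s0; have := @integral_gauss_affine R s 0 0 0 s0 (lexx _).
  rewrite mul0r addr0 !mul0r oppr0 expR0 mulr1 => H.
  under eq_integral do rewrite EFinM.
  rewrite ge0_integralZl_EFin ?invr_ge0 ?pi_ge0 //=; last first.
    by apply/measurable_EFinP; exact: mE.
  rewrite (_ : (fun g : R * R => _) = fun g : R * R =>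
      (expR (- (s * nsq (toC g) + 0 * nsq (0 * toC g + 0))))%:E).
    by rewrite H -EFinM mulrA mulVf // mul1r.
  by apply/funext => g; rewrite mul0r addr0.
have M0 : (0 <= M)%E.
  apply: integral_ge0 => g _; rewrite lee_fin mulr_ge0 ?gauss_density_ge0 //.
  by rewrite mulr_ge0 ?expR_ge0 // nsq_ge0.
have D0 : 0 < 1 + tau by rewrite ltr_wpDr.
have MH (h : R) : 0 < h -> h < 1 ->
    (h%:E * M + ((1 + tau)^-1)%:E <= ((1 + tau - h)^-1)%:E)%E.
  move=> h0 h1; have s0 : 0 < 1 + tau - h by lra.
  rewrite /M -ge0_integralZl_EFin ?(ltW h0) //=; last first.
    move=> g _; rewrite lee_fin mulr_ge0 ?gauss_density_ge0 //.
    by rewrite mulr_ge0 ?expR_ge0 // nsq_ge0.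
  rewrite -(IE _ D0) -(IE _ s0) -ge0_integralD //=; last 4 first.
  - move=> g _; rewrite mule_ge0 ?lee_fin ?(ltW h0) // mulr_ge0 ?gauss_density_ge0 //.
    by rewrite mulr_ge0 ?expR_ge0 // nsq_ge0.
  - by apply: emeasurable_funM => //; exact: mG.
  - by move=> g _; rewrite lee_fin mulr_ge0 ?invr_ge0 ?pi_ge0 ?expR_ge0.
  - exact: mP.
  apply: ge0_le_integral => //=.
  - move=> g _; rewrite adde_ge0 ?mule_ge0 ?lee_fin ?(ltW h0) //.
      rewrite mulr_ge0 ?gauss_density_ge0 //.
      by rewrite mulr_ge0 ?expR_ge0 // nsq_ge0.
    by rewrite mulr_ge0 ?invr_ge0 ?pi_ge0 ?expR_ge0.
  - apply: emeasurable_funD; last exact: mP.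
    by apply: emeasurable_funM => //; exact: mG.
  - exact: mP.
  move=> g _; rewrite -EFinM -EFinD lee_fin /gauss_density.
  set N := nsq _.
  rewrite (_ : - ((1 + tau) * N) = - (tau * N) + - N); last by ring.
  rewrite (_ : - ((1 + tau - h) * N) = h * N + (- (tau * N) + - N)); last by ring.
  rewrite !expRD; set a := expR (- (tau * N)); set b := expR (- N).
  have ab0 : 0 <= pi^-1 * (a * b) by rewrite !mulr_ge0 ?invr_ge0 ?pi_ge0 ?expR_ge0.
  have := expR_ge1Dx (h * N).
  move/(ler_wpM2l ab0); rewrite mulrDr mulr1; lra.
(* The instance [h = 1 / 2] of [MH] excludes [M = +oo]. *)
have h2 : (0 : R) < 1 / 2 by lra.
have h2' : 1 / 2 < 1 :> R by lra.
clearbody M; case: M M0 MH => [m|_ /(_ _ h2 h2')|//]; last first.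
  by rewrite gt0_muley ?lte_fin // addye.
rewrite !lee_fin => m0 MH.
have {}MH (h : R) : 0 < h -> h < 1 -> m * ((1 + tau) * (1 + tau - h)) <= 1.
  move=> h0 h1; have := MH h h0 h1; rewrite -EFinM -EFinD lee_fin => H.
  have s0 : 0 < 1 + tau - h by lra.
  have {}H : h * m <= h * ((1 + tau) * (1 + tau - h))^-1.
    rewrite (_ : h * _^-1 = (1 + tau - h)^-1 - (1 + tau)^-1) ?lerBrDr //.
    by field; rewrite !gt_eqF.
  by rewrite -ler_pdivlMr ?mulr_gt0 // div1r -(ler_pM2l h0).
rewrite -div1r ler_pdivlMr ?exprn_gt0 //.
apply/ler_addgt0Pr => e e0.
(* The defect to absorb is [h * m * (1 + tau)]; the second argument makes it at most [e], the first
   keeps [h < 1]. *)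
pose h := Num.min (1 / 2) (e / (m * (1 + tau) + 1)).
have q0 : 0 < m * (1 + tau) + 1 by rewrite ltr_wpDl // mulr_ge0 // ltW.
have h0 : 0 < h by rewrite lt_min divr_gt0 //= divr_gt0.
have h1 : h < 1 by rewrite gt_min; apply/orP; left; lra.
have he : h * (m * (1 + tau) + 1) <= e.
  by rewrite -ler_pdivlMr // ge_min lexx orbT.
have := MH h h0 h1; lra.
Qed.

End OneGaussian.

(** * Linear forms in Gaussian entries *)

Section GaussianExpectations.
Context (R : realType) (disp : measure_display) (T : measurableType disp).
Variables (P : probability T R) (I : finType) (X : I -> T -> R * R).
Hypotheses (mX : forall e, measurable_fun setT (X e))
  (lawX : forall e (B : set (R * R)), measurable B ->
     P (X e @^-1` B) = complex_normal B)
  (indX : mutually_independent P X).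
Local Notation leb := (@lebesgue_measure R).
Local Notation leb2 := (leb \x leb)%E.
Local Notation Om := (sample_space R I).
Local Notation "'EX' H" := (\int[P]_w (H (at_sample X w))%:E)%E (at level 10).

Definition free_of (Y : Type) (F : Om -> Y) (e : I) :=
  forall (x : Om) g, F (upd x e g) = F x.

Lemma measurable_EX (H : Om -> R) : measurable_fun setT H ->
  measurable_fun setT (fun w => (H (at_sample X w))%:E).
Proof.
move=> mH; apply/measurable_EFinP; apply: measurableT_comp mH _.
exact: measurable_at_sample.
Qed.

Lemma EX_le (H H' : Om -> R) : measurable_fun setT H -> measurable_fun setT H' ->
  (forall x, 0 <= H x) -> (forall x, H x <= H' x) -> (EX H <= EX H')%E.
Proof.
move=> mH mH' H0 HH'; apply: ge0_le_integral => //.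
- by move=> w _; rewrite lee_fin.
- exact: measurable_EX.
- exact: measurable_EX.
- by move=> w _; rewrite lee_fin.
Qed.

Lemma EX_lincomb (a b : R) (H H' : Om -> R) : 0 <= a -> 0 <= b ->
  measurable_fun setT H -> measurable_fun setT H' ->
  (forall x, 0 <= H x) -> (forall x, 0 <= H' x) ->
  EX (fun x => a * H x + b * H' x) = (a%:E * EX H + b%:E * EX H')%E.
Proof.
move=> a0 b0 mH mH' H0 H'0.
have mE := measurable_EX mH; have mE' := measurable_EX mH'.
have E0 w : setT w -> (0 <= (H (at_sample X w))%:E)%E by rewrite lee_fin.
have E'0 w : setT w -> (0 <= (H' (at_sample X w))%:E)%E by rewrite lee_fin.
rewrite -ge0_integralZl_EFin // -ge0_integralZl_EFin // -ge0_integralD //.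
- by move=> w Tw; rewrite mule_ge0 // E0.
- exact: measurable_funeM.
- by move=> w Tw; rewrite mule_ge0 // E'0.
- exact: measurable_funeM.
Qed.

Lemma cmeasurable_entry e : cmeasurable (fun x : Om => toC (x e)).
Proof.
split; apply: measurableT_comp (measurable_coord e);
  [exact: measurable_fst|exact: measurable_snd].
Qed.

(** Induction on [L] through [gauss_step]; the part of the form not yet integrated plays the role of
    the constant. [phi] and [t] are functions of the sample because each step divides them by a
    quantity that involves the coefficients; they must not depend on the entries of [L], so that
    they are constants for the next integrations. *)
Lemma EX_linear_form (L : seq I) (phi t : Om -> R) (u : I -> Om -> R[i])
    (c : Om -> R[i]) : uniq L ->
  measurable_fun setT phi -> measurable_fun setT t ->
  (forall e, cmeasurable (u e)) -> cmeasurable c ->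
  (forall x, 0 <= phi x) -> (forall x, 0 <= t x) ->
  {in L, forall e, free_of phi e} -> {in L, forall e, free_of t e} ->
  (forall e', {in L, forall e, free_of (u e') e}) ->
  {in L, forall e, free_of c e} ->
  (EX (fun x => phi x *
         expR (- (t x * nsq (c x + \sum_(e <- L) u e x * toC (x e)))))
   <= EX (fun x => phi x / (1 + t x * \sum_(e <- L) nsq (u e x)) *
         expR (- (t x / (1 + t x * \sum_(e <- L) nsq (u e x)) * nsq (c x)))))%E.
Proof.
elim: L phi t c => [|e L IH] phi t c uL mphi mt mu mc phi0 t0 iphi it iu ic.
  rewrite le_eqVlt; apply/predU1P; left; apply: eq_integral => w _.
  by rewrite !big_nil mulr0 !addr0 !divr1.
move: uL; rewrite cons_uniq => /andP[eL uL].
have inL e' : e' \in L -> e' \in e :: L by rewrite inE orbC => ->.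
have eeL : e \in e :: L by rewrite inE eqxx.
pose D x := 1 + t x * nsq (u e x).
have D0 x : 0 < D x by rewrite /D ltr_wpDr // mulr_ge0 // nsq_ge0.
pose phi' x := phi x / D x.
pose t' x := t x / D x.
have mD : measurable_fun setT D.
  by apply: measurable_funD => //; apply: measurable_funM => //; exact: measurable_nsq.
have mDV := measurable_inv_pos mD D0.
have mphi' : measurable_fun setT phi' by exact: measurable_funM.
have mt' : measurable_fun setT t' by exact: measurable_funM.
have iD : {in L, forall e', free_of D e'}.
  by move=> e' /inL e'L x g; rewrite /D it // iu.
pose cL x := c x + \sum_(e' <- L) u e' x * toC (x e').
have mcL : cmeasurable cL.
  apply: cmeasurableD => //; apply: cmeasurable_sum => e'.
  by apply: cmeasurableM => //; exact: cmeasurable_entry.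
have icL x g : cL (upd x e g) = cL x.
  rewrite /cL ic //; congr (_ + _); apply: eq_big_seq => e' e'L.
  rewrite iu // upd_neq //; apply: contraNneq eL => <-.
  exact: e'L.
pose H' x := phi' x * expR (- (t' x * nsq (cL x))).
have mH' : measurable_fun setT H'.
  apply: measurable_funM => //; apply: measurableT_comp => //.
  by apply: measurable_funN; apply: measurable_funM => //; exact: measurable_nsq.
pose H x := phi x *
  expR (- (t x * nsq (c x + \sum_(e' <- e :: L) u e' x * toC (x e')))).
rewrite -[leLHS]/(EX H).
apply: (@le_trans _ _ (EX H')).
  apply: (@resampling_le _ _ _ P I X mX lawX indX e H H') => //.
  - apply: measurable_funM => //; apply: measurableT_comp => //.
    apply: measurable_funN; apply: measurable_funM => //; apply: measurable_nsq.
    apply: cmeasurableD => //; apply: cmeasurable_sum => e'.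
    by apply: cmeasurableM => //; exact: cmeasurable_entry.
  - by move=> x; rewrite mulr_ge0 ?expR_ge0.
  move=> x; under eq_integral => g _.
    rewrite /H iphi // it // (_ : c _ + _ = u e x * toC g + cL x); last first.
      rewrite big_cons iu // updE addrCA; congr (_ + _).
      by rewrite -[RHS](icL x g).
    over.
  by rewrite gauss_step.
apply: (le_trans (IH phi' t' c uL mphi' mt' mu mc _ _ _ _ _ _)) => //.
- by move=> x; rewrite divr_ge0 // ltW.
- by move=> x; rewrite divr_ge0 // ltW.
- by move=> e' e'L x g; rewrite /phi' iphi ?inL // iD.
- by move=> e' e'L x g; rewrite /t' it ?inL // iD.
- by move=> e' e'' e''L; apply: iu; exact: inL.
- by move=> e' e'L; apply: ic; exact: inL.
rewrite le_eqVlt; apply/predU1P; left; apply: eq_integral => w _; set x := at_sample X w.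
have S0 : 0 <= \sum_(e' <- L) nsq (u e' x) by apply: sumr_ge0 => *; exact: nsq_ge0.
set S := \sum_(e' <- L) _ in S0 *.
(* The successive denominators telescope to [1 + t * sum of all squared coefficients]. *)
have E (a : R) : a / D x / (1 + t' x * S) = a / (1 + t x * (nsq (u e x) + S)).
  rewrite /t' (_ : 1 + t x * (_ + S) = D x + t x * S); last by rewrite /D; ring.
  have := D0 x; have : 0 <= t x * S by rewrite mulr_ge0.
  move: (D x) (t x) => q r rS0 q0; field.
  by rewrite !gt_eqF // ltr_wpDr.
by rewrite /phi' /t' big_cons -/S !E.
Qed.

Lemma measurable_entry_sq e : measurable_fun setT (fun x : Om => nsq (toC (x e))).
Proof. by apply: measurable_nsq; exact: cmeasurable_entry. Qed.

Lemma EX_entry_sq e : (EX (fun x => nsq (toC (x e))) <= 1)%E.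
Proof.
pose H (x : Om) := nsq (toC (x e)).
have -> : 1%E = EX (fun=> 1).
  by rewrite integral_cst // mul1e; exact/esym/probability_setT.
apply: (@resampling_le _ _ _ P I X mX lawX indX e H (fun=> 1)) => //.
- exact: measurable_entry_sq.
- by move=> x; exact: nsq_ge0.
move=> x; have := @gauss_second_moment R 0 (lexx _).
rewrite addr0 expr1n invr1 => M.
apply: le_trans M; rewrite le_eqVlt; apply/predU1P; left.
by apply: eq_integral => g _; rewrite /H updE mul0r oppr0 expR0 mulr1.
Qed.

Section Moments.
Variables (L : {set I}) (u : I -> Om -> R[i]) (t : R).
Hypotheses (t0 : 0 <= t) (mu : forall e, cmeasurable (u e))
  (iu : forall e e', e' \in L -> free_of (u e) e').

Definition form_var (x : Om) := \sum_(e in L) nsq (u e x).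
Definition form_val (x : Om) := \sum_(e in L) u e x * toC (x e).

Lemma form_var_ge0 x : 0 <= form_var x.
Proof. by apply: sumr_ge0 => *; exact: nsq_ge0. Qed.

Lemma measurable_form_var : measurable_fun setT form_var.
Proof.
rewrite (_ : form_var = fun x => \sum_(e <- enum L) nsq (u e x)).
  by apply: measurable_sum => e; exact: measurable_nsq.
by apply/funext => x; rewrite big_enum.
Qed.

Lemma cmeasurable_form_val : cmeasurable form_val.
Proof.
apply: cmeasurable_sum => e; apply: cmeasurableM => //.
exact: cmeasurable_entry.
Qed.

Lemma form_var_free e : e \in L -> free_of form_var e.
Proof. by move=> eL x g; apply: eq_bigr => e' _; rewrite iu. Qed.

Let dn0 x : 0 < 1 + t * form_var x.
Proof. by rewrite ltr_wpDr // mulr_ge0 // form_var_ge0. Qed.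

Let mden : measurable_fun setT (fun x => (1 + t * form_var x)^-1).
Proof.
apply: measurable_inv_pos => //; apply: measurable_funD => //.
by apply: measurable_funM => //; exact: measurable_form_var.
Qed.

Let measurable_weight e : measurable_fun setT (fun x : Om =>
  t * form_var x * nsq (toC (x e)) * expR (- (t * nsq (form_val x)))).
Proof.
apply: measurable_funM; last first.
  apply: measurableT_comp => //; apply: measurable_funN.
  by apply: measurable_funM => //; apply: measurable_nsq; exact: cmeasurable_form_val.
apply: measurable_funM; last exact: measurable_entry_sq.
by apply: measurable_funM => //; exact: measurable_form_var.
Qed.

(** The factor [|x e|^2] is inert while the entries of [L] are integrated out; what remains is
    [s / (1 + s) <= 1] with [s = t * form_var], and a second moment at most 1. *)
Lemma EX_weight_out e : e \notin L ->
  (EX (fun x => t * form_var x * nsq (toC (x e)) * expR (- (t * nsq (form_val x))))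
   <= 1)%E.
Proof.
move=> eL; apply: le_trans (EX_entry_sq e).
pose phi (x : Om) := t * form_var x * nsq (toC (x e)).
have mphi : measurable_fun setT phi.
  apply: measurable_funM; last exact: measurable_entry_sq.
  by apply: measurable_funM => //; exact: measurable_form_var.
have phi0 x : 0 <= phi x by rewrite !mulr_ge0 ?form_var_ge0 ?nsq_ge0.
have := @EX_linear_form (enum L) phi (fun=> t) u (fun=> 0) (enum_uniq _) mphi
  (measurable_cst _) mu (cmeasurable_cst _ _) phi0 (fun=> t0).
move=> A; apply: le_trans (le_trans (A _ _ _ _) _) => //.
- rewrite le_eqVlt; apply/predU1P; left; apply: eq_integral => w _.
  by rewrite /= add0r big_enum.
- move=> e'; rewrite mem_enum => e'L x g.
  rewrite /phi form_var_free // upd_neq //.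
  by apply: contraNneq eL => ->.
- by move=> e' e''; rewrite mem_enum => e''L; exact: iu.
pose H' (x : Om) := phi x / (1 + t * form_var x).
apply: (@le_trans _ _ (EX H')).
  rewrite le_eqVlt; apply/predU1P; left; apply: eq_integral => w _.
  by rewrite /= nsq0 mulr0 oppr0 expR0 mulr1 big_enum.
apply: (@EX_le H' (fun x => nsq (toC (x e)))) => [||x|x].
- exact: measurable_funM.
- exact: measurable_entry_sq.
- by rewrite divr_ge0 // ltW.
- rewrite /H' /phi ler_pdivrMr // [leRHS]mulrDr mulr1 [in leRHS]mulrC lerDr.
  exact: nsq_ge0.
Qed.

(** The other entries of [L] are integrated out first, with [u e * x e] as the constant of the form.
    This leaves a Gaussian weight in [x e] alone, treated by [gauss_second_moment]. *)
Lemma EX_weight_in e : e \in L ->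
  (EX (fun x => t * form_var x * nsq (toC (x e)) * expR (- (t * nsq (form_val x))))
   <= EX (fun x => t * form_var x * (1 + t * (form_var x - nsq (u e x)))
                   / (1 + t * form_var x) ^+ 2))%E.
Proof.
move=> eL; pose L' := L :\ e.
have L'P e' : e' \in enum L' -> e' \in L /\ e' != e.
  by rewrite mem_enum !inE => /andP[-> ->].
pose phi (x : Om) := t * form_var x * nsq (toC (x e)).
have mphi : measurable_fun setT phi.
  apply: measurable_funM; last exact: measurable_entry_sq.
  by apply: measurable_funM => //; exact: measurable_form_var.
have phi0 x : 0 <= phi x by rewrite !mulr_ge0 ?form_var_ge0 ?nsq_ge0.
pose c (x : Om) := u e x * toC (x e).
have mc : cmeasurable c by apply: cmeasurableM => //; exact: cmeasurable_entry.
have SE x : \sum_(e' <- enum L') nsq (u e' x) = form_var x - nsq (u e x).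
  by rewrite big_enum /form_var [in RHS](big_setD1 e) //= addrC addrK.
have VE x : c x + \sum_(e' <- enum L') u e' x * toC (x e') = form_val x.
  by rewrite big_enum /form_val [in RHS](big_setD1 e).
pose s x := form_var x - nsq (u e x).
have s0 x : 0 <= s x.
  by rewrite /s -SE; apply: sumr_ge0 => *; exact: nsq_ge0.
pose D x := 1 + t * s x.
have D0 x : 0 < D x by rewrite /D ltr_wpDr // mulr_ge0.
have ms : measurable_fun setT s.
  apply: measurable_funB; first exact: measurable_form_var.
  exact: measurable_nsq.
have mD : measurable_fun setT D.
  by apply: measurable_funD => //; exact: measurable_funM.
have mDV := measurable_inv_pos mD D0.
have := @EX_linear_form (enum L') phi (fun=> t) u c (enum_uniq _) mphi
  (measurable_cst _) mu mc phi0 (fun=> t0).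
move=> A; apply: le_trans (le_trans (A _ _ _ _) _) => //.
- rewrite le_eqVlt; apply/predU1P; left; apply: eq_integral => w _.
  by rewrite /= VE.
- move=> e' /L'P[e'L e'e] x g.
  by rewrite /phi form_var_free // upd_neq // eq_sym.
- by move=> e' e'' /L'P[e''L _]; exact: iu.
- move=> e' /L'P[e'L e'e] x g.
  by rewrite /c iu // upd_neq // eq_sym.
(* The final simplification rests on [(1 + tau) * D = 1 + t * form_var]. *)
pose tau x := t / D x * nsq (u e x).
have mtau : measurable_fun setT tau.
  by apply: measurable_funM; [exact: measurable_funM|exact: measurable_nsq].
have tau0 x : 0 <= tau x by rewrite mulr_ge0 ?nsq_ge0 // divr_ge0 // ltW.
pose psi x := t * form_var x / D x.
have mpsi : measurable_fun setT psi.
  apply: measurable_funM => //; apply: measurable_funM => //.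
  exact: measurable_form_var.
have psi0 x : 0 <= psi x by rewrite divr_ge0 ?mulr_ge0 ?form_var_ge0 // ltW.
pose H (x : Om) := psi x * (nsq (toC (x e)) * expR (- (tau x * nsq (toC (x e))))).
pose H' (x : Om) := t * form_var x * D x / (1 + t * form_var x) ^+ 2.
apply: (@le_trans _ _ (EX H)).
  rewrite le_eqVlt; apply/predU1P; left; apply: eq_integral => w _.
  rewrite /= SE -/(s _) -/(D _) /H /psi /phi /tau /c nsqM !mulrA.
  by congr (_ * expR _)%:E; rewrite mulrAC.
rewrite -[leRHS]/(EX H').
have mH' : measurable_fun setT H'.
  apply: measurable_funM; last first.
    apply: measurable_inv_pos => [|x]; last by rewrite exprn_gt0.
    apply: measurable_funX; apply: measurable_funD => //.
    by apply: measurable_funM => //; exact: measurable_form_var.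
  apply: measurable_funM => //; apply: measurable_funM => //.
  exact: measurable_form_var.
apply: (@resampling_le _ _ _ P I X mX lawX indX e H H') => //.
- apply: measurable_funM => //; apply: measurable_funM.
    exact: measurable_entry_sq.
  apply: measurableT_comp => //; apply: measurable_funN.
  by apply: measurable_funM => //; exact: measurable_entry_sq.
- by move=> x; rewrite /H mulr_ge0 // mulr_ge0 ?expR_ge0 ?nsq_ge0.
move=> x.
have HE g : (H (upd x e g) * gauss_density g)%:E =
  ((psi x)%:E * (nsq (toC g) * expR (- (tau x * nsq (toC g))) * gauss_density g)%:E)%E.
  by rewrite /H /psi /tau /D /s !iu // form_var_free // updE -EFinM !mulrA.
under eq_integral do rewrite HE.
rewrite ge0_integralZl_EFin //; last 2 first.
- move=> g _; rewrite lee_fin mulr_ge0 ?gauss_density_ge0 //.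
  by rewrite mulr_ge0 ?expR_ge0 // nsq_ge0.
- apply/measurable_EFinP; apply: measurable_funM.
    apply: measurable_funM; first exact: measurable_nsq_toC.
    apply: measurableT_comp => //; apply: measurable_funN.
    by apply: measurable_funM => //; exact: measurable_nsq_toC.
  exact: measurable_gauss_density.
apply: (@le_trans _ _ ((psi x)%:E * ((1 + tau x) ^- 2)%:E)%E).
  by apply: lee_wpmul2l; [rewrite lee_fin|exact: gauss_second_moment].
rewrite -EFinM lee_fin le_eqVlt; apply/predU1P; left.
rewrite /psi /H' /tau.
have E : 1 + t * form_var x = D x + t * nsq (u e x).
  by rewrite /D /s; ring.
rewrite E; have := D0 x; have : 0 <= t * nsq (u e x) by rewrite mulr_ge0 // nsq_ge0.
move: (D x) (nsq _) (form_var x) => q r v tr0 q0; field.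
by rewrite !gt_eqF // ltr_wpDr.
Qed.

Lemma EX_cst (a : R) : EX (fun=> a) = a%:E.
Proof.
by rewrite integral_cst //; rewrite [X in (_ * X)%E](probability_setT P) mule1.
Qed.

Lemma EX_sum (s : seq I) (H : I -> Om -> R) :
  (forall e, measurable_fun setT (H e)) -> (forall e x, 0 <= H e x) ->
  EX (fun x => \sum_(e <- s) H e x) = (\sum_(e <- s) EX (H e))%E.
Proof.
move=> mH H0; rewrite -ge0_integral_sum //.
- by apply: eq_integral => w _; rewrite sumEFin.
- by move=> e; exact: measurable_EX.
- by move=> e x _; rewrite lee_fin.
Qed.

(** This is where the dimension drops by one: each entry outside [L] contributes at most 1, and the
    entries of [L] together at most [#|L| - 1] plus the error term. *)
Lemma EX_weight : L != finset.set0 ->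
  (EX (fun x => t * form_var x * (\sum_e nsq (toC (x e))) *
        expR (- (t * nsq (form_val x))))
   <= (#|I|%:R - 1)%:E + EX (fun x => t * form_var x / (1 + t * form_var x) ^+ 2))%E.
Proof.
move=> L0.
pose W e (x : Om) :=
  t * form_var x * nsq (toC (x e)) * expR (- (t * nsq (form_val x))).
have W0 e x : 0 <= W e x.
  by rewrite mulr_ge0 ?expR_ge0 // !mulr_ge0 ?form_var_ge0 ?nsq_ge0.
pose h e (x : Om) := t * form_var x * (1 + t * (form_var x - nsq (u e x)))
                   / (1 + t * form_var x) ^+ 2.
pose g (x : Om) := t * form_var x / (1 + t * form_var x) ^+ 2.
have tS0 x : 0 <= t * form_var x by rewrite mulr_ge0 ?form_var_ge0.
have g0 x : 0 <= g x by rewrite divr_ge0 // sqr_ge0.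
have mden2 : measurable_fun setT (fun x : Om => ((1 + t * form_var x) ^+ 2)^-1).
  apply: measurable_inv_pos => [|x]; last by rewrite exprn_gt0.
  apply: measurable_funX; apply: measurable_funD => //.
  by apply: measurable_funM => //; exact: measurable_form_var.
have mtS : measurable_fun setT (fun x : Om => t * form_var x).
  by apply: measurable_funM => //; exact: measurable_form_var.
have mg : measurable_fun setT g by exact: measurable_funM.
have mh e : measurable_fun setT (h e).
  apply: measurable_funM => //; apply: measurable_funM => //.
  apply: measurable_funD => //; apply: measurable_funM => //.
  by apply: measurable_funB; [exact: measurable_form_var|exact: measurable_nsq].
have Cge e x : e \in L -> nsq (u e x) <= form_var x.
  move=> eL; rewrite /form_var (big_setD1 e) //= lerDl.
  by apply: sumr_ge0 => *; exact: nsq_ge0.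
rewrite [leLHS](_ : _ = EX (fun x => \sum_e W e x)); last first.
  apply: eq_integral => w _; rewrite /W /= -[in RHS]mulr_suml; congr (_ * _)%:E.
  by rewrite mulr_sumr.
rewrite EX_sum // (bigID (fun e => e \in L)) /=.
have Lle : (#|L| <= #|I|)%N by exact: max_card.
have Lgt : (0 < #|L|)%N by rewrite card_gt0.
have -> : (#|I|%:R - 1 : R) = (#|L|%:R - 1) + (#|I| - #|L|)%:R.
  by rewrite natrB //; ring.
rewrite EFinD -addeA [X in (_ <= _ + X)%E]addeC addeA; apply: leeD; last first.
  apply: (@le_trans _ _ (\sum_(e | e \notin L) 1)%E).
    by apply: lee_sum => e eL; exact: EX_weight_out.
  rewrite sumEFin lee_fin sumr_const -(cardC L) addKn.
  by rewrite (_ : #|_| = #|[predC L]|) //; apply: eq_card.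
rewrite -EX_cst -ge0_integralD //; last 3 first.
- by move=> w _; rewrite lee_fin subr_ge0 ler1n.
- by move=> w _; rewrite lee_fin; exact: g0.
- exact: (measurable_EX mg).
pose h' e := if e \in L then h e else fun=> 0.
have mh' e : measurable_fun setT (h' e).
  by rewrite /h'; case: ifP => _ //; exact: measurable_cst.
have h'0 e x : 0 <= h' e x.
  rewrite /h'; case: ifP => // eL; rewrite /h divr_ge0 ?sqr_ge0 // mulr_ge0 //.
  by rewrite addr_ge0 // mulr_ge0 // subr_ge0 Cge.
apply: (@le_trans _ _ (\sum_(e <- enum L) EX (h' e))%E).
  rewrite [leRHS]big_enum; apply: lee_sum => e eL.
  by rewrite /h' eL; exact: EX_weight_in.
rewrite -EX_sum //; apply: ge0_le_integral => //.
- by move=> w _; rewrite lee_fin sumr_ge0.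
- apply: (@measurable_EX (fun x => \sum_(e <- enum L) h' e x)).
  exact: measurable_sum.
- apply/measurable_EFinP; apply: measurable_funD => //.
  by apply/measurable_EFinP; exact: (measurable_EX mg).
move=> w _; set x := at_sample X w; rewrite -EFinD lee_fin big_enum /=.
rewrite (eq_bigr (fun e => t * form_var x / (1 + t * form_var x) ^+ 2 *
   ((1 + t * form_var x) - t * nsq (u e x)))); last first.
  by move=> e eL; rewrite /h' eL /h mulrAC; congr (_ * _); ring.
rewrite -mulr_sumr sumrB sumr_const -mulr_sumr -/(form_var x) /g.
set S := t * form_var x; have S0 : 0 <= S by exact: tS0.
have D0 : 0 < 1 + S by rewrite ltr_wpDr.
have L1 : 0 <= #|L|%:R - 1 :> R by rewrite subr_ge0 ler1n.
rewrite -[_ *+ _]mulr_natr; set m := #|L|%:R in L1 *.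
(* The bounds for the entries of [L] have defects [t * |u e|^2] that add up to exactly [S]; this
   removes one unit from [m]. *)
have -> : S / (1 + S) ^+ 2 * ((1 + S) * m - S) =
   (m - 1) * (S / (1 + S)) + S / (1 + S) ^+ 2.
  by field; rewrite gt_eqF.
by rewrite lerD2r ler_piMr // ler_pdivrMr // mul1r lerDr.
Qed.

End Moments.

End GaussianExpectations.

(** * Small values of Gaussian determinants *)

Lemma det_add_delta (S : comNzRingType) m (M : 'M[S]_m.+1) (s : S) :
  \det (M + s *: delta_mx 0 0) = \det M + s * \det (row' 0 (col' 0 M)).
Proof.
rewrite (expand_det_row _ 0) (expand_det_row M 0) !big_ord_recl /=.
have cofE j : cofactor (M + s *: delta_mx 0 0) 0 j = cofactor M 0 j.
  rewrite /cofactor; congr (_ * \det _).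
  by apply/matrixP => i k; rewrite !mxE /= mulr0 addr0.
rewrite cofE !mxE !eqxx mulr1 mulrDl.
rewrite -!addrA; congr (_ + _); rewrite addrC; congr (_ + _).
  apply: eq_bigr => j _; rewrite cofE !mxE /=.
  by rewrite mulr0 addr0.
by rewrite /cofactor expr0 mul1r.
Qed.

Section SmallBall.
Context (R : realType) (disp : measure_display) (T : measurableType disp).
Variables (P : probability T R) (I : finType) (X : I -> T -> R * R).
Hypotheses (mX : forall e, measurable_fun setT (X e))
  (lawX : forall e (B : set (R * R)), measurable B ->
     P (X e @^-1` B) = complex_normal B)
  (indX : mutually_independent P X).
Local Notation Om := (sample_space R I).
Local Notation "'EX' H" := (\int[P]_w (H (at_sample X w))%:E)%E (at level 10).

Local Notation K := (expR 16 : R).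

Fixpoint gauss_mix (k : nat) (y : R) : R :=
  if k is k'.+1 then K * expR (- (16 ^+ k * y)) + gauss_mix k' y / 16 else 1.

Lemma gauss_mix_ge0 k y : 0 <= gauss_mix k y.
Proof.
by elim: k => [|k IH] //=; rewrite addr_ge0 ?mulr_ge0 ?expR_ge0.
Qed.

(* Up to the constant [K], [1 / (1 + Y)] is dominated by a mixture of the
   functions [exp (- Y / 16 ^ i)]. *)
Lemma gauss_mix_ge k y : 0 <= y -> (1 + 16 ^+ k * y)^-1 <= gauss_mix k y.
Proof.
move=> y0; pose Y := 16 ^+ k * y.
have Y0 : 0 <= Y by rewrite mulr_ge0 ?exprn_ge0.
(* Both [1] (for [Y <= 1]) and [1 / Y] (for [Y >= 1]) dominate [1 / (1 + Y)]. *)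
suff [A B] : (Y <= 1 -> 1 <= gauss_mix k y) /\ (1 <= Y -> 1 <= gauss_mix k y * Y).
  rewrite -/Y -div1r ler_pdivrMr ?ltr_wpDr //.
  have G0 := gauss_mix_ge0 k y.
  have [/A|/ltW/B] := leP Y 1; last by nra.
  by move=> G1; rewrite mulrDr mulr1; apply: ler_wpDr => //; rewrite mulr_ge0.
rewrite /Y; clear Y Y0; elim: k => [|k [A B]] /=; first by rewrite expr0 !mul1r; split.
set Y := 16 ^+ k.+1 * y.
have YE : Y = 16 * (16 ^+ k * y) by rewrite /Y exprS mulrA.
set Z := 16 ^+ k * y in A B YE *; have Z0 : 0 <= Z by rewrite mulr_ge0 ?exprn_ge0.
have G0 := gauss_mix_ge0 k y.
(* [K = exp 16] makes the first term alone at least 1 up to [Y = 16]; beyond, [Z = Y / 16 >= 1] and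
   the previous level takes over, its factor [1 / 16] matching the change of scale. *)
have first_term : Y <= 16 -> 1 <= K * expR (- Y).
  by move=> Y16; rewrite -expRD -[leLHS]expR0 ler_expR subr_ge0.
split=> [Y1|Y1].
  apply: le_trans (first_term _) _; first by lra.
  by rewrite lerDl divr_ge0.
have [Y16|Y16] := leP Y 16.
  have := first_term Y16; have : 0 <= gauss_mix k y / 16 by rewrite divr_ge0.
  nra.
have := B ltac:(lra); have : 0 <= K * expR (- Y) by rewrite mulr_ge0 ?expR_ge0.
move: (K * _) => q q0; rewrite YE => BB.
have : 0 <= q * (16 * Z) by rewrite !mulr_ge0.
lra.
Qed.

(** Induction on the size. The determinant is affine in entry [(0, 0)], with slope the minor [c];
    integrating this entry out leaves at most [1 / (1 + 16^k |c|^2)]. As [gauss_mix] bounds this by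
    exponentials of [- 16^i |c|^2] for [0 < i <= k] and a constant, the induction hypothesis applies
    to the minor at each of these scales. *)
Lemma EX_gauss_det m (M : Om -> 'M[R[i]]_m) (e : 'I_m -> I) :
  (forall i j, cmeasurable (fun x => M x i j)) ->
  (forall i x g, M (upd x (e i) g) =
     M x + (toC g - toC (x (e i))) *: delta_mx i i) ->
  forall k, (EX (fun x => expR (- (16 ^+ k * nsq (\det (M x)))))
             <= ((2 * K) ^+ m / 8 ^+ k)%:E)%E.
Proof.
elim: m M e => [|m IH] M e mM eM k.
  rewrite (eq_integral (fun w => (expR (- 16 ^+ k))%:E)); last first.
    by move=> w _; rewrite det_mx00 nsq1 mulr1.
  rewrite (EX_cst P X) lee_fin expr0 mul1r expRN lef_pV2 ?posrE ?expR_gt0 ?exprn_gt0 //.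
  apply: le_trans (expR_ge1Dx _); apply: ler_wpDl => //.
  by rewrite lerXn2r ?nnegrE //; lra.
pose M' x := row' 0 (col' 0 (M x)).
pose c x := \det (M' x).
have mM' i j : cmeasurable (fun x => M' x i j).
  rewrite (_ : (fun x => _) = fun x => M x (lift 0 i) (lift 0 j)) //.
  by apply/funext => x; rewrite !mxE.
have mc : cmeasurable c by exact: cmeasurable_det.
have mdet : cmeasurable (fun x => \det (M x)) by exact: cmeasurable_det.
have eM' i x g : M' (upd x (e (lift 0 i)) g) =
    M' x + (toC g - toC (x (e (lift 0 i)))) *: delta_mx i i.
  by rewrite /M' eM; apply/matrixP => a b; rewrite !mxE !(inj_eq (@lift_inj _ _)).
have {}IH := IH M' (fun i => e (lift 0 i)) mM' eM'.
have mexp t : measurable_fun setT (fun x => expR (- (t * nsq (c x)))).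
  apply: measurableT_comp => //; apply: measurable_funN.
  by apply: measurable_funM => //; exact: measurable_nsq.
have mmix l : measurable_fun setT (fun x => gauss_mix l (nsq (c x))).
  elim: l => [|l IHl] /=; first exact: measurable_cst.
  by apply: measurable_funD; exact: measurable_funM.
have D0 x : 0 < 1 + 16 ^+ k * nsq (c x).
  by rewrite ltr_wpDr // mulr_ge0 ?exprn_ge0 ?nsq_ge0.
have mV : measurable_fun setT (fun x => (1 + 16 ^+ k * nsq (c x))^-1).
  apply: measurable_inv_pos => //; apply: measurable_funD => //.
  by apply: measurable_funM => //; exact: measurable_nsq.
apply: (@le_trans _ _ (EX (fun x => (1 + 16 ^+ k * nsq (c x))^-1))).
  apply: (@resampling_le _ _ _ P I X mX lawX indX (e 0)
    (fun x => expR (- (16 ^+ k * nsq (\det (M x)))))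
    (fun x => (1 + 16 ^+ k * nsq (c x))^-1)) => //.
  - apply: measurableT_comp => //; apply: measurable_funN.
    by apply: measurable_funM => //; exact: measurable_nsq.
  move=> x; pose r := \det (M x) - c x * toC (x (e 0)).
  have dE g : \det (M (upd x (e 0) g)) = c x * toC g + r.
    by rewrite eM det_add_delta /r /c /M'; ring.
  under eq_integral do rewrite dE -[expR _]mul1r.
  rewrite gauss_step ?exprn_ge0 // lee_fin div1r ler_piMr ?invr_ge0 ?(ltW (D0 x)) //.
  rewrite -[leRHS]expR0 ler_expR oppr_le0 mulr_ge0 ?nsq_ge0 // divr_ge0 ?exprn_ge0 //.
  exact: ltW.
apply: (@le_trans _ _ (EX (fun x => gauss_mix k (nsq (c x))))).
  apply: (EX_le P mX (H := fun x => (1 + 16 ^+ k * nsq (c x))^-1)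
    (H' := fun x => gauss_mix k (nsq (c x)))) => // x.
    by rewrite invr_ge0 ltW.
  by apply: gauss_mix_ge; exact: nsq_ge0.
have K1 : 1 <= K by rewrite -[leLHS]expR0 ler_expR.
have Km1 : 1 <= (2 * K) ^+ m by rewrite exprn_ege1 //; lra.
clear D0 mV; elim: k => [|k IHk].
  rewrite [leLHS](EX_cst P X 1) lee_fin expr0 divr1 exprS; nra.
pose H x := expR (- (16 ^+ k.+1 * nsq (c x))).
pose H' x := gauss_mix k (nsq (c x)).
have mH : measurable_fun setT H by exact: mexp.
have mH' : measurable_fun setT H' by exact: mmix.
rewrite [leLHS](_ : _ = (K%:E * EX H + (16^-1)%:E * EX H')%E); last first.
  rewrite -(EX_lincomb P mX) ?expR_ge0 ?invr_ge0 //.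
  - by apply: eq_integral => w _; rewrite /= /H /H' [in RHS](mulrC _^-1).
  - by move=> x; exact: expR_ge0.
  - by move=> x; exact: gauss_mix_ge0.
(* The two terms [K / 8^(k+1)] and [2 K / (16 * 8^k)] are equal and add up to [2 K / 8^(k+1)]: hence
   the factor [2 * K] per row. *)
apply: (@le_trans _ _ (K%:E * ((2 * K) ^+ m / 8 ^+ k.+1)%:E +
    (16^-1)%:E * ((2 * K) ^+ m.+1 / 8 ^+ k)%:E)%E).
  apply: leeD; apply: lee_wpmul2l; rewrite ?lee_fin ?expR_ge0 ?invr_ge0 //.
  exact: IH.
rewrite -!EFinM -EFinD lee_fin le_eqVlt; apply/predU1P; left.
rewrite !exprS; have : 8 ^+ k != 0 :> R by rewrite expf_neq0.
by move: (_ ^+ m) (8 ^+ k) => a b b0; field.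
Qed.

End SmallBall.

(** * Algebra of matrix pencils *)

Lemma horner_deriv_sum (S : nzRingType) (J : Type) (r : seq J) (P : pred J)
    (F : J -> {poly S}) (c : S) :
  (\sum_(j <- r | P j) F j)^`().[c] = \sum_(j <- r | P j) (F j)^`().[c].
Proof. by rewrite raddf_sum horner_sum. Qed.

Lemma pevpE (S : comNzRingType) n d (A : 'I_d.+1 -> 'M[S]_n) a b i j :
  pevp A a b i j = \sum_(k < d.+1) a ^+ k * b ^+ (d - k) * A k i j.
Proof. by rewrite summxE; apply: eq_bigr => k _; rewrite mxE. Qed.

Lemma deriv_prod_seq (S : comNzRingType) (J : eqType) (r : seq J)
    (F : J -> {poly S}) : uniq r ->
  (\prod_(j <- r) F j)^`() =
  \sum_(k <- r) (F k)^`() * \prod_(j <- r | j != k) F j.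
Proof.
elim: r => [|j0 r IH] /=; first by rewrite !big_nil -polyC1 derivC.
move=> /andP[j0r ur]; rewrite !big_cons eqxx /= derivM IH //; congr (_ + _).
  congr (_ * _); rewrite [RHS]big_seq_cond [LHS]big_seq; apply: eq_bigl => j.
  by case: (boolP (j \in r)) => //= jr; rewrite (memPn j0r).
rewrite mulr_sumr; apply: eq_big_seq => k kr.
by rewrite big_cons (eq_sym j0) (memPn j0r) // mulrCA.
Qed.

Lemma deriv_prod (S : comNzRingType) (J : finType) (F : J -> {poly S}) :
  (\prod_j F j)^`() = \sum_k (F k)^`() * \prod_(j | j != k) F j.
Proof. exact/deriv_prod_seq/index_enum_uniq. Qed.

(** Jacobi's formula: differentiating the factor of row [i] in the Leibniz expansion and grouping
    the permutations by [s i = j] produces the cofactors. *)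
Lemma det_deriv (S : comNzRingType) n (M : 'M[{poly S}]_n) (c : S) :
  (\det M)^`().[c] =
  \sum_i \sum_j (M i j)^`().[c] * cofactor (map_mx (horner_eval c) M) i j.
Proof.
rewrite /determinant horner_deriv_sum.
under eq_bigr => s _.
  rewrite derivM (_ : ((-1) ^+ _)^`() = 0); last first.
    by rewrite -polyC1 -polyCN -polyC_exp derivC.
  rewrite mul0r add0r deriv_prod mulr_sumr horner_sum.
  over.
rewrite exchange_big /=; apply: eq_bigr => i _.
under [RHS]eq_bigr do rewrite expand_cofactor mulr_sumr.
rewrite (partition_big (fun s : 'S_n => s i) xpredT) //=.
apply: eq_bigr => j _; apply: eq_bigr => s /eqP sij.
rewrite !hornerM -polyC1 -polyCN -polyC_exp hornerC sij mulrCA; congr (_ * (_ * _)).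
rewrite horner_prod; apply: eq_big => k; first by rewrite eq_sym.
by move=> _; rewrite mxE /horner_eval.
Qed.

Section PevpAlgebra.
Variables (S : comNzRingType) (n d : nat).
Implicit Types (A : 'I_d.+1 -> 'M[S]_n) (a b l : S).

Lemma pevp_polyE A (p q : {poly S}) i j :
  pevp (polyc_mx A) p q i j =
  \sum_(k < d.+1) p ^+ k * q ^+ (d - k) * (A k i j)%:P.
Proof. by rewrite pevpE; apply: eq_bigr => k _; rewrite mxE. Qed.

(** At [k = 0] the truncated exponent [k.-1] is harmless, since [*+ 0] annihilates the term. *)
Lemma pevp_dalphaE A a b :
  pevp_dalpha A a b =
  \sum_(k < d.+1) (a ^+ k.-1 *+ k * b ^+ (d - k)) *: A k.
Proof.
apply/matrixP => i j; rewrite mxE pevp_polyE summxE horner_deriv_sum.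
apply: eq_bigr => k _; rewrite mxE !derivM !derivXn -polyC_exp !derivC.
by rewrite mulr0 addr0 mulr0 addr0 !hornerE hornerMn hornerXn.
Qed.

Lemma pevp_dbetaE A a b :
  pevp_dbeta A a b =
  \sum_(k < d.+1) (a ^+ k * (b ^+ (d - k).-1 *+ (d - k))) *: A k.
Proof.
apply/matrixP => i j; rewrite mxE pevp_polyE summxE horner_deriv_sum.
apply: eq_bigr => k _; rewrite mxE !derivM !derivXn -polyC_exp !derivC.
by rewrite mulr0 addr0 mul0r add0r !hornerE hornerMn hornerXn.
Qed.

Lemma pevp_scale A a b l : pevp A (l * a) (l * b) = l ^+ d *: pevp A a b.
Proof.
rewrite scaler_sumr; apply: eq_bigr => k _; rewrite scalerA !exprMn.
congr (_ *: _); have -> : l ^+ d = l ^+ k * l ^+ (d - k).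
  by rewrite -exprD subnKC // -ltnS.
ring.
Qed.

Lemma pevp_euler A a b :
  a *: pevp_dalpha A a b + b *: pevp_dbeta A a b = d%:R *: pevp A a b.
Proof.
rewrite pevp_dalphaE pevp_dbetaE !scaler_sumr -big_split /=.
apply: eq_bigr => k _; rewrite !scalerA -scalerDl; congr (_ *: _).
have kd : (k <= d)%N by rewrite -ltnS.
have E (c : S) m : c * (c ^+ m.-1 *+ m) = m%:R * c ^+ m.
  by case: m => [|m]; rewrite ?mulr0n ?mulr0 ?mul0r // mulrnAr -exprS mulr_natl.
rewrite mulrA E mulrCA E (_ : d%:R = k%:R + (d - k)%:R); first by ring.
by rewrite -natrD subnKC.
Qed.

Lemma deriv_pevp_line A (a b l m : S) i j :
  ((pevp (polyc_mx A) (a%:P + l%:P * 'X) (b%:P + m%:P * 'X)) i j)^`().[0] =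
  (l *: pevp_dalpha A a b + m *: pevp_dbeta A a b) i j.
Proof.
rewrite pevp_polyE horner_deriv_sum pevp_dalphaE pevp_dbetaE.
rewrite !scaler_sumr -big_split /= summxE; apply: eq_bigr => k _.
rewrite !mxE !derivM derivC mulr0 addr0 !deriv_exp.
rewrite !derivD !derivM !derivC !derivX !mul0r !add0r !mulr1.
rewrite !hornerE !hornerMn !hornerE.
by rewrite /= -(mulrnAr l) -(mulrnAr m); ring.
Qed.

End PevpAlgebra.

Section PevpScale.
Variables (S : comNzRingType) (n d : nat).
Implicit Types (A : 'I_d.+1 -> 'M[S]_n) (a b l : S).

Lemma pevp_dalpha_scale A a b l :
  pevp_dalpha A (l * a) (l * b) = l ^+ d.-1 *: pevp_dalpha A a b.
Proof.
rewrite !pevp_dalphaE scaler_sumr; apply: eq_bigr => -[[|k] kd] _ /=.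
  by rewrite !mulr0n !mul0r !scale0r scaler0.
rewrite scalerA !exprMn; congr (_ *: _).
have -> : l ^+ d.-1 = l ^+ k * l ^+ (d - k.+1).
  by rewrite -exprD; congr (_ ^+ _); rewrite ltnS in kd; rewrite -[in LHS](subnKC kd).
by rewrite -(mulr_natr (a ^+ k)) -(mulr_natr (l ^+ k * _)); ring.
Qed.

Lemma pevp_dbeta_scale A a b l :
  pevp_dbeta A (l * a) (l * b) = l ^+ d.-1 *: pevp_dbeta A a b.
Proof.
rewrite !pevp_dbetaE scaler_sumr; apply: eq_bigr => -[k kd] _ /=.
rewrite scalerA !exprMn; congr (_ *: _).
case E : (d - k)%N => [|m]; first by rewrite !mulr0n !mulr0.
have -> : l ^+ d.-1 = l ^+ k * l ^+ m.
  rewrite -exprD; congr (_ ^+ _); rewrite ltnS in kd.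
  by rewrite -[in LHS](subnKC kd) E addnS.
by rewrite /= -(mulr_natr (b ^+ m)) -(mulr_natr (l ^+ m * _)); ring.
Qed.

End PevpScale.

(** * The adjugate of a singular matrix *)

Section RankOne.
Variables (S : comNzRingType) (n : nat).
Implicit Types (M Q : 'M[S]_n) (x : 'cV[S]_n) (y : 'rV[S]_n).

(* Both sides are computed by Cramer's rule for the matrix obtained from [M]
   by replacing row [i] by the [j]-th basis vector. *)
Lemma cofactor_ker M x i j l : M *m x = 0 ->
  cofactor M i l * x j 0 = cofactor M i j * x l 0.
Proof.
move=> Mx; pose N := \matrix_(a, b) if a == i then (b == j)%:R else M a b.
have cN b : cofactor N i b = cofactor M i b.
  rewrite /cofactor; congr (_ * \det _).
  by apply/matrixP => p q; rewrite !mxE eq_sym (negbTE (neq_lift _ _)).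
have Nx : N *m x = x j 0 *: delta_mx i 0.
  apply/matrixP => a b; rewrite !mxE (ord1 b) eqxx andbT.
  have [->|ai] := eqVneq a i.
    rewrite (bigD1 j) //= mxE !eqxx mul1r big1 ?addr0 ?mulr1 // => c cj.
    by rewrite mxE eqxx (negbTE cj) mul0r.
  rewrite mulr0; transitivity ((M *m x) a 0); last by rewrite Mx mxE.
  by rewrite mxE; apply: eq_bigr => c _; rewrite mxE (negbTE ai).
have := congr1 (fun B => (B *m x) l 0) (mul_adj_mx N).
rewrite -mulmxA Nx -scalemxAr mul_scalar_mx !mxE (bigD1 i) //= big1; last first.
  by move=> c ci; rewrite !mxE (negbTE ci) mulr0.
rewrite !mxE !eqxx mulr1 addr0 cN mulrC => ->; congr (_ * _).
rewrite (expand_det_row _ i) (bigD1 j) //= big1; last first.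
  by move=> c cj; rewrite mxE eqxx (negbTE cj) mul0r.
by rewrite mxE !eqxx mul1r addr0 cN.
Qed.

Lemma cofactor_coker M y i j l : y *m M = 0 ->
  cofactor M l i * y 0 j = cofactor M j i * y 0 l.
Proof.
move=> yM; have : M^T *m y^T = 0 by rewrite -trmx_mul yM trmx0.
by move/(cofactor_ker i j l); rewrite !cofactor_tr !mxE.
Qed.

(** When [M] is singular of corank one, its adjugate is a multiple of [x *m y], and pairing with [Q]
    fixes the multiple. The cross-multiplied form holds without any assumption on the rank. It is
    used with [Q] the derivative of the pencil, for which the double sum is the derivative of the
    determinant. *)
Lemma cofactor_rank_one M Q x y i l : M *m x = 0 -> y *m M = 0 ->
  cofactor M i l * (y *m (Q *m x)) 0 0 =
  (\sum_p \sum_q Q p q * cofactor M p q) * (x l 0 * y 0 i).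
Proof.
move=> Mx yM; rewrite mxE mulr_sumr mulr_suml; apply: eq_bigr => p _.
rewrite mxE !mulr_sumr mulr_suml; apply: eq_bigr => q _.
have H1 := cofactor_ker i q l Mx; have H2 := cofactor_coker q p i yM.
rewrite (_ : _ * _ = (cofactor M i l * x q 0) * (y 0 p * Q p q)); last by ring.
rewrite H1 (_ : _ * _ = (cofactor M i q * y 0 p) * (x l 0 * Q p q)); last by ring.
by rewrite H2; ring.
Qed.

Lemma cofactor_trace M : \sum_p \sum_q M p q * cofactor M p q = n%:R * \det M.
Proof.
under eq_bigr do rewrite -expand_det_row.
by rewrite sumr_const card_ord mulr_natl.
Qed.

End RankOne.

(** * Upper bound for the condition number *)

Section MuBound.
Variables (R : realType) (n d : nat).
Implicit Types (A : 'I_d.+1 -> 'M[R[i]]_n) (a b z : R[i]).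
Implicit Types (x y : 'cV[R[i]]_n).

Definition msq p q (M : 'M[R[i]]_(p, q)) : R := \sum_i \sum_j nsq (M i j).

Lemma msq_ge0 p q (M : 'M[R[i]]_(p, q)) : 0 <= msq M.
Proof. by apply: sumr_ge0 => i _; apply: sumr_ge0 => j _; exact: nsq_ge0. Qed.

Lemma fnorm_sqr p q (M : 'M[R[i]]_(p, q)) : fnorm M ^+ 2 = msq M.
Proof.
rewrite /fnorm sqr_sqrtr.
  by apply: eq_bigr => i _; apply: eq_bigr => j _; rewrite normc_sqr.
by apply: sumr_ge0 => i _; apply: sumr_ge0 => j _; rewrite sqr_ge0.
Qed.

Definition tuple_msq A : R := \sum_k msq (A k).

Lemma tuple_msq_ge0 A : 0 <= tuple_msq A.
Proof. by apply: sumr_ge0 => k _; exact: msq_ge0. Qed.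

Lemma tuple_fnorm_sqr A : tuple_fnorm A ^+ 2 = tuple_msq A.
Proof.
rewrite /tuple_fnorm sqr_sqrtr; last by apply: sumr_ge0 => k _; rewrite sqr_ge0.
by apply: eq_bigr => k _; rewrite fnorm_sqr.
Qed.

Definition pevp_pairing A a b x y : R[i] :=
  Num.conj b * (adjoint y *m (pevp_dalpha A a b *m x)) 0 0
  - Num.conj a * (adjoint y *m (pevp_dbeta A a b *m x)) 0 0.

Lemma mu_formula_sqr A a b x y :
  mu_formula A a b x y ^+ 2 =
  (\sum_(k < d.+1) nsq a ^+ k * nsq b ^+ (d - k)) *
  (msq x * msq y / nsq (pevp_pairing A a b x y)) * tuple_msq A.
Proof.
rewrite /mu_formula !exprMn tuple_fnorm_sqr exprVn normc_sqr !fnorm_sqr.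
rewrite sqr_sqrtr; last first.
  by apply: sumr_ge0 => k _; rewrite mulr_ge0 ?exprn_ge0 ?normc_ge0.
congr (_ * (_ / nsq _) * _).
  by apply: eq_bigr => k _; rewrite -mulnBr !exprM !normc_sqr.
rewrite /pevp_pairing mulmxBr -!scalemxAr.
by move: (adjoint y *m _) (adjoint y *m _) => U V; rewrite !mxE.
Qed.

Definition cof_msq A z : R :=
  \sum_i \sum_j nsq (cofactor (pevp A z 1) i j).

(** Jacobi's expression of [f'(z)]; see [det_pencil_deriv]. *)
Definition char_deriv A z : R[i] :=
  \sum_i \sum_j pevp_dalpha A z 1 i j * cofactor (pevp A z 1) i j.

Definition mu_weight A z : R :=
  (1 + nsq z) ^- 2 * ((\sum_(k < d.+1) nsq z ^+ k) * cof_msq A z) * tuple_msq A.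

Lemma mu_weight_ge0 A z : 0 <= mu_weight A z.
Proof.
rewrite mulr_ge0 ?tuple_msq_ge0 // mulr_ge0 //.
  by rewrite invr_ge0 sqr_ge0.
rewrite mulr_ge0 //; first by apply: sumr_ge0 => k _; rewrite exprn_ge0 ?nsq_ge0.
by apply: sumr_ge0 => i _; apply: sumr_ge0 => j _; exact: nsq_ge0.
Qed.

(** Euler's identity expresses the pairing with the beta-derivative as [- z * q], where [q] is the
    pairing with the alpha-derivative; the vector [v] then yields [(1 + |z|^2) * q] up to powers of
    [b], which cancel. [cofactor_rank_one], summed over all entries in squared modulus, trades
    [|x|^2 |y|^2 / |q|^2] for [cof_msq / |f'|^2]. *)
Lemma mu_formula_le A a b x y : (0 < d)%N -> b != 0 ->
  right_eigenvector A a b x -> left_eigenvector A a b y ->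
  char_deriv A (a / b) != 0 ->
  mu_formula A a b x y ^+ 2 <= mu_weight A (a / b) / nsq (char_deriv A (a / b)).
Proof.
move=> d0 b0 [_ Px] [_ yP]; set z := a / b => T0.
have az : a = b * z by rewrite mulrC divfK.
clearbody z; have bz : b = b * 1 by rewrite mulr1.
have bd0 : b ^+ d != 0 by rewrite expf_neq0.
have P1x : pevp A z 1 *m x = 0.
  move: Px; rewrite az [in X in pevp _ _ X]bz pevp_scale -scalemxAl => /eqP.
  by rewrite scaler_eq0 (negbTE bd0) => /eqP.
have yP1 : adjoint y *m pevp A z 1 = 0.
  move: yP; rewrite az [in X in pevp _ _ X]bz pevp_scale -scalemxAr => /eqP.
  by rewrite scaler_eq0 (negbTE bd0) => /eqP.
pose q := (adjoint y *m (pevp_dalpha A z 1 *m x)) 0 0.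
have qb : (adjoint y *m (pevp_dbeta A z 1 *m x)) 0 0 = - (z * q).
  apply/eqP; rewrite -addr_eq0; apply/eqP.
  have := congr1 (fun M => (adjoint y *m (M *m x)) 0 0) (pevp_euler A z 1).
  rewrite /q scale1r -scalemxAl P1x scaler0 mulmx0 mulmxDl mulmxDr -scalemxAl.
  rewrite -scalemxAr; move: (adjoint y *m _) (adjoint y *m _) => U V.
  by rewrite !mxE addrC.
have pairE : pevp_pairing A a b x y =
    Num.conj b * b ^+ d.-1 * ((1 + z * Num.conj z) * q).
  rewrite /pevp_pairing az [X in pevp_dalpha _ _ X]bz [X in pevp_dbeta _ _ X]bz.
  rewrite pevp_dalpha_scale pevp_dbeta_scale -!scalemxAl -!scalemxAr.
  move: qb; rewrite /q; move: (adjoint y *m _) (adjoint y *m _) => U V.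
  by rewrite !mxE => ->; rewrite rmorphM /=; ring.
have nsq_pair : nsq (pevp_pairing A a b x y) =
    nsq b ^+ d * (1 + nsq z) ^+ 2 * nsq q.
  rewrite pairE !nsqM nsq_conj nsqX -exprS prednK // mulrA; congr (_ * _ * _).
  case: (z) => u v; rewrite !nsqE /=. ring.
have sumE : \sum_(k < d.+1) nsq a ^+ k * nsq b ^+ (d - k) =
    nsq b ^+ d * \sum_(k < d.+1) nsq z ^+ k.
  rewrite mulr_sumr; apply: eq_bigr => k _; rewrite az nsqM exprMn.
  have -> : nsq b ^+ d = nsq b ^+ k * nsq b ^+ (d - k).
    by rewrite -exprD subnKC // -ltnS.
  ring.
have rk : cof_msq A z * nsq q = nsq (char_deriv A z) * (msq x * msq y).
  have -> : msq x * msq y = \sum_i \sum_l nsq (x l 0) * nsq (adjoint y 0 i).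
    rewrite exchange_big /= /msq mulr_suml; apply: eq_bigr => l _.
    rewrite big_ord1 -mulr_sumr; congr (_ * _); apply: eq_bigr => i _.
    by rewrite big_ord1 !mxE nsq_conj.
  rewrite /cof_msq mulr_suml mulr_sumr; apply: eq_bigr => i _.
  rewrite mulr_suml mulr_sumr; apply: eq_bigr => l _.
  by rewrite -!nsqM (cofactor_rank_one _ _ _ P1x yP1).
rewrite mu_formula_sqr sumE nsq_pair.
(* If [q = 0], division by zero makes the left-hand side 0. *)
have [q0|q0] := eqVneq (nsq q) 0.
  rewrite q0 mulr0 invr0 !mulr0 mul0r divr_ge0 ?nsq_ge0 //.
  exact: mu_weight_ge0.
rewrite le_eqVlt; apply/predU1P; left.
have nT : nsq (char_deriv A z) != 0 by rewrite nsq_eq0.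
have nb : nsq b ^+ d != 0 by rewrite expf_neq0 // nsq_eq0.
have nz : 1 + nsq z != 0 by rewrite gt_eqF // ltr_wpDr // nsq_ge0.
have -> : msq x * msq y = cof_msq A z * nsq q / nsq (char_deriv A z).
  by rewrite rk mulrAC mulfV // mul1r.
rewrite /mu_weight; move: (\sum_(k < _) _) (cof_msq _ _) (tuple_msq _) nT nb nz q0.
move: (nsq _) (nsq _) (nsq b ^+ d) (nsq _) => r1 r2 r3 r4 s1 s2 s3 h1 h2 h3 h4.
field; rewrite ?h1 ?h2 ?h3 ?h4 //.
Qed.
End MuBound.

(** * The determinant in the affine chart and its zeros *)

Section CharPoly.
Variables (S : comNzRingType) (n d : nat).
Implicit Types (A : 'I_d.+1 -> 'M[S]_n).

Lemma map_pevp_poly A (p q : {poly S}) c :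
  map_mx (horner_eval c) (pevp (polyc_mx A) p q) = pevp A p.[c] q.[c].
Proof.
apply/matrixP => i j; rewrite mxE pevp_polyE pevpE /horner_eval horner_sum.
by apply: eq_bigr => k _; rewrite !hornerE.
Qed.

Definition det_pencil A : {poly S} := \det (pevp (polyc_mx A) 'X 1%:P).

Lemma horner_det_pevp A (p q : {poly S}) c :
  (\det (pevp (polyc_mx A) p q)).[c] = \det (pevp A p.[c] q.[c]).
Proof. by rewrite -map_pevp_poly det_map_mx. Qed.

Lemma det_pencilE A z : (det_pencil A).[z] = \det (pevp A z 1).
Proof. by rewrite horner_det_pevp !hornerE. Qed.

Lemma det_pencil_deriv A z : (det_pencil A)^`().[z] =
  \sum_i \sum_j pevp_dalpha A z 1 i j * cofactor (pevp A z 1) i j.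
Proof.
rewrite det_deriv map_pevp_poly hornerX hornerC.
by apply: eq_bigr => i _; apply: eq_bigr => j _; rewrite [pevp_dalpha _ _ _ _ _]mxE.
Qed.

End CharPoly.

Section Eigenvalues.
Variables (R : realType) (n d : nat).
Hypotheses (n0 : (0 < n)%N) (d0 : (0 < d)%N).
Implicit Types (A : 'I_d.+1 -> 'M[R[i]]_n) (a b z : R[i]).

Lemma one_plus_conj_neq0 z : 1 + z * Num.conj z != 0.
Proof.
rewrite -nsq_eq0; case: z => u v; rewrite nsqE /=.
have := sqr_ge0 u; have := sqr_ge0 v => v2 u2.
by rewrite gt_eqF //; nra.
Qed.

(** Euler's identity, paired with the cofactors, gives [d * n * det = 0] at an eigenvalue, so the
    beta-derivative of the determinant is [- z * f'(z)]. The tangent derivative is therefore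
    [(1 + |z|^2) * f'(z)] times powers of [b] and its conjugate. *)
Lemma tangent_det_derivative_neq0 A a b : b != 0 ->
  \det (pevp A a b) = 0 -> char_deriv A (a / b) != 0 ->
  tangent_det_derivative A a b != 0.
Proof.
move=> b0 Pab; set z := a / b => T0.
have az : a = b * z by rewrite mulrC divfK.
clearbody z; have bz : b = b * 1 by rewrite mulr1.
have P1 : \det (pevp A z 1) = 0.
  move: Pab; rewrite az [X in pevp _ _ X]bz pevp_scale detZ => /eqP.
  by rewrite mulf_eq0 !expf_eq0 (negbTE b0) !andbF => /eqP.
suff -> : tangent_det_derivative A a b =
  (Num.conj b * b ^+ d.-1 * (b ^+ d) ^+ n.-1) *
  ((1 + z * Num.conj z) * char_deriv A z).
  rewrite !mulf_neq0 ?expf_neq0 ?conjC_eq0 ?one_plus_conj_neq0 //.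
rewrite /tangent_det_derivative -mulNr -polyCN det_deriv.
rewrite map_pevp_poly !hornerE.
under eq_bigr do under eq_bigr do rewrite deriv_pevp_line.
rewrite az [X in pevp_dalpha _ _ X]bz [X in pevp_dbeta _ _ X]bz [X in pevp _ _ X]bz.
rewrite pevp_scale pevp_dalpha_scale pevp_dbeta_scale rmorphM /=.
have Tb : \sum_i \sum_j pevp_dbeta A z 1 i j * cofactor (pevp A z 1) i j =
    - (z * char_deriv A z).
  apply/eqP; rewrite -addr_eq0 /char_deriv mulr_sumr -big_split /=; apply/eqP.
  transitivity (d%:R * (\sum_p \sum_q pevp A z 1 p q * cofactor (pevp A z 1) p q));
    last by rewrite cofactor_trace P1 !mulr0.
  rewrite mulr_sumr.
  apply: eq_bigr => i _; rewrite !mulr_sumr -big_split /=; apply: eq_bigr => j _.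
  have := congr1 (fun M : 'M[R[i]]_n => M i j) (pevp_euler A z 1).
  move: (pevp_dalpha A z 1) (pevp_dbeta A z 1) (pevp A z 1) => U V W.
  by rewrite scale1r !mxE => E; rewrite mulrA -E; ring.
rewrite -[RHS]mulrA
  (_ : (1 + z * _) * _ = char_deriv A z - Num.conj z * - (z * char_deriv A z)).
  rewrite -Tb /char_deriv !mulr_sumr -sumrB mulr_sumr; apply: eq_bigr => i _.
  rewrite !mulr_sumr -sumrB mulr_sumr; apply: eq_bigr => j _.
  rewrite cofactorZ; move: (pevp_dalpha A z 1) (pevp_dbeta A z 1) => U V.
  by rewrite !mxE; ring.
by ring.
Qed.

Lemma pevp_infinity A a : pevp A a 0 = a ^+ d *: A ord_max.
Proof.
rewrite /pevp big_ord_recr /= subnn expr0 mulr1 big1 ?add0r // => k _.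
by rewrite expr0n subn_eq0 leqNgt ltn_ord mulr0 scale0r.
Qed.

Lemma Eig_finite A a b : \det (A ord_max) != 0 -> Eig A (a, b) -> b != 0.
Proof.
move=> Ad [ab0 /=]; apply: contraPneq => b0; rewrite b0 in ab0 *.
rewrite pevp_infinity detZ => /eqP; rewrite mulf_eq0 (negbTE Ad) orbF.
rewrite !expf_eq0 => /andP[_ /andP[_ /eqP a0]]; move: ab0; rewrite a0.
by rewrite eqxx.
Qed.

Lemma poly_eq0_off0 (p : {poly R[i]}) : (forall w, w != 0 -> p.[w] = 0) -> p = 0.
Proof.
move=> p0; apply: (@roots_geq_poly_eq0 _ p [seq (i.+1)%:R | i <- iota 0 (size p)]).
- apply/allP => _ /mapP[i _ ->]; by rewrite rootE p0.
- rewrite map_inj_uniq ?iota_uniq // => i j /eqP; rewrite eqr_nat => /eqP.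
  by case.
- by rewrite size_map size_iota.
Qed.

(** An empty spectrum would make [mu_max] equal to [-oo], whose square is [+oo]. If [f] had no zero
    it would be a constant [c]; by homogeneity [det P(A, 1, w) = c * w^(d n)] for [w != 0], hence
    also at [w = 0], where the left-hand side is [det A_d]. *)
Lemma Eig_neq0 A : \det (A ord_max) != 0 -> exists ab, Eig A ab.
Proof.
move=> Ad; have [[z /eqP]|nr] := pselect (exists z, (det_pencil A).[z] == 0).
  rewrite det_pencilE => Pz; exists (z, 1); split=> //=.
  by rewrite -pair_eqE /= negb_and oner_eq0 orbT.
have /size_poly1P[c c0 fc] : size (det_pencil A) == 1%N.
  by apply/negPn/negP => /closed_rootP[z fz]; apply: nr; exists z.
pose g := \det (pevp (polyc_mx A) 1%:P 'X).
suff g0 : g - c%:P * 'X^(d * n) = 0.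
  move: Ad; suff -> : \det (A ord_max) = 0 by rewrite eqxx.
  have := congr1 (fun p => p.[0]) g0; rewrite !hornerE horner_det_pevp !hornerE.
  have /negbTE dn : (d * n)%N != 0%N by rewrite -lt0n muln_gt0 d0.
  by rewrite pevp_infinity expr1n scale1r expr0n dn mulr0 subr0.
apply: poly_eq0_off0 => w w0; rewrite !hornerE horner_det_pevp !hornerE.
rewrite -[in X in pevp _ X _](mulfV w0) -[in X in pevp _ _ X](mulr1 w).
rewrite pevp_scale detZ -det_pencilE fc hornerC -exprM.
by rewrite mulrC subrr.
Qed.

(** A supremum over the empty set would be [-oo], so a pair of eigenvectors has to be exhibited. *)
Lemma mu_ge0 A a b : \det (pevp A a b) = 0 -> (0 <= mu A a b)%E.
Proof.
move=> Pab; rewrite /mu; case: ifP => // _.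
have /det0P[v v0 vP] : \det (pevp A a b) == 0 by rewrite Pab.
have /det0P[u u0 uP] : \det (pevp A a b)^T == 0 by rewrite det_tr Pab.
pose y := (map_mx Num.conj v)^T.
have yv : adjoint y = v.
  by apply/matrixP => i j; rewrite !mxE conjCK.
apply: (@le_trans _ _ (mu_formula A a b u^T y)%:E).
  rewrite lee_fin !mulr_ge0 ?sqrtr_ge0 // ?invr_ge0; exact: normc_ge0.
apply: ereal_sup_ubound; exists (u^T, y) => //; split; split => /=.
- by rewrite -trmx0 (inj_eq trmx_inj).
- by rewrite -[pevp A a b]trmxK -trmx_mul uP trmx0.
- apply: contraNneq v0 => y0; rewrite -yv y0; apply/eqP/matrixP => i j.
  by rewrite !mxE conjC0.
- by rewrite yv.
Qed.

Lemma mu_max_sqr_le A (Y : \bar R) : \det (A ord_max) != 0 ->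
  (forall z, \det (pevp A z 1) = 0 -> char_deriv A z != 0) ->
  (forall z, \det (pevp A z 1) = 0 ->
     ((mu_weight A z / nsq (char_deriv A z))%:E <= Y)%E) ->
  (mu_max A ^+ 2 <= Y)%E.
Proof.
move=> Ad simple bound.
have P1 a b : b != 0 -> \det (pevp A a b) = 0 -> \det (pevp A (a / b) 1) = 0.
  move=> b0; rewrite -{1}(divfK b0 a) mulrC -[X in pevp _ _ X]mulr1 pevp_scale.
  by rewrite detZ => /eqP; rewrite mulf_eq0 !expf_eq0 (negbTE b0) !andbF => /eqP.
have [[a b] E] := Eig_neq0 Ad.
have mm0 : (0 <= mu_max A)%E.
  apply: (@le_trans _ _ (mu A a b)); first by apply: mu_ge0; case: E.
  by apply: ereal_sup_ubound; exists (a, b).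
case: Y bound => [r|_|]; last 2 first.
- by rewrite leey.
- move=> /(_ (a / b)); have [_ /= Pab] := E.
  by move=> /(_ (P1 a b (Eig_finite Ad E) Pab)).
move=> bound.
have mmr : (mu_max A <= (Num.sqrt r)%:E)%E.
  apply: ge_ereal_sup => _ [[a' b'] E' <-] /=; have [_ /= Pab'] := E'.
  have b'0 := Eig_finite Ad E'.
  have T0 := simple _ (P1 _ _ b'0 Pab').
  rewrite /mu (negbTE (tangent_det_derivative_neq0 b'0 Pab' T0)).
  apply: ge_ereal_sup => _ [[x y] [/= Rx Ly] <-]; rewrite lee_fin.
  rewrite -(ger0_norm (_ : 0 <= mu_formula A a' b' x y)); last first.
    by rewrite !mulr_ge0 ?sqrtr_ge0 // ?invr_ge0; exact: normc_ge0.
  rewrite -sqrtr_sqr ler_wsqrtr //.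
  apply: le_trans (mu_formula_le d0 b'0 Rx Ly T0) _.
  by rewrite -lee_fin; apply: bound; exact: P1.
have r0 : 0 <= r.
  have [_ /= Pab] := E; have := bound _ (P1 _ _ (Eig_finite Ad E) Pab).
  rewrite lee_fin; apply: le_trans; rewrite divr_ge0 ?nsq_ge0 //.
  exact: mu_weight_ge0.
case: (mu_max A) mm0 mmr => [m| |] //; rewrite !lee_fin => m0 mr.
by rewrite -expr2 -(sqr_sqrtr r0) lerXn2r ?nnegrE ?sqrtr_ge0.
Qed.

End Eigenvalues.

(** * Localization at simple zeros *)

Section Chart.
Variable R : realType.
Local Notation leb := (@lebesgue_measure R).
Local Notation leb2 := (leb \x leb)%E.
Implicit Types (z w : R[i]) (p q : {poly R[i]}).

Lemma integral_gauss_center (a : R) z : 0 < a ->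
  (\int[leb2]_g (expR (- (a * nsq (toC g - z))))%:E = (pi / a)%:E)%E.
Proof.
move=> a0; rewrite -(integral_gauss2 (- complex.Re z) (- complex.Im z) a0).
by apply: eq_integral => -[x y] _; case: z => u v; rewrite nsqE.
Qed.

Lemma measurable_gauss_center (a : R) z :
  measurable_fun setT (fun g => expR (- (a * nsq (toC g - z)))).
Proof.
apply: measurableT_comp => //; apply: measurable_funN; apply: measurable_funM => //.
apply: measurable_nsq; apply: cmeasurableD; first exact: cmeasurable_toC.
exact: cmeasurable_cst.
Qed.

Lemma cmeasurable_horner p : cmeasurable (fun g : R * R => p.[toC g]).
Proof.
elim/poly_ind: p => [|p c IH].
  rewrite (_ : (fun _ => _) = fun=> 0); first exact: cmeasurable_cst.
  by apply/funext => g; rewrite horner0.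
rewrite (_ : (fun _ => _) = fun g => p.[toC g] * toC g + c).
  apply: cmeasurableD; last exact: cmeasurable_cst.
  by apply: cmeasurableM => //; exact: cmeasurable_toC.
by apply/funext => g; rewrite !hornerE.
Qed.

Lemma nsq_horner_bounded p z0 :
  exists2 K : R, 0 <= K & forall z, nsq (z - z0) <= 1 -> nsq p.[z] <= K.
Proof.
elim/poly_ind: p => [|p c [K K0 IH]].
  by exists 0 => // z _; rewrite horner0 nsq0.
exists (2 * (K * (2 + 2 * nsq z0)) + 2 * nsq c).
  have h1 := nsq_ge0 c; have h2 := nsq_ge0 z0.
  by rewrite addr_ge0 // mulr_ge0 // mulr_ge0 // addr_ge0 // mulr_ge0.
move=> z zz0; rewrite hornerMXaddC; apply: le_trans (nsqD_le _ _) _.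
rewrite lerD2r ler_pM2l // nsqM ler_pM ?nsq_ge0 ?IH //.
rewrite -[z](subrK z0); apply: le_trans (nsqD_le _ _) _.
by rewrite lerD2r -[leRHS]mulr1 ler_pM2l.
Qed.

(** The cross term is absorbed by [2 |u v| <= s u^2 + v^2 / s], so that continuity can be handled
    with squared moduli only. *)
Lemma nsqD_dist (a b : R[i]) (s : R) : 0 < s ->
  `|nsq (a + b) - nsq a| <= s * nsq a + (1 + s^-1) * nsq b.
Proof.
move=> s0; case: a b => a1 a2 [b1 b2]; rewrite !nsqE /= ler_norml.
have H (u v : R) : - (s * u ^+ 2 + s^-1 * v ^+ 2) <= 2 * u * v
    <= s * u ^+ 2 + s^-1 * v ^+ 2.
  have E : s * u ^+ 2 + s^-1 * v ^+ 2 - 2 * u * v = s^-1 * (s * u - v) ^+ 2.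
    by field; rewrite gt_eqF.
  have E' : s * u ^+ 2 + s^-1 * v ^+ 2 + 2 * u * v = s^-1 * (s * u + v) ^+ 2.
    by field; rewrite gt_eqF.
  have si : 0 <= s^-1 by rewrite invr_ge0 ltW.
  have : 0 <= s^-1 * (s * u - v) ^+ 2 by rewrite mulr_ge0 ?sqr_ge0.
  have : 0 <= s^-1 * (s * u + v) ^+ 2 by rewrite mulr_ge0 ?sqr_ge0.
  lra.
have /andP[H1 H2] := H a1 b1; have /andP[H3 H4] := H a2 b2.
have := sqr_ge0 b1; have := sqr_ge0 b2 => b20 b10.
have := sqr_ge0 a1; have := sqr_ge0 a2 => a20 a10.
have sb1 : 0 <= s^-1 * b1 ^+ 2 by rewrite mulr_ge0 // invr_ge0 ltW.
have sb2 : 0 <= s^-1 * b2 ^+ 2 by rewrite mulr_ge0 // invr_ge0 ltW.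
have sa1 : 0 <= s * a1 ^+ 2 by rewrite mulr_ge0 // ltW.
have sa2 : 0 <= s * a2 ^+ 2 by rewrite mulr_ge0 // ltW.
by apply/andP; split; nra.
Qed.

(** The neighbourhood filter of [z0], described by squared distances to match the estimates on
    [nsq]. *)
Definition near_point z0 : set_system R[i] :=
  [set U | exists2 r : R, 0 < r & forall z, nsq (z - z0) <= r -> U z].

#[global] Instance near_point_filter z0 : ProperFilter (near_point z0).
Proof.
split; first by move=> [r r0 /(_ z0)]; apply; rewrite subrr nsq0 ltW.
split.
- by exists 1.
- move=> U V [r r0 Ur] [s s0 Vs]; exists (Num.min r s); first by rewrite lt_min r0.
  by move=> z; rewrite le_min => /andP[zr zs]; split; [exact: Ur|exact: Vs].
- by move=> U V UV [r r0 Ur]; exists r => // z /Ur /UV.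
Qed.

Lemma nsq_horner_cvg p z0 :
  nsq p.[z] @[z --> near_point z0] --> nsq p.[z0].
Proof.
have /factor_theorem[q pq] : root (p - (p.[z0])%:P) z0.
  by rewrite rootE !hornerE subrr.
have [K K0 qK] := nsq_horner_bounded q z0.
apply/cvgrPdist_le => /= e e0.
pose N := nsq p.[z0]; have N0 : 0 <= N by exact: nsq_ge0.
(* [s] makes the error proportional to [N] at most [e / 2], and [B] does the same for the error
   proportional to [|z - z0|^2]; the summands 1 keep both denominators positive. *)
pose s := e / (2 * (N + 1)); have s0 : 0 < s.
  by rewrite divr_gt0 // mulr_gt0 // ltr_wpDl.
pose B := 2 * ((1 + s^-1) * K) + 1.
have B0 : 0 < B.
  by rewrite ltr_wpDl // mulr_ge0 // mulr_ge0 // addr_ge0 // invr_ge0 ltW.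
exists (Num.min 1 (e / B)); first by rewrite lt_min ltr01 divr_gt0.
move=> z; rewrite le_min => /andP[z1 zB].
have pE : p.[z] = p.[z0] + q.[z] * (z - z0).
  have := congr1 (fun f => f.[z]) pq; rewrite !hornerE => <-.
  by rewrite addrC subrK.
rewrite distrC pE; apply: le_trans (nsqD_dist _ _ s0) _; rewrite -/N nsqM.
have h1 : s * N <= e / 2.
  rewrite /s -mulrA ler_pM2l // invfM -mulrA ler_piMr ?invr_ge0 //.
  by rewrite mulrC ler_pdivrMr ?ltr_wpDl // mul1r lerDl.
have h2 : (1 + s^-1) * (nsq q.[z] * nsq (z - z0)) <= (1 + s^-1) * K * (e / B).
  rewrite -mulrA; apply: ler_wpM2l; first by rewrite addr_ge0 ?invr_ge0 ?(ltW s0).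
  by rewrite ler_pM ?nsq_ge0 // qK.
have h3 : (1 + s^-1) * K * (e / B) <= e / 2.
  rewrite mulrCA -mulrA ler_pM2l // mulrA.
  rewrite ler_pdivrMr // /B; lra.
lra.
Qed.

Definition zero_kernel p (t : R) (g : R * R) : R :=
  t / pi * expR (- (t * nsq p.[toC g])).

Lemma zero_kernel_ge0 p t g : 0 <= t -> 0 <= zero_kernel p t g.
Proof. by move=> t0; rewrite mulr_ge0 ?expR_ge0 // divr_ge0 ?pi_ge0. Qed.

Lemma measurable_zero_kernel p t : measurable_fun setT (zero_kernel p t).
Proof.
apply: measurable_funM => //; apply: measurableT_comp => //.
apply: measurable_funN; apply: measurable_funM => //.
by apply: measurable_nsq; exact: cmeasurable_horner.
Qed.

(* Near the zero, [p] is bounded by [L |z - z0|] and the weight is at least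
   [w'], so the integrand dominates a Gaussian up to a truncation error. *)
Lemma zero_kernel_lower p z0 (wt : R[i] -> R) (L w' r t : R) :
  (forall z, 0 <= wt z) -> measurable_fun setT (fun g => wt (toC g)) ->
  0 < L -> 0 <= w' -> 0 < r -> 0 < t ->
  (forall z, nsq (z - z0) <= r ->
     nsq p.[z] <= L * nsq (z - z0) /\ w' <= wt z) ->
  ((w' / L)%:E <=
   \int[leb2]_g (zero_kernel p t g * wt (toC g))%:E
     + (2 * w' / L * expR (- (t * L * r / 2)))%:E)%E.
Proof.
move=> wt0 mwt L0 w'0 r0 t0 H.
have tL : 0 < t * L by exact: mulr_gt0.
have pi0 : 0 < pi :> R by exact: pi_gt0.
pose C := w' * t / pi; have C0 : 0 <= C by rewrite divr_ge0 ?mulr_ge0 // ltW.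
pose E := expR (- (t * L * r / 2)).
have E0 : 0 <= E by exact: expR_ge0.
have CE0 : 0 <= C * E by exact: mulr_ge0.
pose G a g := expR (- (a * nsq (toC g - z0))).
have mG a : measurable_fun setT (fun g => (G a g)%:E).
  by apply/measurable_EFinP; exact: measurable_gauss_center.
have G0 a g : 0 <= G a g by exact: expR_ge0.
have I1 : (\int[leb2]_g (C%:E * (G (t * L) g)%:E) = (w' / L)%:E)%E.
  rewrite ge0_integralZl_EFin //;
    [|by move=> g _; rewrite lee_fin|exact: mG].
  rewrite integral_gauss_center // -EFinM; congr (_%:E).
  by rewrite /C mulrA divfK ?gt_eqF //; field; rewrite !gt_eqF.
have I2 : (\int[leb2]_g ((C * E)%:E * (G (t * L / 2) g)%:E) =
    (2 * w' / L * E)%:E)%E.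
  rewrite ge0_integralZl_EFin //;
    [|by move=> g _; rewrite lee_fin|exact: mG].
  rewrite integral_gauss_center ?divr_gt0 // -EFinM; congr (_%:E).
  have -> : C * E * (pi / (t * L / 2)) = (w' * t / pi * pi) * (E / (t * L / 2)).
    by rewrite /C; ring.
  rewrite divfK ?gt_eqF //; field.
  by rewrite !gt_eqF.
have mK : measurable_fun setT (fun g => (zero_kernel p t g * wt (toC g))%:E).
  apply/measurable_EFinP; apply: measurable_funM => //.
  exact: measurable_zero_kernel.
have K0 g : 0 <= zero_kernel p t g * wt (toC g).
  by rewrite mulr_ge0 // zero_kernel_ge0 // ltW.
rewrite -I1 -I2 -ge0_integralD //; last 3 first.
- by move=> g _; rewrite lee_fin.
- by move=> g _; rewrite mule_ge0 ?lee_fin.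
- apply: measurable_funeM; exact: mG.
apply: ge0_le_integral => //.
- by move=> g _; rewrite mule_ge0 ?lee_fin.
- apply: measurable_funeM; exact: mG.
- by apply: emeasurable_funD => //; apply: measurable_funeM; exact: mG.
move=> g _; rewrite -!EFinM -EFinD lee_fin.
have [zr|zr] := leP (nsq (toC g - z0)) r.
  have [pL wL] := H _ zr; apply: ler_wpDr; first by rewrite mulr_ge0.
  have tp0 : 0 <= t / pi by rewrite divr_ge0 // ltW.
  have -> : C * G (t * L) g = t / pi * G (t * L) g * w' by rewrite /C; ring.
  apply: ler_pM => //; first by rewrite mulr_ge0.
  apply: ler_wpM2l => //; rewrite ler_expR lerN2 -mulrA.
  by apply: ler_wpM2l => //; exact: ltW.
(* Outside the disc, half of the exponent is spent on the factor [E], the other half remains as the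
   integrable Gaussian of [I2]. *)
apply: ler_wpDl => //; rewrite -[leRHS]mulrA; apply: ler_wpM2l => //.
rewrite /E /G -expRD ler_expR; set x := nsq _ in zr *.
have : t * L * r <= t * L * x by apply: ler_wpM2l => //; exact: ltW.
lra.
Qed.

Lemma simple_zero_lower p z0 (wt : R[i] -> R) (c : R) :
  root p z0 -> p^`().[z0] != 0 ->
  (forall z, 0 <= wt z) -> measurable_fun setT (fun g => wt (toC g)) ->
  wt z @[z --> near_point z0] --> wt z0 ->
  c < wt z0 / nsq p^`().[z0] ->
  exists K : nat, forall k, (K <= k)%N ->
    (c%:E <= \int[leb2]_g (zero_kernel p (k.+1%:R ^+ 2) g * wt (toC g))%:E)%E.
Proof.
move=> /factor_theorem[q pq] dp wt0 mwt wtc cw.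
have dpE : p^`().[z0] = q.[z0].
  by rewrite pq derivM derivXsubC mulr1 hornerD hornerM hornerXsubC subrr mulr0 add0r.
rewrite {}dpE in dp cw; set N := nsq q.[z0] in cw.
have N0 : 0 < N by rewrite lt_neqAle nsq_ge0 eq_sym nsq_eq0 dp.
have [c0|c0] := ltP c 0.
  exists 0%N => k _; apply: (@le_trans _ _ 0%E); first by rewrite lee_fin ltW.
  apply: integral_ge0 => g _; rewrite lee_fin mulr_ge0 //.
  by apply: zero_kernel_ge0; exact: sqr_ge0.
have gap : 0 < wt z0 - c * N by rewrite subr_gt0 -ltr_pdivlMr.
have c1 : 0 < 1 + c by rewrite ltr_wpDr.
(* With this [e], lowering the weight to [w'] and raising [N] to [L] consumes exactly half of the
   gap: [h = w' - c * L = (wt z0 - c * N) / 2]. *)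
pose e := (wt z0 - c * N) / (2 * (1 + c)).
have e0 : 0 < e by rewrite divr_gt0 // mulr_gt0.
have ee : e * (1 + c) = (wt z0 - c * N) / 2.
  by rewrite /e; field; rewrite gt_eqF.
pose L := N + e; pose w' := wt z0 - e.
have L0 : 0 < L by rewrite addr_gt0.
pose h := w' - c * L.
have h0 : 0 < h by rewrite /h /w' /L; lra.
have w'0 : 0 <= w'.
  have : 0 <= c * L by rewrite mulr_ge0 // ltW.
  by move: h0; rewrite /h; lra.
have [r r0 Hr] : near_point z0 [set z | nsq q.[z] <= L /\ w' <= wt z].
  have /cvgrPdist_le/(_ e e0) A := @nsq_horner_cvg q z0.
  have /cvgrPdist_le/(_ e e0) B := wtc.
  apply: filterS2 A B => z; rewrite distrC ler_norml => /andP[_ A].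
  rewrite ler_norml => /andP[_ B]; split; first by rewrite /L -lerBlDl.
  by rewrite /w' lerBlDr -lerBlDl.
(* For [t >= x] one has [h * y >= 2 * w'] with [y = t * L * r / 2]; with [exp (- y) <= 1 / (1 + y)],
   the truncation error is then at most [h / L]. *)
pose x := 4 * w' / (h * L * r).
have x0 : 0 <= x by rewrite divr_ge0 ?mulr_ge0 // ltW.
exists (Num.bound x) => k kx; set t := k.+1%:R ^+ 2.
have tx : x <= t.
  apply: (@le_trans _ _ k.+1%:R).
    by apply: le_trans (ltW (archi_boundP x0)) _; rewrite ler_nat ltnW.
  by rewrite /t expr2 ler_peMr // ler1n.
have t0 : 0 < t by rewrite exprn_gt0.
have Hz z : nsq (z - z0) <= r -> nsq p.[z] <= L * nsq (z - z0) /\ w' <= wt z.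
  move=> zr; have [qL wL] := Hr _ zr; split => //.
  by rewrite pq hornerM hornerXsubC nsqM ler_wpM2r ?nsq_ge0.
have := zero_kernel_lower wt0 mwt L0 w'0 r0 t0 Hz.
set J := (\int[_]_g _)%E => A.
rewrite -(leeD2rE _ _ (_ : (2 * w' / L * expR (- (t * L * r / 2)))%:E \is a fin_num)) //.
apply: le_trans A; rewrite -EFinD lee_fin.
rewrite [leRHS](_ : _ = c + h / L); last first.
  by rewrite /h; field; rewrite gt_eqF.
rewrite lerD2l mulrAC ler_wpM2r ?invr_ge0 ?(ltW L0) //.
pose y := t * L * r / 2; have y0 : 0 <= y by rewrite !mulr_ge0 // ltW.
have ey : expR (- y) <= (1 + y)^-1.
  by rewrite expRN lef_pV2 ?posrE ?expR_gt0 ?ltr_wpDr // expR_ge1Dx.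
apply: (@le_trans _ _ (2 * w' * (1 + y)^-1)).
  by rewrite ler_wpM2l // mulr_ge0.
rewrite ler_pdivrMr ?ltr_wpDr //.
suff : 2 * w' <= h * y by move: h0; clearbody h y; lra.
have : x * (h * L * r) <= t * (h * L * r).
  by rewrite ler_wpM2r // !mulr_ge0 // ltW.
rewrite /x divfK ?gt_eqF ?mulr_gt0 // /y; clearbody h w' L t; lra.
Qed.

End Chart.

(** * The chart density and double zeros *)

(* The library attaches to a product of measures the sub-probability instance
   only, so that a product of sigma-finite measures is not recognized as such. *)
Section ComplexLebesgue.
Variable R : realType.
Local Notation leb := (@lebesgue_measure R).
Local Notation C2 := (measurableTypeR R * measurableTypeR R)%type.

Definition complex_lebesgue : set C2 -> \bar R := (leb \x leb)%E.

HB.instance Definition _ := Measure.copy complex_lebesgue (leb \x leb)%E.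

Lemma sigma_finite_complex_lebesgue : sigma_finite setT complex_lebesgue.
Proof.
have /sigma_finiteP[F [TF ndF Foo]] := sigma_finiteT leb.
exists (fun n => F n `*` F n).
  apply/seteqP; split=> // -[x y] _.
  have [n _ Fx] : (\bigcup_n F n) x by rewrite -TF.
  have [m _ Fy] : (\bigcup_n F n) y by rewrite -TF.
  exists (maxn n m) => //; split.
    exact: (subsetPset _ _ (ndF _ _ (leq_maxl n m))).
  exact: (subsetPset _ _ (ndF _ _ (leq_maxr n m))).
move=> n; have [mF Fy] := Foo n; split; first exact: measurableX.
rewrite /complex_lebesgue product_measure1E //.
by rewrite lte_mul_pinfty // ge0_fin_numE.
Qed.

HB.instance Definition _ := Measure_isSigmaFinite.Build _ _ _
  complex_lebesgue sigma_finite_complex_lebesgue.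

End ComplexLebesgue.

Section ChartMass.
Variable R : realType.
Local Notation leb := (@lebesgue_measure R).
Local Notation leb2 := (leb \x leb)%E.
Implicit Types (z : R[i]) (p : {poly R[i]}).

Definition chart_density z : R := (1 + nsq z) ^- 2.

Lemma chart_density_gt0 z : 0 < chart_density z.
Proof. by rewrite invr_gt0 exprn_gt0 // ltr_wpDr // nsq_ge0. Qed.

Lemma measurable_chart_density :
  measurable_fun setT (fun g : R * R => chart_density (toC g)).
Proof.
apply: measurable_inv_pos => [|g]; last first.
  by rewrite exprn_gt0 // ltr_wpDr // nsq_ge0.
apply: measurable_funX; apply: measurable_funD => //.
exact: measurable_nsq_toC.
Qed.

(** Here [|p|^2 <= K |z - z0|^4] near [z0], so the integrand is at least a constant [B] on the disc
    [|z - z0|^2 <= 2 / 4^k], whose area is of order [4^-k]. *)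
Lemma double_zero_lower p z0 : root p z0 -> p^`().[z0] = 0 ->
  exists2 c : R, 0 < c & forall k, (0 < k)%N ->
    ((c / 4 ^+ k)%:E <= \int[leb2]_g
       (chart_density (toC g) * expR (- (16 ^+ k * nsq p.[toC g])))%:E)%E.
Proof.
move=> /factor_theorem[q pq] dp0.
have /factor_theorem[h qh] : root q z0.
  rewrite rootE; move: dp0; rewrite pq derivM derivXsubC mulr1 hornerD hornerM.
  by rewrite hornerXsubC subrr mulr0 add0r => ->.
have [K K0 hK] := nsq_horner_bounded h z0.
(* A lower bound of the chart density on the unit disc around [z0], as
   [|z|^2 <= 2 |z - z0|^2 + 2 |z0|^2]. *)
pose m0 := (3 + 2 * nsq z0) ^- 2.
have Z0 := nsq_ge0 z0.
have m0_gt0 : 0 < m0 by rewrite invr_gt0 exprn_gt0 // ltr_wpDr // mulr_ge0.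
have pi0 : 0 < pi :> R by exact: pi_gt0.
pose B := m0 * expR (- (4 * K)).
have B0 : 0 < B by rewrite mulr_gt0 ?expR_gt0.
(* This makes [1 - 2 / e] at least [1 / 9], the constant in the witness. *)
have e2 : expR (- 1) <= 4 / 9 :> R.
  have H : 3 / 2 <= expR (1 / 2) :> R.
    by apply: le_trans (expR_ge1Dx _); lra.
  have E : expR 1 = expR (1 / 2) * expR (1 / 2) :> R.
    by rewrite -expRD; congr expR; lra.
  rewrite expRN; have -> : 4 / 9 = (9 / 4)^-1 :> R by field.
  rewrite lef_pV2 ?posrE ?expR_gt0 ?divr_gt0 //.
  by rewrite E; nra.
exists (B * pi / 9); first by rewrite divr_gt0 // mulr_gt0.
move=> k k0; pose s : R := 4 ^+ k.
have s0 : 0 < s by rewrite exprn_gt0.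
have s4 : 4 <= s by rewrite /s -(prednK k0) exprS ler_peMr // exprn_ege1 // ler1n.
pose F g := chart_density (toC g) * expR (- (16 ^+ k * nsq p.[toC g])).
have F0 g : 0 <= F g by rewrite mulr_ge0 ?expR_ge0 // ltW // chart_density_gt0.
have mF : measurable_fun setT (fun g => (F g)%:E).
  apply/measurable_EFinP; apply: measurable_funM; first exact: measurable_chart_density.
  apply: measurableT_comp => //; apply: measurable_funN.
  apply: measurable_funM => //; apply: measurable_nsq.
  exact: cmeasurable_horner.
pose G a g := expR (- (a * nsq (toC g - z0))).
have mG a : measurable_fun setT (fun g => (G a g)%:E).
  by apply/measurable_EFinP; exact: measurable_gauss_center.
have G0 a g : 0 <= G a g by exact: expR_ge0.
have I (b a : R) : 0 <= b -> 0 < a ->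
    (\int[leb2]_g (b%:E * (G a g)%:E) = (b * (pi / a))%:E)%E.
  move=> b0 a0; rewrite ge0_integralZl_EFin //;
    [|by move=> g _; rewrite lee_fin|exact: mG].
  by rewrite integral_gauss_center // -EFinM.
have Be0 : 0 <= B * expR (- 1) by rewrite mulr_ge0 ?expR_ge0 // ltW.
(* In place of the area of the disc [s x <= 2], a difference of Gaussians is integrated: [B exp (- s
   x) - B exp (- 1) exp (- s x / 2)] is at most [B] inside the disc and negative outside. *)
have main : ((B * (pi / s))%:E <= \int[leb2]_g (F g)%:E +
    (B * expR (- 1) * (pi / (s / 2)))%:E)%E.
  rewrite -(I B s (ltW B0) s0) -(I _ (s / 2) Be0 (divr_gt0 s0 _)) //.
  rewrite -ge0_integralD //; last 3 first.
  - by move=> g _; rewrite lee_fin.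
  - by move=> g _; rewrite mule_ge0 ?lee_fin.
  - by apply: measurable_funeM; exact: mG.
  apply: ge0_le_integral => //.
  - by move=> g _; rewrite mule_ge0 ?lee_fin // ltW.
  - by apply: measurable_funeM; exact: mG.
  - by apply: emeasurable_funD => //; apply: measurable_funeM; exact: mG.
  move=> g _; rewrite -!EFinM -EFinD lee_fin.
  set x := nsq (toC g - z0).
  have x0 : 0 <= x by exact: nsq_ge0.
  have [xs|xs] := leP (s * x) 2; last first.
    apply: ler_wpDl => //; rewrite -[leRHS]mulrA; apply: ler_wpM2l; first exact: ltW.
    by rewrite /G -expRD ler_expR -/x; lra.
  apply: ler_wpDr; first by rewrite mulr_ge0.
  have x1 : x <= 1.
    have : 4 * x <= s * x by rewrite ler_wpM2r.
    lra.
  have G1 : G s g <= 1.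
    by rewrite -[leRHS]expR0 ler_expR oppr_le0 mulr_ge0 // ltW.
  apply: (@le_trans _ _ B); first by rewrite ler_piMr // ltW.
  apply: ler_pM; [exact: ltW|exact: expR_ge0| |].
    have a1 : 0 < 1 + nsq (toC g) by rewrite ltr_wpDr ?nsq_ge0.
    have a2 : 0 < 3 + 2 * nsq z0 by rewrite ltr_wpDr ?mulr_ge0.
    rewrite /m0 /chart_density lef_pV2 ?posrE ?exprn_gt0 //.
    rewrite lerXn2r ?nnegrE ?(ltW a1) ?(ltW a2) //.
    have : nsq (toC g) <= 2 * x + 2 * nsq z0.
      by rewrite -{1}[toC g](subrK z0); exact: nsqD_le.
    lra.
  rewrite ler_expR lerN2 pq qh !hornerM !hornerXsubC !nsqM -/x.
  have hx := hK _ x1.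
  have -> : 16 ^+ k = s * s :> R.
    by rewrite /s -exprMn; congr (_ ^+ _); lra.
  rewrite (_ : s * s * _ = nsq h.[toC g] * (s * x) ^+ 2); last by ring.
  rewrite mulrC; apply: ler_pM; rewrite ?nsq_ge0 ?sqr_ge0 //.
  have sx0 : 0 <= s * x by rewrite mulr_ge0 // ltW.
  nra.
rewrite -(leeD2rE _ _ (_ : (B * expR (- 1) * (pi / (s / 2)))%:E \is a fin_num)) //.
apply: le_trans main; rewrite -EFinD lee_fin.
have -> : B * pi / 9 / s + B * expR (-1) * (pi / (s / 2)) =
   B * (pi / s) * (1 / 9 + 2 * expR (- 1)).
  by move: (expR _) (pi) => e pp; field; rewrite gt_eqF.
apply: ler_piMr; last by clear -e2; lra.
by rewrite mulr_ge0 ?divr_ge0 ?(ltW s0) ?(ltW pi0) ?(ltW B0).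
Qed.

(* Integrate [1 - exp (- h |g|^2) <= h |g|^2] and let [h] tend to 0. *)
Lemma second_moment_ge (D : R) : 0 < D ->
  ((D ^- 2)%:E <=
   \int[leb2]_g (pi^-1 * (nsq (toC g) * expR (- (D * nsq (toC g)))))%:E)%E.
Proof.
move=> D0; set M := (X in (_ <= X)%E).
have pi0 : 0 < pi :> R by exact: pi_gt0.
have pV0 : 0 <= pi^-1 :> R by rewrite invr_ge0 ltW.
pose G a (g : R * R) := expR (- (a * nsq (toC g))).
have mG a : measurable_fun setT (G a).
  apply: measurableT_comp => //; apply: measurable_funN.
  by apply: measurable_funM => //; exact: measurable_nsq_toC.
have G0 a g : 0 <= G a g by exact: expR_ge0.
have mGE a : measurable_fun setT (fun g => (pi^-1 * G a g)%:E).
  by apply/measurable_EFinP; apply: measurable_funM.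
have I a : 0 < a -> (\int[leb2]_g (pi^-1 * G a g)%:E = (a^-1)%:E)%E.
  move=> a0; under eq_integral do rewrite EFinM.
  rewrite ge0_integralZl_EFin //;
    [|by move=> g _; rewrite lee_fin|by apply/measurable_EFinP; exact: mG].
  under eq_integral do rewrite /G -[nsq _](congr1 (@nsq R) (subr0 _)).
  rewrite integral_gauss_center // -EFinM; congr (_%:E).
  by rewrite mulrA mulVf ?mul1r // gt_eqF.
pose F g := pi^-1 * (nsq (toC g) * G D g).
have F0 g : 0 <= F g by rewrite !mulr_ge0 ?nsq_ge0.
have mF : measurable_fun setT (fun g => (F g)%:E).
  apply/measurable_EFinP; apply: measurable_funM => //.
  by apply: measurable_funM => //; exact: measurable_nsq_toC.
have M0 : (0 <= M)%E by apply: integral_ge0 => g _; rewrite lee_fin; exact: F0.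
have MH h : 0 < h -> ((D^-1)%:E <= h%:E * M + ((D + h)^-1)%:E)%E.
  move=> h0; have Dh0 : 0 < D + h by rewrite addr_gt0.
  have ME : (h%:E * M = \int[leb2]_g (h%:E * (F g)%:E))%E.
    rewrite ge0_integralZl_EFin // ?(ltW h0) //.
    by move=> g _; rewrite lee_fin; exact: F0.
  have A1 g : setT g -> (0 <= h%:E * (F g)%:E)%E.
    by move=> _; rewrite mule_ge0 ?lee_fin ?(ltW h0) //; exact: F0.
  have A2 : measurable_fun setT (fun g => (h%:E * (F g)%:E)%E).
    by apply: measurable_funeM; exact: mF.
  have A3 a g : setT g -> (0 <= (pi^-1 * G a g)%:E)%E.
    by move=> _; rewrite lee_fin mulr_ge0.
  rewrite ME -(I _ D0) -(I _ Dh0) -ge0_integralD //; [|exact: A3|exact: mGE].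
  apply: ge0_le_integral => //.
  - exact: A3.
  - exact: mGE.
  - by apply: emeasurable_funD; [exact: A2|exact: mGE].
  move=> g _; rewrite -!EFinM -EFinD lee_fin.
  rewrite (_ : h * F g = pi^-1 * (h * (nsq (toC g) * G D g))); last by rewrite /F mulrCA.
  rewrite -mulrDr; apply: ler_wpM2l => //; rewrite /G.
  rewrite (_ : - ((D + h) * nsq (toC g)) = - (D * nsq (toC g)) + - (h * nsq (toC g)));
    last by ring.
  rewrite expRD.
  have := expR_ge1Dx (- (h * nsq (toC g))).
  have := expR_ge0 (- (D * nsq (toC g))).
  set a := expR (- (D * _)); set b := expR (- (h * _)) => a0 xb.
  have : 0 <= a * (b - (1 + - (h * nsq (toC g)))) by rewrite mulr_ge0 // subr_ge0.
  lra.
clearbody M; case: M M0 MH => [m|_ _|//]; last by rewrite leey.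
rewrite !lee_fin => m0 MH.
rewrite -[D ^- 2]mul1r ler_pdivrMr ?exprn_gt0 //; apply/ler_addgt0Pr => e e0.
have q0 : 0 < m * D + 1 by rewrite ltr_wpDl // mulr_ge0 // ltW.
pose h := e / (m * D + 1); have h0 : 0 < h by rewrite divr_gt0.
have he : h * (m * D + 1) = e by rewrite divfK // gt_eqF.
have Dh0 : 0 < D + h by rewrite addr_gt0.
have := MH h h0; rewrite -EFinM -EFinD lee_fin -lerBlDr.
have -> : D^-1 - (D + h)^-1 = h * (D * (D + h))^-1 by field; rewrite !gt_eqF.
rewrite ler_pM2l // -div1r ler_pdivrMr ?mulr_gt0 //; lra.
Qed.

(** [(1 + |z|^2)^-2] is at most the integral over [g] of [|g|^2 exp (- (1 + |z|^2) |g|^2) / pi].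
    After Tonelli the integral over [z] is Gaussian and equals [pi / |g|^2], which cancels [|g|^2]
    and leaves a Gaussian of mass [pi]. *)
Lemma integral_chart_density_le :
  (\int[leb2]_g (chart_density (toC g))%:E <= (pi : R)%:E)%E.
Proof.
have pi0 : 0 < pi :> R by exact: pi_gt0.
have pV0 : 0 <= pi^-1 :> R by rewrite invr_ge0 ltW.
pose C2 := (measurableTypeR R * measurableTypeR R)%type.
pose K (p : C2 * C2) : \bar R :=
  (pi^-1 * (nsq (toC p.2) * expR (- ((1 + nsq (toC p.1)) * nsq (toC p.2)))))%:E.
have mK : measurable_fun setT K.
  apply/measurable_EFinP; apply: measurable_funM => //.
  have m1 : measurable_fun setT (fun p : C2 * C2 => nsq (toC p.1)).
    apply: measurable_nsq; split.
      exact: (measurableT_comp measurable_fst measurable_fst).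
    exact: (measurableT_comp measurable_snd measurable_fst).
  have m2 : measurable_fun setT (fun p : C2 * C2 => nsq (toC p.2)).
    apply: measurable_nsq; split.
      exact: (measurableT_comp measurable_fst measurable_snd).
    exact: (measurableT_comp measurable_snd measurable_snd).
  apply: measurable_funM => //; apply: measurableT_comp => //.
  by apply: measurable_funN; apply: measurable_funM => //; apply: measurable_funD.
have K0 u : (0 <= K u)%E.
  by rewrite lee_fin !mulr_ge0 ?expR_ge0 ?nsq_ge0.
have mF := @measurable_fun_fubini_tonelli_F _ _ C2 C2 R (@complex_lebesgue R) K mK K0.
have mG := @measurable_fun_fubini_tonelli_G _ _ C2 C2 R (@complex_lebesgue R) K mK K0.
apply: (@le_trans _ _ (\int[leb2]_g fubini_F leb2 K g)%E).
  apply: ge0_le_integral.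
  - exact: measurableT.
  - by move=> g _; rewrite lee_fin ltW // chart_density_gt0.
  - by apply/measurable_EFinP; exact: measurable_chart_density.
  - exact: mF.
  - by move=> g _; apply: second_moment_ge; rewrite ltr_wpDr ?nsq_ge0.
rewrite -[leLHS]/(\int[@complex_lebesgue R]_g fubini_F (@complex_lebesgue R) K g)%E.
rewrite -fubini_tonelli1 // fubini_tonelli2 //.
have -> : (pi : R)%:E = (\int[leb2]_g (expR (- (1 * nsq (toC g - 0))))%:E)%E.
  by rewrite integral_gauss_center // divr1.
apply: ge0_le_integral => //.
- by move=> g _; apply: integral_ge0.
- by apply/measurable_EFinP; exact: measurable_gauss_center.
move=> a _; rewrite /fubini_G /K /= mul1r subr0.
(* At [a = 0] the integral over [z] is of the zero function, so only an inequality holds there. *)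
set N := nsq (toC a); have [N0|N0] := eqVneq N 0.
  under eq_integral do rewrite N0 mul0r mulr0.
  by rewrite integral0 lee_fin expR_ge0.
have {}N0 : 0 < N by rewrite lt_neqAle eq_sym N0 nsq_ge0.
have E g : pi^-1 * (N * expR (- ((1 + nsq (toC g)) * N))) =
    (pi^-1 * (N * expR (- N))) * expR (- (N * nsq (toC g - 0))).
  rewrite subr0 (_ : - ((1 + nsq (toC g)) * N) = - N + - (N * nsq (toC g)));
    last by ring.
  by rewrite expRD !mulrA.
under eq_integral do rewrite E EFinM.
rewrite ge0_integralZl_EFin //;
  [|by apply/measurable_EFinP; exact: measurable_gauss_center
   |by rewrite !mulr_ge0 ?expR_ge0 // ltW].
rewrite integral_gauss_center // -EFinM lee_fin le_eqVlt; apply/predU1P; left.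
have pn : pi != 0 :> R by rewrite gt_eqF.
have -> : pi^-1 * (N * expR (- N)) * (pi / N) =
  (pi^-1 * pi) * (N / N) * expR (- N) by ring.
by rewrite mulVf // mulfV ?gt_eqF // !mul1r.
Qed.

End ChartMass.

(** * Expectations at a fixed point *)

Section PencilMeasurability.
Context (R : realType) (dX : measure_display) (X : measurableType dX).
Variables (n d : nat) (a : X -> 'I_d.+1 -> 'M[R[i]]_n) (z : X -> R[i]).
Hypotheses (ma : forall k i j, cmeasurable (fun x => a x k i j))
  (mz : cmeasurable z).

Lemma cmeasurable_pevp i j : cmeasurable (fun x => pevp (a x) (z x) 1 i j).
Proof.
rewrite (_ : (fun x => _) = fun x => \sum_(k < d.+1) z x ^+ k * a x k i j).
  by apply: cmeasurable_sum => k; apply: cmeasurableM => //; exact: cmeasurableX.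
apply/funext => x; rewrite pevpE; apply: eq_bigr => k _.
by rewrite expr1n mulr1.
Qed.

Lemma cmeasurable_det_pevp : cmeasurable (fun x => \det (pevp (a x) (z x) 1)).
Proof. by apply: cmeasurable_det => i j; exact: cmeasurable_pevp. Qed.

Lemma cmeasurable_cofactor i j :
  cmeasurable (fun x => cofactor (pevp (a x) (z x) 1) i j).
Proof.
rewrite /cofactor; apply: cmeasurableM; first exact: cmeasurable_cst.
apply: cmeasurable_det => p q.
rewrite (_ : (fun x => _) = fun x => pevp (a x) (z x) 1 (lift i p) (lift j q)).
  exact: cmeasurable_pevp.
by apply/funext => x; rewrite !mxE.
Qed.

(** The [S_j] of the overview. *)
Definition column_var (A : 'I_d.+1 -> 'M[R[i]]_n) (c : R[i]) (j : 'I_n) : R :=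
  (\sum_(k < d.+1) nsq c ^+ k) * \sum_i nsq (cofactor (pevp A c 1) i j).

Lemma measurable_geom : measurable_fun setT (fun x => \sum_(k < d.+1) nsq (z x) ^+ k).
Proof.
apply: measurable_sum => k; apply: measurable_funX; exact: measurable_nsq.
Qed.

Lemma measurable_column_var j :
  measurable_fun setT (fun x => column_var (a x) (z x) j).
Proof.
apply: measurable_funM; first exact: measurable_geom.
by apply: measurable_sum => i; apply: measurable_nsq; exact: cmeasurable_cofactor.
Qed.

Lemma measurable_tuple_msq : measurable_fun setT (fun x => tuple_msq (a x)).
Proof.
apply: measurable_sum => k; apply: measurable_sum => i; apply: measurable_sum => j.
exact: measurable_nsq.
Qed.

Lemma column_var_sum (A : 'I_d.+1 -> 'M[R[i]]_n) (c : R[i]) :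
  \sum_j column_var A c j = (\sum_(k < d.+1) nsq c ^+ k) * cof_msq A c.
Proof. by rewrite -mulr_sumr /cof_msq exchange_big. Qed.

Lemma mu_weightE (A : 'I_d.+1 -> 'M[R[i]]_n) (c : R[i]) :
  mu_weight A c = chart_density c * (\sum_j column_var A c j) * tuple_msq A.
Proof. by rewrite column_var_sum. Qed.

Lemma column_var_ge0 (A : 'I_d.+1 -> 'M[R[i]]_n) (c : R[i]) j : 0 <= column_var A c j.
Proof.
by rewrite mulr_ge0 // sumr_ge0 // => i _; rewrite ?exprn_ge0 ?nsq_ge0.
Qed.

Lemma measurable_chart_density_comp :
  measurable_fun setT (fun x => chart_density (z x)).
Proof.
apply: measurable_inv_pos => [|x]; last by rewrite exprn_gt0 // ltr_wpDr // nsq_ge0.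
apply: measurable_funX; apply: measurable_funD => //; exact: measurable_nsq.
Qed.

Lemma measurable_mu_weight : measurable_fun setT (fun x => mu_weight (a x) (z x)).
Proof.
rewrite (_ : (fun x => _) = fun x =>
   chart_density (z x) * (\sum_j column_var (a x) (z x) j) * tuple_msq (a x)).
  apply: measurable_funM; last exact: measurable_tuple_msq.
  apply: measurable_funM; first exact: measurable_chart_density_comp.
  by apply: measurable_sum => j; exact: measurable_column_var.
by apply/funext => x; rewrite mu_weightE.
Qed.

Lemma measurable_exp_det (t : R) :
  measurable_fun setT (fun x => expR (- (t * nsq (\det (pevp (a x) (z x) 1))))).
Proof.
apply: measurableT_comp => //; apply: measurable_funN; apply: measurable_funM => //.
by apply: measurable_nsq; exact: cmeasurable_det_pevp.
Qed.

End PencilMeasurability.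

Lemma sum_pair_snd (V : nmodType) (I J : finType) (F : I * J -> V) (j : J) :
  \sum_(e | e.2 == j) F e = \sum_i F (i, j).
Proof.
rewrite (eq_bigr (fun e => F (e.1, e.2))); last by case.
rewrite -(pair_big_dep xpredT (fun _ l => l == j) (fun i l => F (i, l))) /=.
by apply: eq_bigr => i _; rewrite big_pred1_eq.
Qed.

Section FixedPoint.
Context (R : realType) (disp : measure_display) (T : measurableType disp).
Variables (P : probability T R) (n d : nat).
Local Notation I := ('I_d.+1 * 'I_n * 'I_n)%type.
Variable X : I -> T -> R * R.
Hypotheses (mX : forall e, measurable_fun setT (X e))
  (lawX : forall e (B : set (R * R)), measurable B ->
     P (X e @^-1` B) = complex_normal B)
  (indX : mutually_independent P X).
Local Notation Om := (sample_space R I).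
Local Notation "'EX' H" := (\int[P]_w (H (at_sample X w))%:E)%E (at level 10).

Definition sample_tuple (x : Om) : 'I_d.+1 -> 'M[R[i]]_n :=
  fun k => \matrix_(i, j) toC (x (k, i, j)).

Lemma cmeasurable_sample_tuple k i j : cmeasurable (fun x => sample_tuple x k i j).
Proof.
rewrite (_ : (fun x => _) = fun x : Om => toC (x (k, i, j))).
  exact: cmeasurable_entry.
by apply/funext => x; rewrite mxE.
Qed.

Lemma tuple_msq_sample x : tuple_msq (sample_tuple x) = \sum_e nsq (toC (x e)).
Proof.
rewrite (eq_bigr (fun e : I => nsq (toC (x (e.1, e.2))))); last by case.
rewrite -(pair_big xpredT xpredT (fun p j => nsq (toC (x (p, j))))) /=.
rewrite (eq_bigr (fun p : 'I_d.+1 * 'I_n => \sum_j nsq (toC (x (p.1, p.2, j)))));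
  last by case.
rewrite -(pair_big xpredT xpredT (fun k i => \sum_j nsq (toC (x (k, i, j))))) /=.
apply: eq_bigr => k _; apply: eq_bigr => i _; apply: eq_bigr => j _.
by rewrite mxE.
Qed.

Variable z : R[i].

Definition col_set (j : 'I_n) : {set I} := [set e | e.2 == j]%SET.

Definition col_coef (j : 'I_n) (e : I) (x : Om) : R[i] :=
  z ^+ e.1.1 * cofactor (pevp (sample_tuple x) z 1) e.1.2 j.

(** The minor in the cofactor [(i, j)] deletes column [j], hence every entry of [col_set j]. *)
Lemma col_coef_free j e e' : e' \in col_set j -> free_of (col_coef j e) e'.
Proof.
rewrite inE => /eqP e'j x g; rewrite /col_coef; congr (_ * (_ * \det _)).
apply/matrixP => p q; rewrite !mxE !summxE; apply: eq_bigr => k _.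
rewrite !mxE upd_neq //; apply/eqP => E; move: e'j; rewrite -E /= => /eqP.
by rewrite eq_sym (negbTE (neq_lift _ _)).
Qed.

Lemma cmeasurable_col_coef j e : cmeasurable (col_coef j e).
Proof.
apply: cmeasurableM; first exact: cmeasurable_cst.
apply: cmeasurable_cofactor; first exact: cmeasurable_sample_tuple.
exact: cmeasurable_cst.
Qed.

Lemma sum_col (V : nmodType) (F : I -> V) j :
  \sum_(e in col_set j) F e = \sum_k \sum_i F (k, i, j).
Proof.
rewrite (eq_bigl (fun e : I => e.2 == j)) => [|e]; last by rewrite inE.
rewrite sum_pair_snd (eq_bigr (fun p : 'I_d.+1 * 'I_n => F (p.1, p.2, j)));
  last by case.
by rewrite -(pair_big xpredT xpredT (fun k i => F (k, i, j))).
Qed.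

Lemma col_form_val j x :
  form_val (col_set j) (col_coef j) x = \det (pevp (sample_tuple x) z 1).
Proof.
rewrite /form_val sum_col exchange_big /= (expand_det_col _ j).
apply: eq_bigr => i _; rewrite pevpE mulr_suml; apply: eq_bigr => k _.
by rewrite /col_coef expr1n mulr1 mxE /=; ring.
Qed.

Lemma col_form_var j x :
  form_var (col_set j) (col_coef j) x = column_var (sample_tuple x) z j.
Proof.
rewrite /form_var sum_col /column_var mulr_suml; apply: eq_bigr => k _.
by rewrite mulr_sumr; apply: eq_bigr => i _; rewrite nsqM nsqX.
Qed.

Lemma EX_column (t : R) j : 0 <= t ->
  (EX (fun x => t * column_var (sample_tuple x) z j * tuple_msq (sample_tuple x) *
         expR (- (t * nsq (\det (pevp (sample_tuple x) z 1)))))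
   <= (((d + 1) * n ^ 2)%:R - 1)%:E +
      EX (fun x => t * column_var (sample_tuple x) z j
                   / (1 + t * column_var (sample_tuple x) z j) ^+ 2))%E.
Proof.
move=> t0.
have L0 : col_set j != finset.set0.
  by apply/set0Pn; exists (ord0, j, j); rewrite inE.
have := EX_weight mX lawX indX t0 (cmeasurable_col_coef j)
  (fun e e' => @col_coef_free j e e') L0.
rewrite (_ : #|_| = ((d + 1) * n ^ 2)%N); last first.
  by rewrite !card_prod !card_ord -mulnA addn1.
have E1 : (\int[P]_w (t * form_var (col_set j) (col_coef j) (at_sample X w) *
    (\sum_e nsq (toC (at_sample X w e))) *
    expR (- (t * nsq (form_val (col_set j) (col_coef j) (at_sample X w)))))%:E =
  EX (fun x => t * column_var (sample_tuple x) z j * tuple_msq (sample_tuple x) *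
         expR (- (t * nsq (\det (pevp (sample_tuple x) z 1))))))%E.
  by apply: eq_integral => w _; rewrite col_form_val col_form_var tuple_msq_sample.
rewrite E1 => /le_trans; apply; rewrite leeD2lE //.
rewrite le_eqVlt; apply/predU1P; left.
by apply: eq_integral => w _; rewrite col_form_var.
Qed.

(** The diagonal entries of [A_0] enter the pencil with coefficient [z^0 = 1]; resampling these
    makes the bound uniform in [z]. *)
Lemma EX_exp_det k :
  (EX (fun x => expR (- (16 ^+ k * nsq (\det (pevp (sample_tuple x) z 1)))))
   <= ((2 * expR 16) ^+ n / 8 ^+ k)%:E)%E.
Proof.
apply: (EX_gauss_det mX lawX indX (M := fun x => pevp (sample_tuple x) z 1)
  (e := fun i => (ord0, i, i))) => [i j|i x g].
  by apply: cmeasurable_pevp; [exact: cmeasurable_sample_tuple|exact: cmeasurable_cst].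
apply/matrixP => p q; rewrite mxE !pevpE big_ord_recl [in RHS]big_ord_recl /=.
rewrite !mxE addrAC.
have S0 k' : sample_tuple (upd x (ord0, i, i) g) (lift ord0 k') p q =
    sample_tuple x (lift ord0 k') p q by rewrite !mxE upd_neq.
under eq_bigr do rewrite S0.
congr (_ + _).
rewrite expr0 !mul1r expr1n !mul1r; have [->|np] := eqVneq p i; last first.
  by rewrite upd_neq ?mulr0 ?addr0 // !xpair_eqE (negbTE np) andbF.
have [->|nq] := eqVneq q i; first by rewrite updE mulr1 addrC subrK.
by rewrite upd_neq ?mulr0 ?addr0 // !xpair_eqE (negbTE nq) !andbF.
Qed.

End FixedPoint.

Section LeadingCoefficient.
Context (R : realType) (disp : measure_display) (T : measurableType disp).
Variables (P : probability T R) (n d : nat).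
Local Notation I := ('I_d.+1 * 'I_n * 'I_n)%type.
Variable X : I -> T -> R * R.
Hypotheses (mX : forall e, measurable_fun setT (X e))
  (lawX : forall e (B : set (R * R)), measurable B ->
     P (X e @^-1` B) = complex_normal B)
  (indX : mutually_independent P X).

Lemma EX_exp_det_lead k :
  (\int[P]_w (expR (- (16 ^+ k *
       nsq (\det (sample_tuple (at_sample X w) ord_max)))))%:E
   <= ((2 * expR 16) ^+ n / 8 ^+ k)%:E)%E.
Proof.
apply: (EX_gauss_det mX lawX indX (M := fun x => sample_tuple x ord_max)
  (e := fun i => (ord_max, i, i))) => [i j|i x g].
  exact: cmeasurable_sample_tuple.
apply/matrixP => p q; rewrite !mxE.
have [->|np] := eqVneq p i; last first.
  by rewrite upd_neq ?mulr0 ?addr0 // !xpair_eqE (negbTE np) andbF.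
have [->|nq] := eqVneq q i; first by rewrite updE mulr1 addrC subrK.
by rewrite upd_neq ?mulr0 ?addr0 // !xpair_eqE (negbTE nq) !andbF.
Qed.

End LeadingCoefficient.

(** * The majorant of the condition number *)

Section LowerIntegral.
Context d (T : measurableType d) (R : realType) (mu : {measure set T -> \bar R}).
Local Open Scope ereal_scope.

(* No measurability is needed: the library's integral of a nonnegative function
   is the supremum of the integrals of the simple functions below it. *)
Lemma ge0_integral_mono (f g : T -> \bar R) :
  (forall x, 0 <= f x) -> (forall x, f x <= g x) ->
  \int[mu]_x f x <= \int[mu]_x g x.
Proof.
move=> f0 fg; rewrite !ge0_integralTE //; last first.
  by move=> x; exact: le_trans (f0 x) (fg x).
apply: ge_ereal_sup => _ [h /= hf <-]; apply: ereal_sup_ubound.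
by exists h => //= x; exact: le_trans (hf x) (fg x).
Qed.

(** Meant for the logarithm, which may be negative: positive parts grow and negative parts
    shrink. *)
Lemma integral_mono (f g : T -> \bar R) : (forall x, f x <= g x) ->
  \int[mu]_x f x <= \int[mu]_x g x.
Proof.
move=> fg; rewrite integralE [leRHS]integralE.
apply: leeB; apply: ge0_integral_mono => x.
- exact: funepos_ge0.
- by rewrite !funeposE ge_max !le_max fg lexx orbT.
- exact: funeneg_ge0.
- by rewrite !funenegE ge_max !le_max leeN2 fg lexx orbT.
Qed.

End LowerIntegral.

(** * Lower limits of extended real sequences *)

Section LimInf.
Variable R : realType.
Implicit Types (u v : (\bar R)^nat).
Local Open Scope ereal_scope.

Lemma limn_einf_ge u (c : \bar R) (K : nat) :
  (forall k, (K <= k)%N -> c <= u k) -> c <= limn_einf u.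
Proof.
move=> cu; rewrite limn_einf_lim; apply: lime_ge; first exact: is_cvg_einfs.
exists K => // m /= Km; rewrite /einfs /=.
apply: le_ereal_inf_tmp => _ [k /= mk <-]; apply: cu; exact: leq_trans Km mk.
Qed.

Lemma limn_einf_le u v : (forall k, u k <= v k) -> limn_einf u <= limn_einf v.
Proof.
move=> uv; rewrite !limn_einf_lim.
apply: lee_lim; [exact: is_cvg_einfs|exact: is_cvg_einfs|].
apply: nearW => m; rewrite /einfs /=; apply: le_ereal_inf_tmp => _ [k mk <-].
by apply: le_trans (uv k); apply: ereal_inf_lbound; exists k.
Qed.

Lemma limn_einf_pinfty u (c : R) : (0 < c)%R ->
  (forall k, (0 < k)%N -> (c * (3 / 2) ^+ k)%:E <= u k) -> limn_einf u = +oo.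
Proof.
move=> c0 cu; apply: eq_infty => A.
have bern k : (1 + k%:R / 2 <= (3 / 2) ^+ k :> R)%R.
  elim: k => [|k IH]; first by rewrite expr0 mul0r addr0.
  rewrite exprS -addn1 natrD; have : (0 <= k%:R :> R)%R by [].
  by move: IH; move: (_ ^+ k)%R (k%:R)%R => p q; lra.
pose x := (2 * `|A| / c)%R; have x0 : (0 <= x)%R by rewrite divr_ge0 ?mulr_ge0 // ltW.
apply: (limn_einf_ge (K := (Num.bound x).+1)) => k kx.
have k0 : (0 < k)%N by exact: leq_trans kx.
apply: le_trans (cu k k0); rewrite lee_fin.
apply: le_trans (ler_norm A) _; rewrite -ler_pdivrMl //.
apply: le_trans (bern k); have : (x <= k%:R)%R.
  apply: le_trans (ltW (archi_boundP x0)) _; rewrite ler_nat; exact: ltnW.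
have -> : (x = 2 * (c^-1 * `|A|))%R by rewrite /x -mulrA (mulrC (c^-1)%R).
by move: (_ * `|A|)%R => y; lra.
Qed.

End LimInf.

Section Estimator.
Variables (R : realType) (n d : nat).
Hypotheses (n0 : (0 < n)%N) (d0 : (0 < d)%N).
Local Notation leb := (@lebesgue_measure R).
Local Notation leb2 := (leb \x leb)%E.
Implicit Types (A : 'I_d.+1 -> 'M[R[i]]_n) (g : R * R).

Definition main_integrand (k : nat) A g : R :=
  zero_kernel (det_pencil A) (k.+1%:R ^+ 2) g * mu_weight A (toC g).

Definition degenerate_integrand (k : nat) A g : R :=
  chart_density (toC g) * expR (- (16 ^+ k * nsq (\det (pevp A (toC g) 1)))).

Definition lead_term (k : nat) A : R :=
  expR (- (16 ^+ k * nsq (\det (A ord_max)))).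

Definition mu_estimator (k : nat) A : \bar R :=
  (\int[leb2]_g (main_integrand k A g)%:E +
   (6 ^+ k)%:E * (\int[leb2]_g (degenerate_integrand k A g)%:E + (lead_term k A)%:E))%E.

Lemma main_integrand_ge0 k A g : 0 <= main_integrand k A g.
Proof.
by rewrite mulr_ge0 ?mu_weight_ge0 // zero_kernel_ge0 // sqr_ge0.
Qed.

Lemma degenerate_integrand_ge0 k A g : 0 <= degenerate_integrand k A g.
Proof. by rewrite mulr_ge0 ?expR_ge0 // ltW // chart_density_gt0. Qed.

Lemma measurable_mu_weight_toC A :
  measurable_fun setT (fun g : R * R => mu_weight A (toC g)).
Proof.
apply: measurable_mu_weight; last exact: cmeasurable_toC.
by move=> k i j; exact: cmeasurable_cst.
Qed.

Lemma int_main_ge0 k A : (0 <= \int[leb2]_g (main_integrand k A g)%:E)%E.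
Proof. by apply: integral_ge0 => g _; rewrite lee_fin main_integrand_ge0. Qed.

Lemma int_degenerate_ge0 k A : (0 <= \int[leb2]_g (degenerate_integrand k A g)%:E)%E.
Proof. by apply: integral_ge0 => g _; rewrite lee_fin degenerate_integrand_ge0. Qed.

Lemma mu_estimator_ge0 k A : (0 <= mu_estimator k A)%E.
Proof.
rewrite adde_ge0 ?int_main_ge0 // mule_ge0 ?lee_fin ?exprn_ge0 //.
by rewrite adde_ge0 ?int_degenerate_ge0 // lee_fin expR_ge0.
Qed.

Lemma cvg_sumr (F : set_system R[i]) (I : finType) (f : I -> R[i] -> R) (l : I -> R) :
  Filter F -> (forall i, f i z @[z --> F] --> l i) ->
  \sum_i f i z @[z --> F] --> \sum_i l i.
Proof. by move=> FF fl; apply: cvg_big => [|i _]; [exact: add_continuous|exact: fl]. Qed.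

Lemma cof_msq_cvg A z0 : cof_msq A z @[z --> near_point z0] --> cof_msq A z0.
Proof.
pose p i j := cofactor (pevp (polyc_mx A) 'X 1%:P) i j.
have pE z i j : cofactor (pevp A z 1) i j = (p i j).[z].
  rewrite -[RHS]/(horner_eval z _) -cofactor_map_mx map_pevp_poly.
  by rewrite hornerX hornerC.
rewrite /cof_msq; under eq_fun do under eq_bigr do under eq_bigr do rewrite pE.
under eq_bigr do under eq_bigr do rewrite pE.
by apply: cvg_sumr => i; apply: cvg_sumr => j; exact: nsq_horner_cvg.
Qed.

Lemma nsq_cvg (z0 : R[i]) : nsq z @[z --> near_point z0] --> nsq z0.
Proof.
by have := @nsq_horner_cvg R 'X z0; under eq_fun do rewrite hornerX; rewrite hornerX.
Qed.

Lemma mu_weight_cvg A z0 :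
  mu_weight A z @[z --> near_point z0] --> mu_weight A z0.
Proof.
apply: cvgM; last exact: cvg_cst.
apply: cvgM.
  apply: cvgV; first by rewrite expf_neq0 // gt_eqF // ltr_wpDr // nsq_ge0.
  apply: (continuous_cvg _ (@exprn_continuous R 2 _)).
  by apply: cvgD; [exact: cvg_cst|exact: nsq_cvg].
apply: cvgM; last exact: cof_msq_cvg.
by apply: cvg_sumr => k; apply: (continuous_cvg _ (@exprn_continuous R k _)); exact: nsq_cvg.
Qed.

(** Deterministic, and valid for every [A]. If [det A_d = 0], the lead term alone gives [6^k]; at a
    double zero the degenerate integral gives [6^k * c / 4^k = c * (3 / 2)^k]. Otherwise every
    eigenvalue is finite and simple, and the main integral is eventually above each value
    [w / |f'|^2 - e]. *)
Lemma mu_max_sqr_le_liminf A :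
  (mu_max A ^+ 2 <= limn_einf (fun k => mu_estimator k A))%E.
Proof.
have tail (c : R) k : (c%:E <= \int[leb2]_g (degenerate_integrand k A g)%:E +
     (lead_term k A)%:E)%E -> ((6 ^+ k * c)%:E <= mu_estimator k A)%E.
  move=> cU; apply: (@le_trans _ _ (0 + (6 ^+ k * c)%:E)%E); first by rewrite add0e.
  apply: leeD; first exact: int_main_ge0.
  by rewrite EFinM; apply: lee_wpmul2l => //; rewrite lee_fin exprn_ge0.
have [Ad|Ad] := eqVneq (\det (A ord_max)) 0.
  rewrite (limn_einf_pinfty (c := 1)) ?leey // => k _.
  apply: (@le_trans _ _ (6 ^+ k * 1)%:E).
    by rewrite lee_fin mul1r mulr1 lerXn2r ?nnegrE //; lra.
  apply: tail; rewrite /lead_term Ad nsq0 mulr0 oppr0 expR0.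
  apply: (@le_trans _ _ (0 + 1)%E); first by rewrite add0e.
  by rewrite leeD2r // int_degenerate_ge0.
have [[z [fz dz]]|simple] :=
    pselect (exists z, \det (pevp A z 1) = 0 /\ char_deriv A z = 0).
  have rz : root (det_pencil A) z by rewrite rootE det_pencilE fz.
  have dfz : (det_pencil A)^`().[z] = 0 by rewrite det_pencil_deriv.
  have [c c0 H] := double_zero_lower rz dfz.
  rewrite (limn_einf_pinfty (c := c)) ?leey // => k k0.
  have -> : c * (3 / 2) ^+ k = 6 ^+ k * (c / 4 ^+ k).
    rewrite mulrCA -expr_div_n; congr (_ * _ ^+ _); lra.
  apply: tail; apply: le_trans (H k k0) _.
  apply: (@le_trans _ _ (\int[leb2]_g (degenerate_integrand k A g)%:E + 0)%E).
    rewrite adde0 le_eqVlt; apply/predU1P; left; apply: eq_integral => g _.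
    by rewrite /degenerate_integrand det_pencilE.
  by rewrite leeD2l // lee_fin expR_ge0.
apply: mu_max_sqr_le => // z fz.
  by apply/eqP => dz; apply: simple; exists z.
have dz : char_deriv A z != 0 by apply/eqP => dz; apply: simple; exists z.
have rz : root (det_pencil A) z by rewrite rootE det_pencilE fz.
have dfz : (det_pencil A)^`().[z] != 0 by rewrite det_pencil_deriv.
apply/lee_subgt0Pr => e e0; rewrite -EFinB.
have := simple_zero_lower rz dfz (mu_weight_ge0 A) (measurable_mu_weight_toC A)
  (@mu_weight_cvg A z).
rewrite det_pencil_deriv => /(_ (mu_weight A z / nsq (char_deriv A z) - e)).
rewrite ltrBlDr ltrDl => /(_ e0) [K HK].
apply: (limn_einf_ge (K := K)) => k Kk; apply: le_trans (HK k Kk) _.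
rewrite /mu_estimator -[leLHS]adde0; apply: leeD => //.
rewrite mule_ge0 ?lee_fin ?exprn_ge0 //.
by rewrite adde_ge0 ?int_degenerate_ge0 // lee_fin expR_ge0.
Qed.

End Estimator.

(** * Expectation of the majorant *)

Section Expectation.
Context (R : realType) (disp : measure_display) (T : measurableType disp).
Variables (P : probability T R) (n d : nat).
Hypothesis n0 : (0 < n)%N.
Local Notation I := ('I_d.+1 * 'I_n * 'I_n)%type.
Variable X : I -> T -> R * R.
Hypotheses (mX : forall e, measurable_fun setT (X e))
  (lawX : forall e (B : set (R * R)), measurable B ->
     P (X e @^-1` B) = complex_normal B)
  (indX : mutually_independent P X).
Local Notation C2 := (measurableTypeR R * measurableTypeR R)%type.
Local Notation Leb := (@complex_lebesgue R).
Local Notation tup w := (sample_tuple (at_sample X w)).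
Local Notation N := ((((d + 1) * n ^ 2)%:R - 1) : R).

Lemma cmeasurable_tup k i j : cmeasurable (fun p : T * C2 => tup p.1 k i j).
Proof.
rewrite (_ : (fun p => _) = fun p : T * C2 => toC (X (k, i, j) p.1)).
  have m1 : measurable_fun setT (fun p : T * C2 => X (k, i, j) p.1).
    by apply: measurableT_comp (mX _) _; exact: measurable_fst.
  split; apply: measurableT_comp m1; [exact: measurable_fst|exact: measurable_snd].
by apply/funext => p; rewrite mxE.
Qed.

Lemma cmeasurable_point : cmeasurable (fun p : T * C2 => toC p.2).
Proof.
have m2 : measurable_fun setT (fun p : T * C2 => p.2 : R * R).
  exact: measurable_snd.
split; apply: measurableT_comp m2; [exact: measurable_fst|exact: measurable_snd].
Qed.

(** The [o(1)] terms of the overview, summed over the columns and weighted by the normalized chart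
    density. *)
Definition excess (k : nat) (p : T * C2) : R :=
  chart_density (toC p.2) / pi *
  \sum_j (k.+1%:R ^+ 2 * column_var (tup p.1) (toC p.2) j
          / (1 + k.+1%:R ^+ 2 * column_var (tup p.1) (toC p.2) j) ^+ 2).

Lemma measurable_main k :
  measurable_fun setT (fun p : T * C2 => main_integrand k (tup p.1) p.2).
Proof.
rewrite (_ : (fun p => _) = fun p : T * C2 => k.+1%:R ^+ 2 / pi *
   expR (- (k.+1%:R ^+ 2 * nsq (\det (pevp (tup p.1) (toC p.2) 1)))) *
   mu_weight (tup p.1) (toC p.2)); last first.
  by apply/funext => p; rewrite /main_integrand /zero_kernel det_pencilE.
apply: measurable_funM; last first.
  exact: measurable_mu_weight cmeasurable_tup cmeasurable_point.
apply: measurable_funM => //.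
exact: measurable_exp_det cmeasurable_tup cmeasurable_point _.
Qed.

Lemma measurable_degenerate k :
  measurable_fun setT (fun p : T * C2 => degenerate_integrand k (tup p.1) p.2).
Proof.
apply: measurable_funM; first exact: measurable_chart_density_comp cmeasurable_point.
exact: measurable_exp_det cmeasurable_tup cmeasurable_point _.
Qed.

Lemma frac_ge0 (s : R) : 0 <= s -> 0 <= s / (1 + s) ^+ 2.
Proof. by move=> s0; rewrite divr_ge0 ?sqr_ge0. Qed.

Lemma frac_le1 (s : R) : 0 <= s -> s / (1 + s) ^+ 2 <= 1.
Proof.
move=> s0; rewrite ler_pdivrMr ?exprn_gt0 ?ltr_wpDr // mul1r expr2.
by rewrite mulrDl mul1r mulrDr mulr1 -addrA addrCA lerDl; nra.
Qed.

Lemma frac_leV (s : R) : 0 <= s -> s / (1 + s) ^+ 2 <= s^-1.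
Proof.
rewrite le_eqVlt => /predU1P[<-|s0]; first by rewrite mul0r invr0.
rewrite ler_pdivrMr ?exprn_gt0 ?ltr_wpDr ?(ltW s0) //.
by rewrite ler_pdivlMl //; nra.
Qed.

Lemma excess_ge0 k p : 0 <= excess k p.
Proof.
rewrite mulr_ge0 ?divr_ge0 ?pi_ge0 ?(ltW (chart_density_gt0 _)) //.
by apply: sumr_ge0 => j _; rewrite frac_ge0 // mulr_ge0 ?sqr_ge0 ?column_var_ge0.
Qed.

Lemma excess_le k p : excess k p <= chart_density (toC p.2) / pi * n%:R.
Proof.
rewrite ler_wpM2l ?divr_ge0 ?pi_ge0 ?(ltW (chart_density_gt0 _)) //.
have -> : n%:R = \sum_(j < n) 1 :> R by rewrite sumr_const card_ord.
by apply: ler_sum => j _; rewrite frac_le1 // mulr_ge0 ?sqr_ge0 ?column_var_ge0.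
Qed.

Lemma measurable_excess k : measurable_fun setT (excess k).
Proof.
apply: measurable_funM.
  apply: measurable_funM => //.
  exact: measurable_chart_density_comp cmeasurable_point.
apply: measurable_sum => j.
have mS : measurable_fun setT (fun p : T * C2 =>
    k.+1%:R ^+ 2 * column_var (tup p.1) (toC p.2) j).
  apply: measurable_funM => //.
  exact: measurable_column_var cmeasurable_tup cmeasurable_point _.
apply: measurable_funM => //; apply: measurable_inv_pos => [|p].
  by apply: measurable_funX; apply: measurable_funD.
by rewrite exprn_gt0 // ltr_wpDr // mulr_ge0 ?sqr_ge0 ?column_var_ge0.
Qed.

Lemma integral_density_le (c : R) : 0 <= c ->
  (\int[Leb]_g (c * chart_density (toC g))%:E <= (c * pi)%:E)%E.
Proof.
move=> c0; under eq_integral do rewrite EFinM.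
rewrite ge0_integralZl_EFin //; last first.
- by apply/measurable_EFinP; exact: measurable_chart_density.
- by move=> g _; rewrite lee_fin ltW // chart_density_gt0.
by rewrite EFinM lee_wpmul2l // ?lee_fin //; exact: integral_chart_density_le.
Qed.

(** Dominated convergence: [s / (1 + s)^2 <= 1] gives the integrable majorant, and
    [s / (1 + s)^2 <= 1 / s] the pointwise limit. Where some [S_j] vanishes its summand is 0, in
    agreement with the convention [0^-1 = 0], so no null set has to be removed. *)
Lemma excess_cvg0 :
  (\int[P \x Leb]_p (excess k p)%:E)%E @[k --> \oo] --> 0%E.
Proof.
have -> : 0%E = (\int[P \x Leb]_p (cst 0 p))%E by rewrite integral0.
pose D (p : T * C2) := (n%:R / pi * chart_density (toC p.2))%:E.
have D0 p : (0 <= D p)%E.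
  by rewrite lee_fin mulr_ge0 ?divr_ge0 ?pi_ge0 // ltW // chart_density_gt0.
have mD : measurable_fun setT D.
  apply/measurable_EFinP; apply: measurable_funM => //.
  exact: measurable_chart_density_comp cmeasurable_point.
apply: (@dominated_cvg _ _ _ _ _ _ _ _ D) => //.
- by move=> k; apply/measurable_EFinP; exact: measurable_excess.
- move=> p _; apply: cvg_EFin; first exact: nearW.
  pose S j := column_var (tup p.1) (toC p.2) j.
  pose c := chart_density (toC p.2) / pi * \sum_j (S j)^-1.
  apply: (@squeeze_cvgr _ _ _ _ (fun=> 0) (fun k => c * harmonic k)).
  + apply: nearW => k; rewrite excess_ge0 /c /harmonic -mulrA.
    rewrite ler_wpM2l ?divr_ge0 ?pi_ge0 ?(ltW (chart_density_gt0 _)) //.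
    rewrite mulr_suml; apply: ler_sum => j _.
    apply: le_trans (frac_leV _) _; first by rewrite mulr_ge0 ?sqr_ge0 ?column_var_ge0.
    rewrite invfM mulrC ler_wpM2l ?invr_ge0 ?column_var_ge0 //.
    rewrite lef_pV2 ?posrE ?exprn_gt0 // expr2 ler_peMr // ler1n //.
  + exact: cvg_cst.
  + rewrite -[X in _ --> X](mulr0 c); apply: cvgM; first exact: cvg_cst.
    exact: cvg_harmonic.
- apply/integrableP; split => //.
  under eq_integral do rewrite gee0_abs //.
  rewrite fubini_tonelli1 //.
  apply: (@le_lt_trans _ _ (\int[P]_w (n%:R / pi * pi)%:E)%E); last first.
    by rewrite integral_cst // [X in (_ * X)%E](probability_setT P) mule1 ltry.
  apply: ge0_integral_mono => w; first exact: integral_ge0.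
  by apply: integral_density_le; rewrite divr_ge0 ?pi_ge0.
- move=> k p _; rewrite gee0_abs ?lee_fin ?excess_ge0 //.
  by apply: le_trans (excess_le k p) _; rewrite -!mulrA mulrC -!mulrA mulrCA mulrC -!mulrA.
Qed.

Lemma fubini_swap (f : T * C2 -> R) : measurable_fun setT f -> (forall p, 0 <= f p) ->
  (\int[P]_w \int[Leb]_g (f (w, g))%:E = \int[Leb]_g \int[P]_w (f (w, g))%:E)%E.
Proof.
move=> mf f0.
have mF : measurable_fun setT (fun p => (f p)%:E) by exact/measurable_EFinP.
by apply: (@fubini_tonelli _ _ T C2 R P Leb (fun p => (f p)%:E)).
Qed.

Lemma measurable_section (f : T * C2 -> R) g : measurable_fun setT f ->
  measurable_fun setT (fun w => (f (w, g))%:E).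
Proof.
move=> mf; apply/measurable_EFinP; apply: measurableT_comp mf _.
by apply: measurable_fun_pair.
Qed.

Lemma pred_dimension_ge0 : 0 <= N.
Proof. by rewrite subr_ge0 ler1n muln_gt0 addn1 expn_gt0 n0. Qed.

(** The weight is a sum over the columns [j], and [EX_column] bounds each of them by [N] plus an
    error: hence the factor [n]. *)
Lemma integral_main_at k g :
  (\int[P]_w (main_integrand k (tup w) g)%:E <=
   (N * n%:R / pi * chart_density (toC g))%:E + \int[P]_w (excess k (w, g))%:E)%E.
Proof.
set c := chart_density (toC g) / pi; set t := k.+1%:R ^+ 2 : R.
have t0 : 0 <= t by exact: sqr_ge0.
have c0 : 0 <= c by rewrite divr_ge0 ?pi_ge0 // ltW // chart_density_gt0.
pose S w j := column_var (tup w) (toC g) j.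
have S0 w j : 0 <= S w j by exact: column_var_ge0.
have mtup i' i j : cmeasurable (fun w => tup w i' i j).
  rewrite (_ : (fun w => _) = fun w => toC (X (i', i, j) w)).
    by split; apply: measurableT_comp (mX _); [exact: measurable_fst|exact: measurable_snd].
  by apply/funext => w; rewrite mxE.
have mS j : measurable_fun setT (S^~ j).
  by apply: measurable_column_var => //; exact: cmeasurable_cst.
pose h j w := t * S w j * tuple_msq (tup w) *
  expR (- (t * nsq (\det (pevp (tup w) (toC g) 1)))).
pose e j w := t * S w j / (1 + t * S w j) ^+ 2.
have h0 j w : 0 <= h j w 
  by rewrite mulr_ge0 ?expR_ge0 // mulr_ge0 ?tuple_msq_ge0 // (mulr_ge0 t0 (S0 w j)).
have e0 j w : 0 <= e j w by exact: frac_ge0 (mulr_ge0 t0 (S0 w j)).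
have mh j : measurable_fun setT (h j).
  apply: measurable_funM; last first.
    by apply: measurable_exp_det => //; exact: cmeasurable_cst.
  apply: measurable_funM; last exact: measurable_tuple_msq.
  exact: measurable_funM.
have me j : measurable_fun setT (e j).
  have mt : measurable_fun setT (fun w => t * S w j) by exact: measurable_funM.
  apply: measurable_funM => //; apply: measurable_inv_pos => [|w].
    by apply: measurable_funX; apply: measurable_funD.
  by rewrite exprn_gt0 // ltr_wpDr // mulr_ge0.
have split_sum (f : 'I_n -> T -> R) : (forall j, measurable_fun setT (f j)) ->
    (forall j w, 0 <= f j w) ->
    (\int[P]_w (c * \sum_j f j w)%:E = c%:E * \sum_j \int[P]_w (f j w)%:E)%E.
  move=> mf f0; under eq_integral do rewrite EFinM -sumEFin.
  rewrite ge0_integralZl_EFin //; last 2 first.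
  - by move=> w _; apply: sume_ge0 => j _; rewrite lee_fin.
  - apply: emeasurable_sum => j; exact/measurable_EFinP.
  congr (_ * _)%E; rewrite ge0_integral_sum //.
  - by move=> j; exact/measurable_EFinP.
  - by move=> j w _; rewrite lee_fin.
have -> : (\int[P]_w (main_integrand k (tup w) g)%:E =
           \int[P]_w (c * \sum_j h j w)%:E)%E.
  apply: eq_integral => w _; congr EFin.
  rewrite /main_integrand mu_weightE /zero_kernel det_pencilE -/t /h -mulr_suml -mulr_suml.
  by rewrite -mulr_sumr /c /S; ring.
rewrite split_sum // [X in (_ <= _ + X)%E](_ : _ =
  \int[P]_w (c * \sum_j e j w)%:E)%E // split_sum //.
apply: (@le_trans _ _ (c%:E * \sum_(j < n) (N%:E + \int[P]_w (e j w)%:E))%E).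
  apply: lee_wpmul2l; rewrite ?lee_fin //; apply: lee_sum => j _.
  exact: (EX_column mX lawX indX (toC g) j t0).
rewrite big_split /= ge0_muleDr; last 2 first.
- by apply: sume_ge0 => j _; rewrite lee_fin pred_dimension_ge0.
- by apply: sume_ge0 => j _; apply: integral_ge0 => w _; rewrite lee_fin.
rewrite leeD2r // sumEFin sumr_const card_ord -EFinM lee_fin -mulr_natr.
by rewrite le_eqVlt; apply/predU1P; left; rewrite /c; ring.
Qed.

Lemma integral_main_le k :
  (\int[P]_w \int[Leb]_g (main_integrand k (tup w) g)%:E <=
   (N * n%:R)%:E + \int[P \x Leb]_p (excess k p)%:E)%E.
Proof.
rewrite (fubini_swap (f := fun p => main_integrand k (tup p.1) p.2)); last 2 first.
- exact: measurable_main.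
- by move=> p; exact: main_integrand_ge0.
have mE : measurable_fun setT (fun p => (excess k p)%:E).
  by apply/measurable_EFinP; exact: measurable_excess.
have E0 p : (0 <= (excess k p)%:E)%E by rewrite lee_fin excess_ge0.
rewrite (fubini_tonelli2 _ mE E0).
have c0 : 0 <= N * n%:R / pi by rewrite divr_ge0 ?pi_ge0 // mulr_ge0 ?pred_dimension_ge0.
apply: (@le_trans _ _ (\int[Leb]_g ((N * n%:R / pi * chart_density (toC g))%:E +
    fubini_G P (fun p => (excess k p)%:E) g))%E).
  apply: ge0_integral_mono => g; last exact: integral_main_at.
  by apply: integral_ge0 => w _; rewrite lee_fin main_integrand_ge0.
rewrite ge0_integralD //.
- rewrite leeD2r //; apply: le_trans (integral_density_le c0) _.
  by rewrite lee_fin divfK // gt_eqF // pi_gt0.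
- by move=> g _; rewrite lee_fin mulr_ge0 // ltW // chart_density_gt0.
- apply/measurable_EFinP; apply: measurable_funM => //.
  exact: measurable_chart_density.
- by move=> g _; apply: integral_ge0.
- exact: measurable_fun_fubini_tonelli_G.
Qed.

Lemma integral_degenerate_le k :
  (\int[P]_w \int[Leb]_g (degenerate_integrand k (tup w) g)%:E <=
   ((2 * expR 16) ^+ n / 8 ^+ k * pi)%:E)%E.
Proof.
rewrite (fubini_swap (f := fun p => degenerate_integrand k (tup p.1) p.2)); last 2 first.
- exact: measurable_degenerate.
- by move=> p; exact: degenerate_integrand_ge0.
have C0 : 0 <= (2 * expR 16) ^+ n / 8 ^+ k :> R.
  by rewrite divr_ge0 ?exprn_ge0 // mulr_ge0 ?expR_ge0.
apply: le_trans (integral_density_le C0).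
apply: ge0_integral_mono => g.
  by apply: integral_ge0 => w _; rewrite lee_fin degenerate_integrand_ge0.
have d0 : 0 <= chart_density (toC g) by rewrite ltW // chart_density_gt0.
rewrite (_ : (\int[P]_w _)%E = (\int[P]_w ((chart_density (toC g))%:E *
    (expR (- (16 ^+ k * nsq (\det (pevp (tup w) (toC g) 1)))))%:E))%E); last first.
  by apply: eq_integral => w _; rewrite -EFinM.
rewrite ge0_integralZl_EFin //.
- rewrite mulrC EFinM lee_wpmul2l ?lee_fin //.
  exact: (EX_exp_det mX lawX indX (toC g) k).
apply: (measurable_section (f := fun p => expR (- (16 ^+ k *
  nsq (\det (pevp (tup p.1) (toC p.2) 1)))))).
exact: measurable_exp_det cmeasurable_tup cmeasurable_point _.
Qed.

End Expectation.

Lemma measurable_fun_limn_einf d (T : measurableType d) (R : realType)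
    (f : (T -> \bar R)^nat) : (forall k, measurable_fun setT (f k)) ->
  measurable_fun setT (fun x => limn_einf (f^~ x)).
Proof.
move=> mf; rewrite (_ : (fun x => _) = fun x => (- limn_esup (fun k => - f k x))%E).
  apply: measurableT_comp => //; apply: measurable_fun_limn_esup => k.
  exact: measurableT_comp.
apply/funext => x; rewrite -[RHS]limn_einfN; congr limn_einf.
by apply/funext => k /=; rewrite oppeK.
Qed.

Section Estimate.
Context (R : realType) (disp : measure_display) (T : measurableType disp).
Variables (P : probability T R) (n d : nat).
Hypothesis n0 : (0 < n)%N.
Local Notation I := ('I_d.+1 * 'I_n * 'I_n)%type.
Variable X : I -> T -> R * R.
Hypotheses (mX : forall e, measurable_fun setT (X e))
  (lawX : forall e (B : set (R * R)), measurable B ->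
     P (X e @^-1` B) = complex_normal B)
  (indX : mutually_independent P X).
Local Notation C2 := (measurableTypeR R * measurableTypeR R)%type.
Local Notation Leb := (@complex_lebesgue R).
Local Notation tup w := (sample_tuple (at_sample X w)).
Local Notation N := ((((d + 1) * n ^ 2)%:R - 1) : R).

Lemma measurable_int_main k : measurable_fun setT
  (fun w => \int[Leb]_g (main_integrand k (tup w) g)%:E)%E.
Proof.
apply: (@measurable_fun_fubini_tonelli_F _ _ T C2 R Leb
  (fun p => (main_integrand k (tup p.1) p.2)%:E)).
  by apply/measurable_EFinP; exact: measurable_main.
by move=> p; rewrite lee_fin main_integrand_ge0.
Qed.

Lemma measurable_int_degenerate k : measurable_fun setT
  (fun w => \int[Leb]_g (degenerate_integrand k (tup w) g)%:E)%E.
Proof.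
apply: (@measurable_fun_fubini_tonelli_F _ _ T C2 R Leb
  (fun p => (degenerate_integrand k (tup p.1) p.2)%:E)).
  by apply/measurable_EFinP; exact: measurable_degenerate.
by move=> p; rewrite lee_fin degenerate_integrand_ge0.
Qed.

Lemma measurable_lead_term k :
  measurable_fun setT (fun w => (lead_term k (tup w))%:E).
Proof.
apply/measurable_EFinP; apply: measurableT_comp => //; apply: measurable_funN.
apply: measurable_funM => //; apply: measurable_nsq; apply: cmeasurable_det => i j.
rewrite (_ : (fun w => _) = fun w => toC (X (ord_max, i, j) w)).
  by split; apply: measurableT_comp (mX _); [exact: measurable_fst|exact: measurable_snd].
by apply/funext => w; rewrite mxE.
Qed.

Lemma measurable_mu_estimator k :
  measurable_fun setT (fun w => mu_estimator k (tup w)).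
Proof.
apply: emeasurable_funD; first exact: measurable_int_main.
apply: measurable_funeM; apply: emeasurable_funD.
  exact: measurable_int_degenerate.
exact: measurable_lead_term.
Qed.

(** The second term is [6^k * C / 8^k * (pi + 1)]: [pi] is the mass of the chart density, 1 comes
    from the lead term. *)
Definition mean_error (k : nat) : \bar R :=
  (\int[P \x Leb]_p (excess X k p)%:E +
   ((2 * expR 16) ^+ n * (pi + 1) * (3 / 4) ^+ k)%:E)%E.

Lemma mean_error_cvg0 : mean_error k @[k --> \oo] --> 0%E.
Proof.
rewrite -[X in _ --> X](adde0 0%E); apply: cvgeD => //.
  exact: excess_cvg0.
apply: cvg_EFin; first exact: nearW.
rewrite -[X in _ --> X](mulr0 ((2 * expR 16) ^+ n * (pi + 1))).
apply: cvgM; first exact: cvg_cst.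
by apply: cvg_expr; rewrite ger0_norm; lra.
Qed.

Lemma integral_mu_estimator_le k :
  (\int[P]_w mu_estimator k (tup w) <= (N * n%:R)%:E + mean_error k)%E.
Proof.
have d0 w : (0 <= \int[Leb]_g (degenerate_integrand k (tup w) g)%:E)%E.
  exact: int_degenerate_ge0.
have l0 w : (0 <= (lead_term k (tup w))%:E)%E by rewrite lee_fin expR_ge0.
have mD := measurable_int_degenerate k.
have mL := measurable_lead_term k.
rewrite ge0_integralD //; last 4 first.
- by move=> w _; exact: int_main_ge0.
- exact: measurable_int_main.
- by move=> w _; rewrite mule_ge0 ?lee_fin ?exprn_ge0 // adde_ge0.
- by apply: measurable_funeM; exact: emeasurable_funD.
rewrite /mean_error [leRHS]addeA; apply: leeD.
  exact: (integral_main_le n0 mX lawX indX k).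
rewrite ge0_integralZl_EFin ?exprn_ge0 //; last 2 first.
- by move=> w _; rewrite adde_ge0.
- exact: emeasurable_funD.
rewrite ge0_integralD //.
set C := (2 * expR 16) ^+ n.
apply: (@le_trans _ _ ((6 ^+ k)%:E * ((C / 8 ^+ k * pi)%:E + (C / 8 ^+ k)%:E))%E).
  apply: lee_wpmul2l; first by rewrite lee_fin exprn_ge0.
  apply: leeD; first exact: (integral_degenerate_le mX lawX indX k).
  exact: (EX_exp_det_lead mX lawX indX k).
rewrite -EFinD -EFinM lee_fin le_eqVlt; apply/predU1P; left.
have -> : (3 / 4) ^+ k = 6 ^+ k / 8 ^+ k :> R.
  by rewrite -expr_div_n; congr (_ ^+ _); lra.
by move: C (6 ^+ k) (8 ^+ k) (@pi R) => c u v q; ring.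
Qed.

Definition mu_liminf w : \bar R := limn_einf (fun k => mu_estimator k (tup w)).

Lemma measurable_mu_liminf : measurable_fun setT mu_liminf.
Proof. by apply: measurable_fun_limn_einf => k; exact: measurable_mu_estimator. Qed.

Lemma mu_liminf_ge0 w : (0 <= mu_liminf w)%E.
Proof. by apply: (limn_einf_ge (K := 0)) => k _; exact: mu_estimator_ge0. Qed.

Lemma integral_mu_liminf : (\int[P]_w mu_liminf w <= (N * n%:R)%:E)%E.
Proof.
apply: le_trans (fatou P measurableT measurable_mu_estimator _) _.
  by move=> k w _; exact: mu_estimator_ge0.
apply: le_trans (limn_einf_le integral_mu_estimator_le) _.
by rewrite limn_einf_shift // (cvg_limn_einf_sup mean_error_cvg0).1 adde0.
Qed.

End Estimate.

(** The tangent inequality [ln u <= u - 1] at [u = m^2 / c]. For infinite [m] the square is [+oo],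
    which a finite [y] excludes; for [m <= 0] the left-hand side is [-oo]. *)
Lemma lne_le_sqr (R : realType) (m y : \bar R) (c : R) :
  0 < c -> (0 <= y)%E -> (m ^+ 2 <= y)%E ->
  (lne m <= (1 / 2 / c)%:E * y + (1 / 2 * (ln c - 1))%:E)%E.
Proof.
move=> c0 y0; have c2 : 0 < 1 / 2 / c by rewrite !divr_gt0.
case: y y0 => [y| |] // y0 my; last first.
  by rewrite gt0_muley ?lte_fin // addye // leey.
case: m my => [r| |] //.
rewrite -EFin_expe lee_fin => ry.
have [r0|r0] := leP r 0; first by rewrite le0_lneNy ?lee_fin // leNye.
rewrite lne_EFin // -EFinM -EFinD lee_fin.
have s0 : 0 < r ^+ 2 / c by rewrite divr_gt0 ?exprn_gt0.
have h : ln (r ^+ 2 / c) <= r ^+ 2 / c - 1.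
  by rewrite -[in leLHS](subrKC 1 (r ^+ 2 / c)) le_ln1Dx //; lra.
rewrite ln_div ?posrE ?exprn_gt0 // lnXn // mulr2n in h.
have : r ^+ 2 / c <= y / c by rewrite ler_wpM2r // invr_ge0 ltW.
have -> : 1 / 2 / c * y = 1 / 2 * (y / c) by ring.
by move: h; move: (r ^+ 2 / c) (y / c) => u v; lra.
Qed.

Theorem corollary1p2 (R : realType) (disp : measure_display)
    (T : measurableType disp) (P : probability T R) (n d : nat)
    (hn : (1 <= n)%N) (hd : (1 <= d)%N)
    (A : T -> 'I_d.+1 -> 'M[R[i]]_n)
    (hA : iid_complex_normal_entries P A) :
  (\int[P]_w (mu_max (A w) ^+ 2)
     <= ((((d + 1) * n ^ 2)%:R - 1) * n%:R)%:E)%E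
  /\
  (\int[P]_w lne (mu_max (A w))
     <= (3 / 2 * ln n%:R + 1 / 2 * ln (d + 1)%:R)%:E)%E.
Proof.
case: hA => mX lawX indX.
set X : 'I_d.+1 * 'I_n * 'I_n -> T -> R * R := fun e w => _ in mX lawX indX.
pose Y := mu_liminf (d := d) (n := n) X.
have AE w : A w = sample_tuple (at_sample X w).
  by apply/funext => k; apply/matrixP => i j; rewrite mxE /= /X /at_sample re_imK.
have AY w : (mu_max (A w) ^+ 2 <= Y w)%E.
  by rewrite AE; exact: mu_max_sqr_le_liminf.
have Y0 w : (0 <= Y w)%E by exact: mu_liminf_ge0.
have intY : (\int[P]_w Y w <= ((((d + 1) * n ^ 2)%:R - 1) * n%:R)%:E)%E.
  exact: (integral_mu_liminf hn mX lawX indX).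
split.
  apply: le_trans intY; apply: ge0_integral_mono => // w.
  exact: sqre_ge0.
(* [c] dominates the first bound, and half its logarithm is exactly the right-hand side of the
   second. *)
pose c : R := (d + 1)%:R * n%:R ^+ 3.
have nR : 0 < n%:R :> R by rewrite ltr0n.
have dR : 0 < (d + 1)%:R :> R by rewrite ltr0n addn1.
have c0 : 0 < c by rewrite mulr_gt0 // exprn_gt0.
(* The constant [(ln c - 1) / 2] may be negative, so linearity is used for integrable functions
   rather than for nonnegative ones. *)
have iY : P.-integrable setT Y.
  apply/integrableP; split; first exact: measurable_mu_liminf.
  under eq_integral do rewrite gee0_abs //.
  by apply: le_lt_trans intY _; rewrite ltry.
apply: le_trans (integral_mono P (fun w => lne_le_sqr c0 (Y0 w) (AY w))) _.
rewrite integralD //; last 2 first.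
- exact: integrableZl.
- exact: finite_measure_integrable_cst.
rewrite integralZl // [X in (_ + X)%E](EX_cst P X).
apply: (@le_trans _ _ ((1 / 2 / c)%:E * c%:E + (1 / 2 * (ln c - 1))%:E)%E).
  rewrite leeD2r // lee_wpmul2l ?lee_fin ?divr_ge0 ?(ltW c0) //.
  apply: le_trans intY _; rewrite lee_fin /c natrM natrX.
  by rewrite mulrBl mul1r (exprSr _ 2) mulrA gerBl.
rewrite -EFinM -EFinD lee_fin divfK ?gt_eqF // /c.
rewrite lnM ?posrE ?exprn_gt0 // lnXn // -mulr_natl.
by move: (ln _) (ln _) => u v; lra.
Qed.
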